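(* Let $\alpha>\frac12$ and $p\ge1$ be fixed such that either $p\in\mathbb{N}$ or $p=\frac{m}{n}$ with $m$ and $n$ even and odd integers, respectively. Then there exist constants $a_0,b_0>0$ such that for any fixed $b\in(-b_0,b_0)$ the equation $-\Lambda^\alpha u-u+u^{p+1}=b$ on $\mathbb{R}$ admits a one-parameter family of even periodic solutions $\{u_{a,b}\}_{a\in(-a_0,a_0)}$ of the form $u_{a,b}(x)=P_{a,b}(k_{a,b}x)$, where $P_{a,b}$ is $2\pi$-periodic and smooth and $k_{a,b}>0$. Moreover: (i) The map $k:(-a_0,a_0)\times(-b_0,b_0)\to\mathbb{R}$ is analytic, even in $a$, and satisfies $k_{a,b}^\alpha=k^*(b)+\tilde k(a,b)$ where $k^*(b)=(p+1)Q_b^p-1$ and $\tilde k(a,b)=\sum_{n\ge1}\tilde k_{2n}(b)a^{2n}$ with $|\tilde k_{2n}(b)|\le K_0/\rho_0^{2n}$ for all $|(a,b)|$ small and some positive constants $K_0$ and $\rho_0>a_0$. (ii) The map $(a,b)\mapsto P_{a,b}\in H^\alpha(\mathbb{R}/2\pi\mathbb{Z})$ is analytic on $(-a_0,a_0)\times(-b_0,b_0)$ and can be expanded as $$P_{a,b}(z)=Q_b+a\cos z+\sum_{\substack{n,m\neq0,\ n+m\ge2\\ n-m\neq\pm1}}\tilde p_{n,m}(b)e^{i(n-m)z}a^{n+m},$$ with $n,m$ nonnegative integers, where $\tilde p_{n,m}(b)\in\mathbb{R}$, $\tilde p_{n,m}(b)=\tilde p_{m,n}(b)$, and $|\tilde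 p_{n,m}(b)|\le C_0/\rho_0^{n+m}$ for all $|b|$ small and some $C_0>0$. (iii) The Fourier coefficients $\hat p_n(a,b)$ in $P_{a,b}(z)=\sum_{n\in\mathbb{Z}}\hat p_n(a,b)e^{inz}$ are real and satisfy $\hat p_0(a,0)=1+\mathcal{O}(a^2)$ and $\hat p_n(a,0)=\mathcal{O}(|a|^{|n|})$ for $n\neq0$ as $a\to0$; moreover $a\mapsto\hat p_n(a,b)$ is even (resp. odd) for even (resp. odd) $n$.
   Context: $\Lambda=\sqrt{-\partial_x^2}$ is the Fourier multiplier with symbol $|k|$ (on the torus: $\Lambda^s f=\sum_{k\neq0}|k|^s\hat f(k)e^{ikx}$). For $|b|$ small, $Q_b$ denotes the unique constant solution of $-Q+Q^{p+1}=b$ continuing from $Q_0=1$. Equivalently to the $u$-equation, $P_{a,b}$ solves $-k_{a,b}^\alpha\Lambda^\alpha P-P+P^{p+1}=b$ on $\mathbb{R}/2\pi\mathbb{Z}$.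
   Formalization: In (ii) the condition ''n,m≠0'' is read as (n,m)≠(0,0), so terms with n=0 or m=0 are allowed; with both indices nonzero the expansion fails, since the e^{2iz} coefficient is of exact order a² (e.g. p=1, b=0). *)

(* Defs.v *)
From Stdlib Require Import Reals Lra ZArith.
From Coquelicot Require Import Coquelicot.
Open Scope R_scope.

Definition root_odd (n : nat) (x : R) : R :=
  if Rlt_dec 0 x then Rpower x (/ INR n)
  else if Rlt_dec x 0 then - Rpower (- x) (/ INR n) else 0.

(** x^(m/n) := (x^(1/n))^m, the real-valued power used when p = m/n with
    n odd (and m even, or n = 1, i.e. p = m a natural number). *)
Definition powq (m n : nat) (x : R) : R := (root_odd n x) ^ m.

(** Q_b: the constant solution of -Q + Q^(p+1) = b on the branch through Q_0 = 1,
    i.e. on the region Q > 0, (p+1) Q^p > 1 where Q |-> -Q + Q^(p+1) is strictly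
    increasing (this determines Q uniquely). *)
Definition Qb_spec (p b Q : R) : Prop :=
  0 < Q /\ 1 < (p + 1) * Rpower Q p /\ - Q + Rpower Q (p + 1) = b.

Definition eix (t : R) : C := (cos t, sin t).

Definition four_coef (f : R -> R) (n : Z) : C :=
  (/ (2 * PI) * RInt (fun z => f z * cos (IZR n * z)) 0 (2 * PI),
   - (/ (2 * PI) * RInt (fun z => f z * sin (IZR n * z)) 0 (2 * PI))).

(** Lambda^alpha f (x) = sum_{k <> 0} |k|^alpha fhat(k) e^{ikx}  (symmetric summation);
    is_frac_lap alpha f x v : this series converges to v. *)
Definition is_frac_lap (alpha : R) (f : R -> R) (x : R) (v : C) : Prop :=
  is_series (fun j : nat =>
     Cmult (RtoC (Rpower (INR (S j)) alpha))
       (Cplus (Cmult (four_coef f (Z.of_nat (S j))) (eix (INR (S j) * x)))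
              (Cmult (four_coef f (- Z.of_nat (S j))%Z) (eix (- (INR (S j) * x)))))) v.

(** H^alpha(R/2piZ), described through Fourier coefficients:
    ||c||^2 = sum_{k in Z} (1 + k^2)^alpha |c_k|^2. *)
Definition Hsq_terms (alpha : R) (c : Z -> C) (j : nat) : R :=
  Rpower (1 + INR (S j) ^ 2) alpha *
    (Cmod (c (Z.of_nat (S j))) ^ 2 + Cmod (c (- Z.of_nat (S j))%Z) ^ 2).

Definition in_H (alpha : R) (c : Z -> C) : Prop := ex_series (Hsq_terms alpha c).

Definition Hnorm (alpha : R) (c : Z -> C) : R :=
  sqrt (Cmod (c 0%Z) ^ 2 + Series (Hsq_terms alpha c)).

Definition box (a0 b0 a b : R) : Prop := - a0 < a < a0 /\ - b0 < b < b0.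

Definition analytic2 (D : R -> R -> Prop) (f : R -> R -> R) : Prop :=
  forall x y, D x y -> exists r, 0 < r /\ exists c : nat -> nat -> R,
    (forall i, ex_series (fun j => Rabs (c i j) * r ^ (i + j))) /\
    ex_series (fun i => Series (fun j => Rabs (c i j) * r ^ (i + j))) /\
    forall a b, D a b -> Rabs (a - x) < r -> Rabs (b - y) < r ->
      is_lim_seq (fun N => sum_n (fun i => sum_n (fun j =>
                     c i j * (a - x) ^ i * (b - y) ^ j) N) N) (f a b).

(** Real-analytic map of two real variables into H^alpha(R/2piZ) (functions
    identified with their Fourier coefficients): locally the sum, in H^alpha norm,
    of an absolutely convergent double power series with H^alpha coefficients. *)
Definition analytic2_H (alpha : R) (D : R -> R -> Prop) (F : R -> R -> Z -> C) : Prop :=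
  (forall a b, D a b -> in_H alpha (F a b)) /\
  forall x y, D x y -> exists r, 0 < r /\ exists c : nat -> nat -> Z -> C,
    (forall i j, in_H alpha (c i j)) /\
    (forall i, ex_series (fun j => Hnorm alpha (c i j) * r ^ (i + j))) /\
    ex_series (fun i => Series (fun j => Hnorm alpha (c i j) * r ^ (i + j))) /\
    forall a b, D a b -> Rabs (a - x) < r -> Rabs (b - y) < r ->
      is_lim_seq (fun N => Hnorm alpha (fun k =>
         Cminus (F a b k)
           (sum_n (fun i => sum_n (fun j =>
               Cmult (c i j k) (RtoC ((a - x) ^ i * (b - y) ^ j))) N) N))) 0.

Definition adm (i j : nat) : bool :=
  (2 <=? i + j)%nat && negb (i =? S j)%nat && negb (j =? S i)%nat.

(* Main.v *)
Require Import Defs.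
From Stdlib Require Import Reals ZArith Lra Lia List FinFun ClassicalEpsilon FunctionalExtensionality.
From Coquelicot Require Import Coquelicot.
Import ListNotations.
Open Scope R_scope.

(* Expand the solution as P = 1 + eps * Sum w_(i,j,l) X^i Y^j B^l with X = A e^(iz), Y = A e^(-iz),
   a = 2 eps A and b = eps B.  Since Lambda^alpha multiplies X^i Y^j by |i-j|^alpha, the equation
   becomes a fixed-point problem for the coefficient family w in the convolution algebra
   l^1(N^3): for |i-j| <> 1 divide by the linear symbol p (1 - |i-j|^alpha), and for |i-j| = 1 the
   normalisation of the amplitude of cos z forces w and the equation determines the
   coefficients of k^alpha.  Because |i-j|^alpha / (|i-j|^alpha - 1) is bounded for |i-j| >= 2, no
   derivative is lost, and the map is a contraction for small eps.  Evaluating the resulting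
   identity of coefficients gives the solution, and the l^1 bound gives the geometric
   bounds on all expansions and the analyticity in (a, b). *)

(** * Unordered sums *)

(** The obstacle is that the unknown k^alpha multiplies the unbounded Lambda^alpha. Treating X and Y
    as independent variables makes every monomial an eigenvector of Lambda^alpha and turns products
    into convolutions, so a single Banach algebra norm controls the nonlinearity. The amplitude
    condition makes the frequency-one part of w exactly X + Y. A factor that depends only on XY and
    B preserves frequency, so k^alpha is read off by dividing the part of the nonlinearity on i = j
    + 1 by X. This expresses k^alpha through w before the contraction, in place of a
    Lyapunov-Schmidt reduction. The factor 2 in a = 2 eps A is there because X + Y = 2 A cos z. The
    l^1 bounds hold at |A| = 1 while the solution is evaluated at |A| < 1/2. This geometric gap
    absorbs every polynomial weight in the frequency, hence smoothness and membership in H^alpha,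
    and it yields rho0 > a0. Sums are unordered because monomials are constantly regrouped: by
    product, by frequency, by power of a, and by Taylor index at a new centre. *)

Definition pdec := excluded_middle_informative.
(* The Iverson bracket. *)
Definition iv (P : Prop) : R := if pdec P then 1 else 0.

Lemma iv_true (P : Prop) : P -> iv P = 1.
Proof. intros H; unfold iv; destruct (pdec P); tauto. Qed.
Lemma iv_false (P : Prop) : ~ P -> iv P = 0.
Proof. intros H; unfold iv; destruct (pdec P); tauto. Qed.
Lemma iv_01 (P : Prop) : 0 <= iv P <= 1.
Proof. unfold iv; destruct (pdec P); lra. Qed.
Lemma iv_abs (P : Prop) : Rabs (iv P) <= 1.
Proof. destruct (iv_01 P). rewrite Rabs_pos_eq; lra. Qed.
Lemma iv_iff (P Q : Prop) : (P <-> Q) -> iv P = iv Q.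
Proof. unfold iv; intros H; destruct (pdec P), (pdec Q); tauto. Qed.

Fixpoint sumL {T} (f : T -> R) (L : list T) : R :=
  match L with [] => 0 | x :: L' => f x + sumL f L' end.

Section SumL.
Context {T : Type}.
Implicit Types (f g : T -> R) (L : list T).

Lemma sumL_ext f g L : (forall x, In x L -> f x = g x) -> sumL f L = sumL g L.
Proof.
  induction L as [|x L IH]; simpl; intros H; [easy|].
  rewrite (H x), IH; auto.
Qed.
Lemma sumL_le f g L : (forall x, In x L -> f x <= g x) -> sumL f L <= sumL g L.
Proof.
  induction L as [|x L IH]; simpl; intros H; [lra|].
  assert (f x <= g x) by auto. assert (sumL f L <= sumL g L) by auto. lra.
Qed.
Lemma sumL_plus f g L : sumL (fun x => f x + g x) L = sumL f L + sumL g L.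
Proof. induction L; simpl; lra. Qed.
Lemma sumL_scal c f L : sumL (fun x => c * f x) L = c * sumL f L.
Proof. induction L; simpl; [lra|rewrite IHL; ring]. Qed.
Lemma sumL_nonneg f L : (forall x, 0 <= f x) -> 0 <= sumL f L.
Proof. intros H; induction L; simpl; [lra|]. specialize (H a); lra. Qed.
Lemma sumL_app f L L' : sumL f (L ++ L') = sumL f L + sumL f L'.
Proof. induction L; simpl; [lra|rewrite IHL; ring]. Qed.
Lemma sumL_zero L : sumL (fun _ : T => 0) L = 0.
Proof. induction L; simpl; lra. Qed.

Lemma sumL_incl f L L' : (forall x, 0 <= f x) -> NoDup L -> incl L L' ->
  sumL f L <= sumL f L'.
Proof.
  intros Hf H; revert L'; induction H as [|x L Hx HL IH]; intros L' Hi.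
  - apply sumL_nonneg; auto.
  - destruct (in_split x L') as (l1 & l2 & ->); [apply Hi; now left|].
    rewrite sumL_app; simpl.
    assert (sumL f L <= sumL f (l1 ++ l2)).
    { apply IH. intros y Hy. assert (Hy' : In y (x :: L)) by now right.
      apply Hi in Hy'. apply in_app_iff in Hy'; apply in_app_iff.
      destruct Hy' as [|[->|]]; tauto. }
    rewrite sumL_app in H; lra.
Qed.

Definition nodupL (L : list T) := nodup (fun x y => pdec (x = y)) L.
Lemma nodupL_NoDup L : NoDup (nodupL L).
Proof. apply NoDup_nodup. Qed.
Lemma nodupL_In L x : In x (nodupL L) <-> In x L.
Proof. apply nodup_In. Qed.

(* [nle f B] says that the l^1 norm of [f] is at most [B]. *)
Definition nle f (B : R) := forall L, NoDup L -> sumL (fun t => Rabs (f t)) L <= B.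
Definition summable f := exists B, nle f B.
(** Convergence along the net of finite subsets: no enumeration enters, so [T] can be any type of
    indices and regrouping is free. *)
Definition has_sum f (s : R) := forall eps, 0 < eps -> exists L0, forall L,
  NoDup L -> incl L0 L -> Rabs (sumL f L - s) < eps.
(* An arbitrary real number when [f] is not summable. *)
Definition tsum f : R := epsilon (inhabits 0) (has_sum f).

Lemma nle_summable f B : nle f B -> summable f.
Proof. now exists B. Qed.

Lemma nle_nonneg f B : nle f B -> 0 <= B.
Proof. intros H. apply (H []). constructor. Qed.

Lemma has_sum_unique f s s' : has_sum f s -> has_sum f s' -> s = s'.
Proof.
  intros H H'.   destruct (Req_dec s s') as [|N]; [easy|exfalso].
  set (e := Rabs (s - s') / 2).
  assert (He : 0 < e) by (unfold e; apply Rdiv_lt_0_compat; [apply Rabs_pos_lt|]; lra).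
  destruct (H e He) as [L1 H1], (H' e He) as [L2 H2].
  set (L := nodupL (L1 ++ L2)).
  assert (A1 : Rabs (sumL f L - s) < e).
  { apply H1; [apply nodupL_NoDup|]. intros x Hx; apply nodupL_In, in_app_iff; auto. }
  assert (A2 : Rabs (sumL f L - s') < e).
  { apply H2; [apply nodupL_NoDup|]. intros x Hx; apply nodupL_In, in_app_iff; auto. }
  revert A1 A2. unfold e. unfold Rabs; repeat destruct Rcase_abs; lra.
Qed.

Lemma tsum_eq f s : has_sum f s -> tsum f = s.
Proof.
  intros H. apply (has_sum_unique f); [|easy].
  unfold tsum. apply epsilon_spec. now exists s.
Qed.

Lemma tsum_ext f g : (forall t, f t = g t) -> tsum f = tsum g.
Proof. intros H; f_equal; now apply functional_extensionality. Qed.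

Lemma has_sum_ext f g s : (forall t, f t = g t) -> has_sum f s -> has_sum g s.
Proof. intros H; now rewrite (functional_extensionality _ _ H). Qed.
Lemma nle_ext f g s : (forall t, f t = g t) -> nle f s -> nle g s.
Proof. intros H; now rewrite (functional_extensionality _ _ H). Qed.

Lemma has_sum_plus f g s t : has_sum f s -> has_sum g t ->
  has_sum (fun x => f x + g x) (s + t).
Proof.
  intros H H' e He. destruct (H (e/2)) as [L1 H1]; [lra|].
  destruct (H' (e/2)) as [L2 H2]; [lra|].
  exists (L1 ++ L2). intros L HL Hi. rewrite sumL_plus.
  assert (A1 : Rabs (sumL f L - s) < e/2).
  { apply H1; [easy|]. intros x Hx; apply Hi, in_app_iff; auto. }
  assert (A2 : Rabs (sumL g L - t) < e/2).
  { apply H2; [easy|]. intros x Hx; apply Hi, in_app_iff; auto. }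
  revert A1 A2. unfold Rabs; repeat destruct Rcase_abs; lra.
Qed.

Lemma has_sum_scal c f s : has_sum f s -> has_sum (fun x => c * f x) (c * s).
Proof.
  intros H e He.
  assert (Hc : 0 < 1 + Rabs c) by (pose proof (Rabs_pos c); lra).
  destruct (H (e / (1 + Rabs c))) as [L0 H0]; [now apply Rdiv_lt_0_compat|].
  exists L0. intros L HL Hi. rewrite sumL_scal.
  replace (c * sumL f L - c * s) with (c * (sumL f L - s)) by ring.
  rewrite Rabs_mult. specialize (H0 L HL Hi).
  apply Rle_lt_trans with (Rabs c * (e / (1 + Rabs c))).
  - apply Rmult_le_compat_l; [apply Rabs_pos|lra].
  - apply Rlt_le_trans with ((1 + Rabs c) * (e / (1 + Rabs c))).
    + apply Rmult_lt_compat_r; [now apply Rdiv_lt_0_compat|lra].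
    + right; field; lra.
Qed.

Lemma has_sum_le f g s t : (forall x, f x <= g x) -> has_sum f s -> has_sum g t -> s <= t.
Proof.
  intros Hfg H H'. apply Rnot_lt_le; intros N.
  destruct (H ((s-t)/2)) as [L1 H1]; [lra|].
  destruct (H' ((s-t)/2)) as [L2 H2]; [lra|].
  set (L := nodupL (L1 ++ L2)).
  assert (A1 : Rabs (sumL f L - s) < (s-t)/2).
  { apply H1; [apply nodupL_NoDup|]. intros x Hx; apply nodupL_In, in_app_iff; auto. }
  assert (A2 : Rabs (sumL g L - t) < (s-t)/2).
  { apply H2; [apply nodupL_NoDup|]. intros x Hx; apply nodupL_In, in_app_iff; auto. }
  assert (sumL f L <= sumL g L) by (apply sumL_le; auto).
  revert A1 A2. unfold Rabs; repeat destruct Rcase_abs; lra.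
Qed.

Lemma has_sum_finite f (L0 : list T) : NoDup L0 -> (forall x, ~ In x L0 -> f x = 0) ->
  has_sum f (sumL f L0).
Proof.
  intros HN H e He. exists L0. intros L HL Hi.
  replace (sumL f L) with (sumL f L0); [rewrite Rminus_diag, Rabs_R0; lra|].
  revert L HL Hi. induction HN as [|x L0 Hx HN IH] in f, H |- *; intros L HL Hi.
  - clear Hi HL. induction L as [|y L IHL]; simpl in *; [easy|]. rewrite H; auto. lra.
  - destruct (in_split x L) as (l1 & l2 & ->); [apply Hi; now left|].
    rewrite sumL_app; simpl.
    assert (HL' : NoDup (l1 ++ l2)) by now apply NoDup_remove_1 in HL.
    assert (Hx' : ~ In x (l1 ++ l2)) by now apply NoDup_remove_2 in HL.
    (* [f] need not vanish at [x], which lies outside the shorter list. Zeroing it there restores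
       the induction hypothesis and changes neither of the two remaining sums. *)
    set (g := fun y => if pdec (y = x) then 0 else f y).
    assert (E1 : sumL f L0 = sumL g L0).
    { apply sumL_ext. intros y Hy. unfold g; destruct pdec; [subst; tauto|easy]. }
    assert (E2 : sumL f (l1 ++ l2) = sumL g (l1 ++ l2)).
    { apply sumL_ext. intros y Hy. unfold g; destruct pdec; [subst; tauto|easy]. }
    rewrite E1, (IH g) with (L := l1 ++ l2), <- E2, sumL_app; [ring| |easy|].
    + intros y Hy. unfold g; destruct pdec; [easy|]. apply H. simpl; intuition.
    + intros y Hy. assert (Hy' : In y (l1 ++ x :: l2)) by (apply Hi; now right).
      rewrite in_app_iff in *; simpl in Hy'. destruct Hy' as [|[->|]]; tauto.
Qed.

Lemma has_sum_zero : has_sum (fun _ => 0) 0.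
Proof. apply (has_sum_finite (fun _ => 0) []); [constructor|easy]. Qed.

(** The sum is the supremum of the finite sums, hence also the least l^1 bound of [f]; the last two
    conclusions record this. *)
Lemma has_sum_nonneg f : (forall x, 0 <= f x) -> summable f ->
  exists s, has_sum f s /\ (forall B, nle f B -> s <= B) /\ nle f s.
Proof.
  intros Hf [B HB].
  destruct (completeness (fun s => exists L, NoDup L /\ s = sumL f L)) as [s [Hs1 Hs2]].
  - exists B. intros s [L [HL ->]]. specialize (HB L HL).
    rewrite (sumL_ext _ f) in HB; [easy|]. intros; now apply Rabs_pos_eq.
  - exists 0, []. split; [constructor|easy].
  - exists s. split; [|split].
    + intros e He.
      destruct (classic (exists L, NoDup L /\ s - e < sumL f L)) as [[L0 [HL0 H0]]|N].
      * exists L0. intros L HL Hi.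
        assert (sumL f L0 <= sumL f L) by now apply sumL_incl.
        assert (sumL f L <= s) by (apply Hs1; now exists L).
        unfold Rabs; destruct Rcase_abs; lra.
      * exfalso. assert (s <= s - e); [|lra]. apply Hs2. intros x [L [HL ->]].
        apply Rnot_lt_le. intros A. apply N. now exists L.
    + intros B' HB'. apply Hs2. intros x [L [HL ->]]. specialize (HB' L HL).
      rewrite (sumL_ext _ f) in HB'; [easy|]. intros; now apply Rabs_pos_eq.
    + intros L HL. rewrite (sumL_ext _ f); [|intros; now apply Rabs_pos_eq].
      apply Hs1. now exists L.
Qed.

Lemma nle_abs f B : nle f B <-> nle (fun x => Rabs (f x)) B.
Proof.
  unfold nle. split; intros H L HL; specialize (H L HL);
  rewrite (sumL_ext _ (fun t => Rabs (f t))) in * by (intros; now rewrite Rabs_Rabsolu); easy.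
Qed.
Lemma nle_dom f g B : (forall x, Rabs (f x) <= Rabs (g x)) -> nle g B -> nle f B.
Proof.
  intros H HB L HL. apply Rle_trans with (2 := HB L HL). apply sumL_le; auto.
Qed.
Lemma nle_weak f B B' : nle f B -> B <= B' -> nle f B'.
Proof. intros H HB L HL. apply Rle_trans with (1 := H L HL); easy. Qed.
Lemma nle_plus f g B B' : nle f B -> nle g B' -> nle (fun x => f x + g x) (B + B').
Proof.
  intros H H' L HL. specialize (H L HL); specialize (H' L HL).
  apply Rle_trans with (sumL (fun x => Rabs (f x) + Rabs (g x)) L).
  - apply sumL_le; intros; apply Rabs_triang.
  - rewrite sumL_plus; lra.
Qed.
Lemma nle_scal c f B : nle f B -> nle (fun x => c * f x) (Rabs c * B).
Proof.
  intros H L HL. rewrite (sumL_ext _ (fun x => Rabs c * Rabs (f x))).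
  - rewrite sumL_scal. apply Rmult_le_compat_l; [apply Rabs_pos|auto].
  - intros; apply Rabs_mult.
Qed.
Lemma nle_mul (h : T -> R) f K B : 0 <= K -> (forall x, Rabs (h x) <= K) -> nle f B ->
  nle (fun x => h x * f x) (K * B).
Proof.
  intros HK Hh H. rewrite <- (Rabs_pos_eq K) at 1 by easy.
  apply nle_dom with (g := fun x => K * f x); [|now apply nle_scal].
  intros x. rewrite !Rabs_mult. apply Rmult_le_compat_r; [apply Rabs_pos|].
  rewrite (Rabs_pos_eq K); auto.
Qed.
Lemma nle_mul1 (h : T -> R) f B : (forall x, Rabs (h x) <= 1) -> nle f B ->
  nle (fun x => h x * f x) B.
Proof. intros Hh H. rewrite <- (Rmult_1_l B). apply nle_mul; auto; lra. Qed.
Lemma nle_zero : nle (fun _ : T => 0) 0.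
Proof.
  intros L _. rewrite (sumL_ext _ (fun _ => 0)), sumL_zero; [lra|]. intros; apply Rabs_R0.
Qed.
Lemma nle_point f B x : nle f B -> Rabs (f x) <= B.
Proof.
  intros H. specialize (H [x]). simpl in H. rewrite Rplus_0_r in H. apply H.
  constructor; [intros []|constructor].
Qed.

Lemma summable_dom f g : (forall x, Rabs (f x) <= Rabs (g x)) -> summable g -> summable f.
Proof. intros H [B HB]; exists B; now apply nle_dom with g. Qed.
Lemma summable_plus f g : summable f -> summable g -> summable (fun x => f x + g x).
Proof. intros [B H] [B' H']; eexists; apply nle_plus; eauto. Qed.
Lemma summable_scal c f : summable f -> summable (fun x => c * f x).
Proof. intros [B H]; eexists; apply nle_scal; eauto. Qed.
Lemma summable_abs f : summable f <-> summable (fun x => Rabs (f x)).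
Proof. split; intros [B H]; exists B; [now apply -> nle_abs|now apply <- nle_abs]. Qed.
Lemma summable_mul (h : T -> R) f K : (forall x, Rabs (h x) <= K) -> summable f ->
  summable (fun x => h x * f x).
Proof.
  intros Hh [B H]. exists (Rabs K * B). apply nle_mul; auto; [apply Rabs_pos|].
  intros x; apply Rle_trans with (1 := Hh x), Rle_abs.
Qed.
Lemma summable_mul1 (h : T -> R) f : (forall x, Rabs (h x) <= 1) -> summable f ->
  summable (fun x => h x * f x).
Proof. intros Hh [B H]; exists B; now apply nle_mul1. Qed.
Lemma summable_ext f g : (forall x, f x = g x) -> summable f -> summable g.
Proof. intros H; now rewrite (functional_extensionality _ _ H). Qed.

(** f = (f + |f|) - |f| is a difference of nonnegative summable families. *)
Lemma tsum_correct f : summable f -> has_sum f (tsum f).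
Proof.
  intros H.
  destruct (has_sum_nonneg (fun x => Rabs (f x))) as [s [Hs _]];
    [intros; apply Rabs_pos|now apply -> summable_abs|].
  destruct (has_sum_nonneg (fun x => f x + Rabs (f x))) as [t [Ht _]].
  - intros x. unfold Rabs; destruct Rcase_abs; lra.
  - apply summable_plus; [easy|now apply -> summable_abs].
  - assert (E : has_sum f (t + -1 * s)).
    { apply has_sum_ext with (f := fun x => (f x + Rabs (f x)) + -1 * Rabs (f x)); [intros; ring|].
      apply has_sum_plus; [easy|now apply has_sum_scal]. }
    now rewrite (tsum_eq _ _ E).
Qed.
Lemma tsum_plus f g : summable f -> summable g -> tsum (fun x => f x + g x) = tsum f + tsum g.
Proof. intros H H'; apply tsum_eq, has_sum_plus; now apply tsum_correct. Qed.
Lemma tsum_zero : tsum (fun _ : T => 0) = 0.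
Proof. apply tsum_eq, has_sum_zero. Qed.
Lemma tsum_scal c f : summable f -> tsum (fun x => c * f x) = c * tsum f.
Proof. intros H; apply tsum_eq, has_sum_scal; now apply tsum_correct. Qed.
Lemma tsum_minus f g : summable f -> summable g -> tsum (fun x => f x - g x) = tsum f - tsum g.
Proof.
  intros H H'. rewrite (tsum_ext _ (fun x => f x + -1 * g x)) by (intros; ring).
  rewrite tsum_plus, tsum_scal; auto; [ring|now apply summable_scal].
Qed.
Lemma tsum_le f g : (forall x, f x <= g x) -> summable f -> summable g -> tsum f <= tsum g.
Proof. intros H H1 H2; apply has_sum_le with f g; auto; now apply tsum_correct. Qed.
Lemma tsum_abs_le f B : nle f B -> tsum (fun x => Rabs (f x)) <= B.
Proof.
  intros H. destruct (has_sum_nonneg (fun x => Rabs (f x))) as [s [Hs [H1 _]]].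
  - intros; apply Rabs_pos.
  - exists B; now apply -> nle_abs.
  - rewrite (tsum_eq _ _ Hs). apply H1. now apply -> nle_abs.
Qed.
Lemma nle_tsum f : summable f -> nle f (tsum (fun x => Rabs (f x))).
Proof.
  intros H. destruct (has_sum_nonneg (fun x => Rabs (f x))) as [s [Hs [_ H1]]].
  - intros; apply Rabs_pos.
  - now apply -> summable_abs.
  - rewrite (tsum_eq _ _ Hs). now apply nle_abs.
Qed.
Lemma tsum_Rabs f B : nle f B -> Rabs (tsum f) <= B.
Proof.
  intros H. apply Rle_trans with (2 := tsum_abs_le f B H).
  assert (S : summable f) by now exists B.
  assert (S' := proj1 (summable_abs f) S).
  apply Rabs_le. split.
  - replace (- tsum (fun x => Rabs (f x))) with (tsum (fun x => -1 * Rabs (f x)))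
      by (rewrite tsum_scal; auto; ring).
    apply tsum_le; auto; [|now apply summable_scal].
    intros x; unfold Rabs; destruct Rcase_abs; lra.
  - apply tsum_le; auto. intros; apply Rle_abs.
Qed.
Lemma tsum_single x0 (f : T -> R) : tsum (fun x => iv (x0 = x) * f x) = f x0.
Proof.
  replace (f x0) with (sumL (fun x => iv (x0 = x) * f x) [x0]).
  - apply tsum_eq, has_sum_finite; [constructor; [intros []|constructor]|].
    intros x Hx. rewrite iv_false; [ring|]. intros ->; apply Hx; now left.
  - simpl. rewrite iv_true; [ring|easy].
Qed.
Lemma has_sum_nle f s : has_sum (fun x => Rabs (f x)) s -> nle f s.
Proof.
  intros H L HL. apply Rnot_lt_le; intros N.
  destruct (H (sumL (fun t => Rabs (f t)) L - s)) as [L0 HL0]; [lra|].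
  set (L' := nodupL (L ++ L0)).
  assert (A : sumL (fun t => Rabs (f t)) L <= sumL (fun t => Rabs (f t)) L').
  { apply sumL_incl; auto; [intros; apply Rabs_pos|].
    intros x Hx; apply nodupL_In, in_app_iff; auto. }
  specialize (HL0 L' (nodupL_NoDup _)). apply Rabs_def2 in HL0; [lra|].
  intros x Hx; apply nodupL_In, in_app_iff; auto.
Qed.
Lemma nle_single x0 (f : T -> R) : nle (fun x => iv (x0 = x) * f x) (Rabs (f x0)).
Proof.
  apply has_sum_nle.
  replace (Rabs (f x0)) with (sumL (fun x => Rabs (iv (x0 = x) * f x)) [x0]).
  - apply has_sum_finite; [constructor; [intros []|constructor]|].
    intros x Hx. rewrite iv_false, Rmult_0_l; [apply Rabs_R0|]. intros ->; apply Hx; now left.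
  - simpl. rewrite iv_true, Rmult_1_l; [ring|easy].
Qed.

(** A finite set carries all but e of the mass of [f], and the increasing sets [E N] eventually
    contain it. This supplies the uniform convergence needed for integrals and for Sobolev norms. *)
Lemma tsum_tail f (E : nat -> T -> Prop) : summable f ->
  (forall N x, E N x -> E (S N) x) -> (forall x, exists N, E N x) ->
  is_lim_seq (fun N => tsum (fun x => iv (~ E N x) * Rabs (f x))) 0.
Proof.
  intros Hf Hm He. apply is_lim_seq_spec. intros e.
  assert (Hmon : forall N N' x, (N <= N')%nat -> E N x -> E N' x).
  { intros N N' x H; induction H; auto. }
  assert (S' := proj1 (summable_abs f) Hf).
  destruct (tsum_correct _ S' e (cond_pos e)) as [L0 H0].
  assert (HN : exists N, forall x, In x L0 -> E N x).
  { clear H0. induction L0 as [|x L0 [N IH]]; [now exists 0%nat|].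
    destruct (He x) as [N' HN']. exists (N + N')%nat. intros y [<-|Hy].
    - apply Hmon with N'; [lia|easy].
    - apply Hmon with N; [lia|auto]. }
  destruct HN as [N0 HN0]. exists N0. intros N HN. rewrite Rminus_0_r.
  assert (SI : forall P : T -> Prop, summable (fun x => iv (P x) * Rabs (f x))).
  { intros P. apply summable_mul1; auto. intros; apply iv_abs. }
  rewrite Rabs_pos_eq.
  2:{ rewrite <- tsum_zero. apply tsum_le; auto; [|exists 0; apply nle_zero].
      intros x. apply Rmult_le_pos; [apply iv_01|apply Rabs_pos]. }
  specialize (H0 (nodupL L0) (nodupL_NoDup _)).
  assert (A : incl L0 (nodupL L0)) by (intros x Hx; now apply nodupL_In).
  specialize (H0 A). apply Rabs_def2 in H0. destruct H0 as [_ H0].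
  assert (B : tsum (fun x => iv (In x L0) * Rabs (f x)) = sumL (fun x => Rabs (f x)) (nodupL L0)).
  { apply tsum_eq.
    rewrite (sumL_ext _ (fun x => iv (In x L0) * Rabs (f x))).
    - apply has_sum_finite; [apply nodupL_NoDup|]. intros x Hx.
      rewrite iv_false; [ring|]. now rewrite <- nodupL_In.
    - intros x Hx. rewrite iv_true; [ring|]. now apply nodupL_In. }
  assert (D : tsum (fun x => iv (~ E N x) * Rabs (f x)) + tsum (fun x => iv (In x L0) * Rabs (f x))
     <= tsum (fun x => Rabs (f x))); [|lra].
  rewrite <- tsum_plus; auto. apply tsum_le; auto; [|apply summable_plus; auto].
  intros x. pose proof (Rabs_pos (f x)).
  destruct (classic (In x L0)) as [Hx|Hx].
  - rewrite (iv_true (In x L0)), (iv_false (~ _)); auto; [lra|].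
    intros HH; apply HH, Hmon with N0; auto.
  - rewrite (iv_false (In x L0)) by easy. destruct (iv_01 (~ E N x)). nra.
Qed.
End SumL.

(** * Reindexing unordered sums *)

Lemma sumL_map {A B} (h : A -> B) (f : B -> R) L : sumL f (map h L) = sumL (fun x => f (h x)) L.
Proof. induction L; simpl; congruence. Qed.

Lemma nle_inj {A B} (h : A -> B) (f : B -> R) K : (forall x y, h x = h y -> x = y) ->
  nle f K -> nle (fun x => f (h x)) K.
Proof.
  intros Hh H L HL. rewrite <- (sumL_map h (fun x => Rabs (f x))). apply H.
  apply Injective_map_NoDup; [exact Hh|easy].
Qed.

Lemma has_sum_bij {A B} (h : A -> B) (g : B -> A) f s : (forall x, g (h x) = x) ->
  (forall y, h (g y) = y) -> has_sum f s -> has_sum (fun x => f (h x)) s.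
Proof.
  intros H1 H2 H e He. destruct (H e He) as [L0 H0]. exists (map g L0). intros L HL Hi.
  rewrite <- (sumL_map h f). apply H0.
  - apply Injective_map_NoDup; [|easy]. intros x y E.
    now rewrite <- (H1 x), <- (H1 y), E.
  - intros y Hy. rewrite <- (H2 y). apply in_map, Hi, in_map, Hy.
Qed.
Lemma nle_bij {A B} (h : A -> B) (g : B -> A) f K : (forall x, g (h x) = x) ->
  nle f K -> nle (fun x => f (h x)) K.
Proof. intros H. apply nle_inj. intros x y E. now rewrite <- (H x), <- (H y), E. Qed.
Lemma tsum_bij {A B} (h : A -> B) (g : B -> A) f : (forall x, g (h x) = x) ->
  (forall y, h (g y) = y) -> summable f -> tsum (fun x => f (h x)) = tsum f.
Proof. intros; apply tsum_eq, has_sum_bij with g; auto. now apply tsum_correct. Qed.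

(** * Iterated sums: Tonelli and Fubini *)

Lemma NoDup_list_prod {A B} (L : list A) (L' : list B) :
  NoDup L -> NoDup L' -> NoDup (list_prod L L').
Proof.
  intros H H'; induction H as [|x L Hx HL IH]; simpl; [constructor|].
  apply NoDup_app; [|easy|].
  - apply Injective_map_NoDup; [|easy]. congruence.
  - intros [a b] H1 H2. apply in_map_iff in H1 as (y & E & _). inversion E; subst.
    apply in_prod_iff in H2. tauto.
Qed.
Section Prod.
Context {A B : Type}.

Lemma sumL_list_prod (f : A * B -> R) L L' :
  sumL f (list_prod L L') = sumL (fun a => sumL (fun b => f (a, b)) L') L.
Proof.
  induction L as [|a L IH]; simpl; [easy|].
  rewrite sumL_app, IH, sumL_map. easy.
Qed.

Lemma nle_slice (f : A * B -> R) K a : nle f K -> nle (fun b => f (a, b)) K.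
Proof. apply nle_inj. congruence. Qed.

Lemma has_sum_sumL (f : A -> B -> R) (s : A -> R) L :
  (forall a, has_sum (f a) (s a)) -> has_sum (fun b => sumL (fun a => f a b) L) (sumL s L).
Proof.
  intros H; induction L as [|a L IH]; simpl; [apply has_sum_zero|].
  apply has_sum_plus; auto.
Qed.

(** Finitely many inner sums add up to a sum over [b] of finite sums, and its finite sub-sums are
    sums of |f| over rectangles, hence at most [K]. *)
Lemma nle_outer (f : A * B -> R) K : nle f K ->
  nle (fun a => tsum (fun b => Rabs (f (a, b)))) K.
Proof.
  intros H L HL.
  assert (Hs : forall a, summable (fun b => Rabs (f (a, b)))).
  { intros a. apply (proj1 (summable_abs _)). exists K. now apply nle_slice. }
  rewrite (sumL_ext _ (fun a => tsum (fun b => Rabs (f (a, b))))).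
  2:{ intros a _. apply Rabs_pos_eq. rewrite <- (tsum_zero (T := B)).
      apply tsum_le; auto; [intros; apply Rabs_pos|]. exists 0; apply nle_zero. }
  assert (E := has_sum_sumL (fun a b => Rabs (f (a, b))) _ L (fun a => tsum_correct _ (Hs a))).
  cbv beta in E. rewrite <- (tsum_eq _ _ E).
  apply Rle_trans with (tsum (fun b => Rabs (sumL (fun a => Rabs (f (a, b))) L))).
  - right; apply tsum_ext. intros b. symmetry; apply Rabs_pos_eq, sumL_nonneg.
    intros; apply Rabs_pos.
  - apply tsum_abs_le. intros L' HL'.
    rewrite (sumL_ext _ (fun b => sumL (fun a => Rabs (f (a, b))) L)).
    2:{ intros b _. apply Rabs_pos_eq, sumL_nonneg. intros; apply Rabs_pos. }
    assert (S : forall L2 : list B, sumL (fun b => sumL (fun a => Rabs (f (a, b))) L) L2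
       = sumL (fun a => sumL (fun b => Rabs (f (a, b))) L2) L).
    { induction L2 as [|b L2 IH]; simpl; [now rewrite sumL_zero|].
      now rewrite IH, <- sumL_plus. }
    rewrite S, <- (sumL_list_prod (fun x => Rabs (f x))). apply H.
    now apply NoDup_list_prod.
Qed.

Lemma nle_outer_tsum (f : A * B -> R) K : nle f K -> nle (fun a => tsum (fun b => f (a, b))) K.
Proof.
  intros H. apply nle_dom with (2 := nle_outer f K H). intros a.
  rewrite (Rabs_pos_eq (tsum (fun b => Rabs (f (a, b))))).
  - apply tsum_Rabs, nle_tsum. exists K; now apply nle_slice.
  - rewrite <- (tsum_zero (T := B)). apply tsum_le; [intros; apply Rabs_pos|exists 0; apply nle_zero|].
    apply (proj1 (summable_abs _)). exists K. now apply nle_slice.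
Qed.

(** A finite set of pairs lies in the rectangle spanned by its two projections. *)
Lemma tonelli (f : A * B -> R) K : (forall a, summable (fun b => f (a, b))) ->
  nle (fun a => tsum (fun b => Rabs (f (a, b)))) K -> nle f K.
Proof.
  intros Hs H L HL.
  set (L1 := nodupL (map fst L)). set (L2 := nodupL (map snd L)).
  apply Rle_trans with (sumL (fun x => Rabs (f x)) (list_prod L1 L2)).
  { apply sumL_incl; auto; [intros; apply Rabs_pos|].
    intros [a b] Hx. apply in_prod; apply nodupL_In.
    - now apply (in_map fst) in Hx.
    - now apply (in_map snd) in Hx. }
  rewrite sumL_list_prod.
  apply Rle_trans with (2 := H L1 (nodupL_NoDup _)).
  apply sumL_le. intros a _. apply Rle_trans with (2 := Rle_abs _).
  apply nle_tsum; [apply Hs|apply nodupL_NoDup].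
Qed.

(** For nonnegative families the sum is the least l^1 bound, so the two inequalities come from
    [nle_outer_tsum] and [tonelli]. *)
Lemma fubini_nonneg (f : A * B -> R) : (forall x, 0 <= f x) -> summable f ->
  tsum (fun a => tsum (fun b => f (a, b))) = tsum f.
Proof.
  intros H0 [K HK].
  assert (Ef : forall x, Rabs (f x) = f x) by (intros; now apply Rabs_pos_eq).
  assert (Ht : forall a, 0 <= tsum (fun b => f (a, b))).
  { intros a. rewrite <- (tsum_zero (T := B)). apply tsum_le; auto; [exists 0; apply nle_zero|].
    exists K. now apply nle_slice. }
  apply Rle_antisym.
  - rewrite (tsum_ext _ (fun a => Rabs (tsum (fun b => f (a, b))))).
    2:{ intros a. now rewrite Rabs_pos_eq. }
    apply tsum_abs_le, nle_outer_tsum.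
    rewrite (tsum_ext f (fun x => Rabs (f x))) by easy. apply nle_tsum. now exists K.
  - rewrite (tsum_ext f (fun x => Rabs (f x))) by easy. apply tsum_abs_le.
    apply tonelli; [intros a; exists K; now apply nle_slice|].
    assert (E : (fun a => tsum (fun b => Rabs (f (a, b)))) = (fun a => tsum (fun b => f (a, b)))).
    { apply functional_extensionality; intros a; now apply tsum_ext. }
    rewrite E.
    rewrite (tsum_ext (fun a => tsum (fun b => f (a, b))) (fun a => Rabs (tsum (fun b => f (a, b))))).
    2:{ intros a. now rewrite Rabs_pos_eq. }
    apply nle_tsum. exists K. now apply nle_outer_tsum.
Qed.

(** The nonnegative case is applied to f + |f| and to |f|. *)
Theorem fubini (f : A * B -> R) : summable f ->
  tsum (fun a => tsum (fun b => f (a, b))) = tsum f.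
Proof.
  intros Hf. assert (Hf2 := proj1 (summable_abs _) Hf).
  assert (Hp : summable (fun x => f x + Rabs (f x))) by now apply summable_plus.
  assert (Sl : forall (h : A * B -> R) a, summable h -> summable (fun b => h (a, b))).
  { intros h a [K HK]. exists K. now apply nle_slice. }
  assert (So : forall (h : A * B -> R), summable h -> summable (fun a => tsum (fun b => h (a, b)))).
  { intros h [K HK]. exists K. now apply nle_outer_tsum. }
  rewrite (tsum_ext f (fun x => (f x + Rabs (f x)) - Rabs (f x))) by (intros; ring).
  rewrite (tsum_minus (fun x => f x + Rabs (f x))), <- !fubini_nonneg; auto.
  - rewrite <- tsum_minus; try (now apply (So _ Hp)); try (now apply (So _ Hf2)).
    apply tsum_ext; intros a.
    rewrite <- tsum_minus; try (now apply (Sl _ a Hp)); try (now apply (Sl _ a Hf2)).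
    apply tsum_ext; intros; ring.
  - intros; apply Rabs_pos.
  - intros x; unfold Rabs; destruct Rcase_abs; lra.
Qed.

Lemma nle_prod_mul (x : A -> R) (y : B -> R) K K' : nle x K -> nle y K' ->
  nle (fun u : A * B => x (fst u) * y (snd u)) (K * K').
Proof.
  intros Hx Hy. apply tonelli; simpl.
  - intros a. apply summable_scal. now exists K'.
  - apply nle_dom with (g := fun a => K' * x a).
    + intros a. rewrite Rabs_mult, (Rabs_pos_eq K') by now apply nle_nonneg in Hy.
      rewrite (tsum_ext _ (fun b => Rabs (x a) * Rabs (y b))) by (intros; apply Rabs_mult).
      rewrite tsum_scal; [|apply (proj1 (summable_abs _)); now exists K'].
      rewrite Rabs_mult, Rabs_Rabsolu, Rmult_comm.
      apply Rmult_le_compat_r; [apply Rabs_pos|].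
      apply tsum_Rabs. now apply (proj1 (nle_abs _ _)).
    + rewrite Rmult_comm, <- (Rabs_pos_eq K') by now apply nle_nonneg in Hy.
      apply (nle_scal (Rabs K')) in Hx. rewrite Rabs_Rabsolu, Rmult_comm in Hx.
      rewrite Rmult_comm. exact Hx.
Qed.
Lemma tsum_prod_mul (x : A -> R) (y : B -> R) : summable x -> summable y ->
  tsum (fun u : A * B => x (fst u) * y (snd u)) = tsum x * tsum y.
Proof.
  intros [K Hx] [K' Hy]. rewrite <- fubini by (exists (K * K'); now apply nle_prod_mul). simpl.
  rewrite (tsum_ext _ (fun a => tsum y * x a)).
  - rewrite tsum_scal; [ring|now exists K].
  - intros a. rewrite tsum_scal; [ring|now exists K'].
Qed.
End Prod.

Lemma tsum_swap {A B} (f : A * B -> R) : summable f ->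
  tsum (fun b => tsum (fun a => f (a, b))) = tsum f.
Proof.
  intros [K Hf].
  rewrite <- (tsum_bij (fun x : B * A => (snd x, fst x)) (fun x => (snd x, fst x)) f);
    try (now intros []); [|now exists K].
  rewrite <- fubini; [easy|]. exists K.
  apply (nle_bij (fun x : B * A => (snd x, fst x)) (fun x => (snd x, fst x)) f); [now intros []|easy].
Qed.

(** * Grouping a sum along the fibres of a map *)

Section Fibre.
Context {T B : Type}.
Variable g : T -> B.

(** [X] is carried to the graph of [g] inside [B * T], so that grouping by fibres becomes an
    iterated sum. *)
Lemma nle_fibre2 (X : T -> R) K : nle X K -> nle (fun u : B * T => iv (g (snd u) = fst u) * X (snd u)) K.
Proof.
  intros H.
  apply (nle_bij (fun x : B * T => (snd x, fst x)) (fun x => (snd x, fst x))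
     (fun u : T * B => iv (g (fst u) = snd u) * X (fst u))); [now intros []|].
  apply tonelli; simpl.
  - intros t. exists (Rabs (X t)). apply (nle_single (g t) (fun _ => X t)).
  - apply nle_dom with (2 := H). intros t.
    apply tsum_Rabs, (proj1 (nle_abs _ _)), (nle_single (g t) (fun _ => X t)).
Qed.
Lemma nle_fibre (X : T -> R) K : nle X K -> nle (fun b => tsum (fun t => iv (g t = b) * X t)) K.
Proof. intros H; exact (nle_outer_tsum _ _ (nle_fibre2 X K H)). Qed.
Lemma tsum_fibre (X : T -> R) : summable X ->
  tsum (fun b => tsum (fun t => iv (g t = b) * X t)) = tsum X.
Proof.
  intros [K H].
  assert (S : summable (fun u : B * T => iv (g (snd u) = fst u) * X (snd u)))
    by (exists K; now apply nle_fibre2).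
  refine (eq_trans (fubini _ S) _). rewrite <- (tsum_swap _ S). simpl. apply tsum_ext. intros t. apply (tsum_single (g t) (fun _ => X t)).
Qed.
End Fibre.

Lemma tsum_inj {A B} (h : A -> B) (f : B -> R) : (forall x y, h x = h y -> x = y) ->
  summable f -> (forall b, (forall a, h a <> b) -> f b = 0) ->
  tsum f = tsum (fun a => f (h a)).
Proof.
  intros Hh [K Hf] H0.
  assert (S : summable (fun a => f (h a))) by (exists K; now apply nle_inj).
  rewrite <- (tsum_fibre h _ S). apply tsum_ext. intros b.
  destruct (classic (exists a, h a = b)) as [[a <-]|N].
  - rewrite (tsum_ext _ (fun t => iv (a = t) * f (h t))).
    + now rewrite (tsum_single a (fun t => f (h t))).
    + intros t. f_equal. apply iv_iff. split; [intros E; symmetry; now apply Hh|congruence].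
  - rewrite (tsum_ext _ (fun _ => 0)), tsum_zero.
    + apply H0. intros a E; apply N; now exists a.
    + intros t. rewrite iv_false; [ring|]. intros E; apply N; now exists t.
Qed.

(** * Unordered sums and series over the naturals *)

Lemma sum_nS (f : nat -> R) n : sum_n f (S n) = sum_n f n + f (S n).
Proof. exact (sum_Sn f n). Qed.
Lemma sumL_seq (f : nat -> R) N : sumL f (seq 0 (S N)) = sum_n f N.
Proof.
  induction N as [|N IH].
  - rewrite sum_O; simpl; lra.
  - rewrite sum_nS, seq_S, sumL_app, IH. simpl; ring.
Qed.

Lemma has_sum_is_series (f : nat -> R) s : has_sum f s -> is_series f s.
Proof.
  intros H. change (is_lim_seq (sum_n f) s). apply is_lim_seq_spec. intros e.
  destruct (H e (cond_pos e)) as [L0 H0].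
  exists (list_max L0). intros N HN.
  rewrite <- sumL_seq. apply H0; [apply seq_NoDup|].
  intros x Hx. apply in_seq.
  assert (HH := proj1 (list_max_le L0 (list_max L0)) (Nat.le_refl _)).
  rewrite Forall_forall in HH. specialize (HH x Hx). lia.
Qed.
Lemma tsum_is_series (f : nat -> R) : summable f -> is_series f (tsum f).
Proof. intros; now apply has_sum_is_series, tsum_correct. Qed.

Lemma ex_series_summable (f : nat -> R) : ex_series (fun n => Rabs (f n)) ->
  nle f (Series (fun n => Rabs (f n))).
Proof.
  intros H L HL.
  apply Rle_trans with (sumL (fun x => Rabs (f x)) (seq 0 (S (list_max L)))).
  - apply sumL_incl; auto; [intros; apply Rabs_pos|].
    intros x Hx. apply in_seq.
    assert (HH := proj1 (list_max_le L (list_max L)) (Nat.le_refl _)).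
    rewrite Forall_forall in HH. specialize (HH x Hx). lia.
  - rewrite sumL_seq. apply Series_correct in H.
    set (u := sum_n (fun x => Rabs (f x))).
    change (u (list_max L) <= Series (fun n => Rabs (f n))).
    apply (is_lim_seq_incr_compare u); [exact H|].
    intros n; unfold u; rewrite sum_nS. pose proof (Rabs_pos (f (S n))); lra.
Qed.
Lemma summable_ex_series (f : nat -> R) : summable f -> ex_series (fun n => Rabs (f n)).
Proof. intros H. eexists. apply tsum_is_series. now apply (proj1 (summable_abs _)). Qed.
Lemma tsum_Series (f : nat -> R) : summable f -> Series f = tsum f.
Proof. intros; now apply is_series_unique, tsum_is_series. Qed.

(** The squares [0,N]^2 exhaust N^2. This turns unordered sums over pairs into the double partial
    sums in which the expansions are stated. *)
Lemma has_sum_square (f : nat * nat -> R) s : has_sum f s ->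
  is_lim_seq (fun N => sum_n (fun i => sum_n (fun j => f (i, j)) N) N) s.
Proof.
  intros H. apply is_lim_seq_spec. intros e.
  destruct (H e (cond_pos e)) as [L0 H0].
  exists (list_max (map fst L0 ++ map snd L0)). intros N HN.
  rewrite <- sumL_seq, (sumL_ext _ (fun i => sumL (fun j => f (i, j)) (seq 0 (S N)))).
  2:{ intros; now rewrite sumL_seq. }
  rewrite <- sumL_list_prod. apply H0.
  - apply NoDup_list_prod; apply seq_NoDup.
  - assert (HH := proj1 (list_max_le _ _) HN). rewrite Forall_forall in HH.
    intros [i j] Hx. apply in_prod; apply in_seq.
    + assert (i <= N)%nat; [|lia]. apply HH, in_app_iff; left. now apply (in_map fst) in Hx.
    + assert (j <= N)%nat; [|lia]. apply HH, in_app_iff; right. now apply (in_map snd) in Hx.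
Qed.

(** * Countable superpositions in l^1 *)

Section Superpose.
Context {T : Type}.
Lemma nle_superpose2 (Y : nat -> T -> R) b B : (forall k, nle (Y k) (b k)) -> nle b B ->
  nle (fun u : nat * T => Y (fst u) (snd u)) B.
Proof.
  intros HY Hb. apply tonelli; simpl.
  - intros k. now exists (b k).
  - apply nle_dom with (2 := Hb). intros k. rewrite (Rabs_pos_eq (b k)) by now apply (nle_nonneg (Y k)).
    apply tsum_Rabs. apply (proj1 (nle_abs _ _)), HY.
Qed.
Lemma nle_superpose (Y : nat -> T -> R) b B : (forall k, nle (Y k) (b k)) -> nle b B ->
  nle (fun m => tsum (fun k => Y k m)) B.
Proof.
  intros HY Hb.
  apply (nle_outer_tsum (fun u : T * nat => Y (snd u) (fst u))).
  apply (nle_bij (fun x : T * nat => (snd x, fst x)) (fun x => (snd x, fst x))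
     (fun u : nat * T => Y (fst u) (snd u))); [now intros []|].
  now apply nle_superpose2 with b.
Qed.
Lemma summable_superpose (Y : nat -> T -> R) b B m : (forall k, nle (Y k) (b k)) -> nle b B ->
  summable (fun k => Y k m).
Proof.
  intros HY Hb. exists B. apply nle_dom with (2 := Hb). intros k.
  rewrite (Rabs_pos_eq (b k)) by now apply (nle_nonneg (Y k)). apply nle_point, HY.
Qed.
Lemma tsum_superpose (Y : nat -> T -> R) b B (phi : T -> R) :
  (forall k, nle (Y k) (b k)) -> nle b B -> (forall t, Rabs (phi t) <= 1) ->
  tsum (fun m => phi m * tsum (fun k => Y k m)) = tsum (fun k => tsum (fun m => phi m * Y k m)).
Proof.
  intros HY Hb Hp.
  assert (S : summable (fun u : nat * T => phi (snd u) * Y (fst u) (snd u))).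
  { apply summable_mul1; [auto|]. exists B. now apply nle_superpose2 with b. }
  refine (eq_trans _ (eq_sym (fubini _ S))). rewrite <- (tsum_swap _ S). simpl.
  apply tsum_ext. intros m. rewrite tsum_scal; [easy|]. now apply summable_superpose with b B.
Qed.
End Superpose.

(** * The convolution algebra l^1(N^3) *)

(* (i, j, l) is the exponent of (A e^(iz))^i (A e^(-iz))^j B^l, so swapping i and j is the
   reflection z -> -z. *)
Definition M := (nat * nat * nat)%type.
Definition n1 (m : M) : nat := fst (fst m).
Definition n2 (m : M) : nat := snd (fst m).
Definition n3 (m : M) : nat := snd m.
Definition madd (u v : M) : M := (n1 u + n1 v, n2 u + n2 v, n3 u + n3 v)%nat.
Definition m0 : M := (0, 0, 0)%nat.
Definition sw (m : M) : M := (n2 m, n1 m, n3 m).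

Lemma sw_sw m : sw (sw m) = m.
Proof. now destruct m as [[] ?]. Qed.
Lemma sw_madd u v : sw (madd u v) = madd (sw u) (sw v).
Proof. easy. Qed.

(** The fibre sum of the tensor product along [madd], rather than a finite sum over the
    decompositions of [m]: norm bounds and evaluation are then instances of the fibre lemmas. *)
Definition conv (x y : M -> R) (m : M) : R :=
  tsum (fun u : M * M => iv (madd (fst u) (snd u) = m) * (x (fst u) * y (snd u))).

Lemma nle_conv x y A B : nle x A -> nle y B -> nle (conv x y) (A * B).
Proof. intros Hx Hy. apply nle_fibre. now apply nle_prod_mul. Qed.
Lemma summable_conv x y : summable x -> summable y -> summable (conv x y).
Proof. intros [A Hx] [B Hy]; exists (A * B); now apply nle_conv. Qed.

Lemma summable_conv_terms x y m : summable x -> summable y ->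
  summable (fun u : M * M => iv (madd (fst u) (snd u) = m) * (x (fst u) * y (snd u))).
Proof.
  intros [A Hx] [B Hy]. apply summable_mul1; [intros; apply iv_abs|].
  exists (A * B). now apply nle_prod_mul.
Qed.
Lemma conv_minus_l x x' y m : summable x -> summable x' -> summable y ->
  conv (fun m => x m - x' m) y m = conv x y m - conv x' y m.
Proof.
  intros. unfold conv. rewrite <- tsum_minus; [|now apply summable_conv_terms..].
  apply tsum_ext; intros; ring.
Qed.
Lemma conv_minus_r x y y' m : summable x -> summable y -> summable y' ->
  conv x (fun m => y m - y' m) m = conv x y m - conv x y' m.
Proof.
  intros. unfold conv. rewrite <- tsum_minus; [|now apply summable_conv_terms..].
  apply tsum_ext; intros; ring.
Qed.

(** The bound on [phi] is a general [K] because the lemma also serves for a character multiplied by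
    the symbol of Lambda^alpha. *)
Lemma conv_eval (phi : M -> R) K x y : (forall m, Rabs (phi m) <= K) -> summable x -> summable y ->
  tsum (fun m => phi m * conv x y m) =
  tsum (fun u : M * M => phi (madd (fst u) (snd u)) * (x (fst u) * y (snd u))).
Proof.
  intros Hp Hx Hy.
  assert (S : summable (fun u : M * M => phi (madd (fst u) (snd u)) * (x (fst u) * y (snd u)))).
  { apply summable_mul with K; [intros; apply Hp|].
    destruct Hx as [A Hx], Hy as [B Hy]. exists (A * B). now apply nle_prod_mul. }
  rewrite <- (tsum_fibre (fun u : M * M => madd (fst u) (snd u)) _ S).
  apply tsum_ext; intros m. unfold conv.
  rewrite <- tsum_scal by now apply summable_conv_terms.
  apply tsum_ext; intros u. unfold iv. destruct pdec as [<-|]; ring.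
Qed.

Lemma conv_sw x y m : summable x -> summable y ->
  conv x y (sw m) = conv (fun m => x (sw m)) (fun m => y (sw m)) m.
Proof.
  intros Hx Hy. unfold conv.
  rewrite <- (tsum_bij (fun u : M * M => (sw (fst u), sw (snd u)))
     (fun u : M * M => (sw (fst u), sw (snd u)))).
  - apply tsum_ext; intros [u v]; simpl. f_equal. apply iv_iff. split; intros E.
    + now rewrite <- (sw_sw m), <- E, sw_madd, !sw_sw.
    + now rewrite <- E.
  - now intros [[[] ?] [[] ?]].
  - now intros [[[] ?] [[] ?]].
  - now apply summable_conv_terms.
Qed.

Lemma conv_m0 x y : conv x y m0 = x m0 * y m0.
Proof.
  refine (eq_trans _ (tsum_single (m0, m0) (fun u : M * M => x (fst u) * y (snd u)))).
  apply tsum_ext; intros [[[i j] l] [[i' j'] l']]; simpl. f_equal. apply iv_iff.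
  unfold madd, m0, n1, n2, n3; simpl. split; intros E; inversion E; subst; [|easy].
  repeat f_equal; lia.
Qed.

Fixpoint pw (x : M -> R) (k : nat) : M -> R :=
  match k with O => fun m => iv (m0 = m) * 1 | S k => conv x (pw x k) end.

Lemma nle_pw x r k : nle x r -> nle (pw x k) (r ^ k).
Proof.
  intros H; induction k; simpl; [|now apply nle_conv].
  apply nle_weak with (Rabs 1); [apply (nle_single m0 (fun _ => 1))|rewrite Rabs_R1; lra].
Qed.
Lemma summable_pw x k : summable x -> summable (pw x k).
Proof. intros [r H]. exists (r ^ k). now apply nle_pw. Qed.

(* Since [4 * 8^k + 4^k <= 8^(k+1)], the telescoped difference of powers on the ball of
   radius 4 grows at most like [8^k]. *)
Lemma nle_pw_diff x y d k : nle x 4 -> nle y 4 -> nle (fun m => x m - y m) d ->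
  nle (fun m => pw x k m - pw y k m) (8 ^ k * d).
Proof.
  intros Hx Hy Hd. assert (0 <= d) by now apply nle_nonneg in Hd.
  induction k as [|k IH].
  - apply nle_weak with 0; [|simpl; lra].
    apply nle_ext with (f := fun _ => 0); [intros; simpl; ring|apply nle_zero].
  - apply nle_ext with (f := fun m => conv x (fun m => pw x k m - pw y k m) m
       + conv (fun m => x m - y m) (pw y k) m).
    + intros m. simpl pw.
      assert (summable x) by now exists 4. assert (summable y) by now exists 4.
      rewrite conv_minus_r, conv_minus_l; auto using summable_pw. ring.
    + apply nle_weak with (4 * (8 ^ k * d) + d * 4 ^ k).
      * apply nle_plus; apply nle_conv; auto. now apply nle_pw.
      * assert (4 ^ k <= 8 ^ k) by (apply pow_incr; lra).
        assert (0 <= 4 ^ k) by (apply pow_le; lra). simpl. nra.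
Qed.

(* phi + t psi is a character with values in R[t]/(t^2 - sigma): sigma = -1 gives the
   trigonometric evaluation, sigma = 0 a first-order Taylor coefficient.  If sigma * psi(x) = 0,
   both components of the value of x^k are the dual-number ones. *)
Section Eval.
Variables (phi psi : M -> R) (sigma : R).
Hypothesis (phi1 : forall m, Rabs (phi m) <= 1) (psi1 : forall m, Rabs (psi m) <= 1).
Hypothesis (phi0 : phi m0 = 1) (psi0 : psi m0 = 0).
Hypothesis phi_add : forall u v, phi (madd u v) = phi u * phi v + sigma * (psi u * psi v).
Hypothesis psi_add : forall u v, psi (madd u v) = phi u * psi v + psi u * phi v.
Notation ev f x := (tsum (fun m => f m * x m)).

Lemma summable_ev (f x : M -> R) : (forall m, Rabs (f m) <= 1) -> summable x ->
  summable (fun m => f m * x m).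
Proof. intros; now apply summable_mul1. Qed.

Lemma ev_sep (f g x y : M -> R) : (forall m, Rabs (f m) <= 1) -> (forall m, Rabs (g m) <= 1) ->
  summable x -> summable y ->
  tsum (fun u : M * M => (f (fst u) * g (snd u)) * (x (fst u) * y (snd u))) = ev f x * ev g y.
Proof.
  intros. rewrite <- tsum_prod_mul; try now apply summable_ev.
  apply tsum_ext; intros; ring.
Qed.
Lemma summable_sep (f g x y : M -> R) : (forall m, Rabs (f m) <= 1) -> (forall m, Rabs (g m) <= 1) ->
  summable x -> summable y ->
  summable (fun u : M * M => (f (fst u) * g (snd u)) * (x (fst u) * y (snd u))).
Proof.
  intros Hf Hg [A Hx] [B Hy]. apply summable_mul1.
  - intros u. rewrite Rabs_mult. rewrite <- (Rmult_1_r 1).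
    apply Rmult_le_compat; auto using Rabs_pos.
  - exists (A * B). now apply nle_prod_mul.
Qed.

Lemma phi_conv x y : summable x -> summable y ->
  ev phi (conv x y) = ev phi x * ev phi y + sigma * (ev psi x * ev psi y).
Proof.
  intros Hx Hy. rewrite (conv_eval phi 1), <- !ev_sep; auto.
  rewrite <- tsum_scal, <- tsum_plus; auto using summable_sep, summable_scal.
  apply tsum_ext; intros. rewrite phi_add; ring.
Qed.
Lemma psi_conv x y : summable x -> summable y ->
  ev psi (conv x y) = ev phi x * ev psi y + ev psi x * ev phi y.
Proof.
  intros Hx Hy. rewrite (conv_eval psi 1), <- !ev_sep; auto.
  rewrite <- tsum_plus; auto using summable_sep.
  apply tsum_ext; intros. rewrite psi_add; ring.
Qed.

Lemma ev_pw x k : summable x -> sigma * ev psi x = 0 ->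
  ev phi (pw x k) = ev phi x ^ k /\ ev psi (pw x k) = INR k * ev phi x ^ pred k * ev psi x.
Proof.
  intros Hx H0. induction k as [|k [IH1 IH2]].
  - simpl. split.
    + rewrite (tsum_ext _ (fun m => iv (m0 = m) * phi m)) by (intros; ring).
      now rewrite (tsum_single m0 phi).
    + rewrite (tsum_ext _ (fun m => iv (m0 = m) * psi m)) by (intros; ring).
      rewrite (tsum_single m0 psi). rewrite psi0; ring.
  - simpl pw. rewrite phi_conv, psi_conv by (auto using summable_pw). rewrite IH1, IH2. split.
    + rewrite <- Rmult_assoc, H0. simpl; ring.
    + rewrite S_INR. destruct k; simpl; ring.
Qed.
End Eval.

(** * Power series evaluated in the convolution algebra *)

Definition psub (c : nat -> R) (x : M -> R) (m : M) : R := tsum (fun k => c k * pw x k m).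

Section Comp.
Variables (c : nat -> R) (r B : R).
Hypothesis Hc : nle (fun k => c k * r ^ k) B.

Lemma nle_psub_terms x k : nle x r -> nle (fun m => c k * pw x k m) (Rabs (c k * r ^ k)).
Proof.
  intros Hx. assert (0 <= r) by now apply nle_nonneg in Hx.
  rewrite Rabs_mult, (Rabs_pos_eq (r ^ k)) by now apply pow_le.
  now apply nle_scal, nle_pw.
Qed.
Lemma nle_psub x : nle x r -> nle (psub c x) B.
Proof.
  intros Hx. apply nle_superpose with (b := fun k => Rabs (c k * r ^ k)).
  - intros; now apply nle_psub_terms.
  - now apply (proj1 (nle_abs _ _)).
Qed.
Lemma psub_eval (phi : M -> R) x : (forall m, Rabs (phi m) <= 1) -> nle x r ->
  tsum (fun m => phi m * psub c x m) = tsum (fun k => c k * tsum (fun m => phi m * pw x k m)).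
Proof.
  intros Hp Hx. unfold psub.
  rewrite (tsum_superpose (fun k m => c k * pw x k m) (fun k => Rabs (c k * r ^ k)) B); auto.
  - apply tsum_ext; intros k. rewrite <- tsum_scal.
    + apply tsum_ext; intros; ring.
    + apply summable_mul1; auto. apply summable_pw. now exists r.
  - intros; now apply nle_psub_terms.
  - now apply (proj1 (nle_abs _ _)).
Qed.
End Comp.

(** The coefficients are taken summable at radius 8, twice the radius of the ball, to absorb the
    factor [8 ^ k] in the difference of k-th powers. *)
Lemma nle_psub_diff c B x y d : nle (fun k => c k * 8 ^ k) B -> nle x 4 -> nle y 4 ->
  nle (fun m => x m - y m) d -> nle (fun m => psub c x m - psub c y m) (B * d).
Proof.
  intros Hc Hx Hy Hd.
  assert (Hd0 : 0 <= d) by now apply nle_nonneg in Hd.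
  assert (Hc4 : nle (fun k => c k * 4 ^ k) B).
  { apply nle_dom with (2 := Hc). intros k. rewrite !Rabs_mult.
    apply Rmult_le_compat_l; [apply Rabs_pos|]. rewrite <- !RPow_abs, !Rabs_pos_eq by lra.
    apply pow_incr; lra. }
  assert (Hs : forall z m, nle z 4 -> summable (fun k => c k * pw z k m)).
  { intros z m Hz. apply summable_superpose with (Y := fun k m => c k * pw z k m)
      (b := fun k => Rabs (c k * 4 ^ k)) (B := B).
    - intros; now apply nle_psub_terms.
    - now apply (proj1 (nle_abs _ _)). }
  apply nle_ext with (f := fun m => tsum (fun k => c k * (pw x k m - pw y k m))).
  - intros m. unfold psub. rewrite <- tsum_minus; auto. apply tsum_ext; intros; ring.
  - apply nle_superpose with (b := fun k => d * Rabs (c k * 8 ^ k)).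
    + intros k. rewrite Rabs_mult, (Rabs_pos_eq (8 ^ k)) by (apply pow_le; lra).
      replace (d * (Rabs (c k) * 8 ^ k)) with (Rabs (c k) * (8 ^ k * d)) by ring.
      apply nle_scal. now apply nle_pw_diff.
    + rewrite Rmult_comm. replace (d * B) with (Rabs d * B) by now rewrite Rabs_pos_eq.
      apply nle_scal. now apply (proj1 (nle_abs _ _)).
Qed.

Lemma pw_sw x k m : summable x -> (forall m, x (sw m) = x m) -> pw x k (sw m) = pw x k m.
Proof.
  intros Hs H. revert m. induction k as [|k IH]; intros m.
  - simpl. f_equal. apply iv_iff. split; intros E.
    + now rewrite <- (sw_sw m), <- E.
    + now rewrite <- E.
  - simpl. rewrite conv_sw by auto using summable_pw. f_equal; now apply functional_extensionality.
Qed.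
Lemma psub_sw c x m : summable x -> (forall m, x (sw m) = x m) -> psub c x (sw m) = psub c x m.
Proof. intros; apply tsum_ext; intros; now rewrite pw_sw. Qed.
Lemma psub_m0 c x : x m0 = 0 -> psub c x m0 = c 0%nat.
Proof.
  intros H. unfold psub. rewrite <- (tsum_single 0%nat c). apply tsum_ext.
  intros [|k]; simpl.
  - rewrite !iv_true by easy; ring.
  - rewrite conv_m0, H, iv_false by easy. ring.
Qed.

Lemma nle_geom_half : nle (fun k => (/ 2) ^ k) 2.
Proof.
  assert (H : is_series (fun k => (/ 2) ^ k) 2).
  { evar_last; [apply is_series_geom; rewrite Rabs_pos_eq; lra|]. field. }
  assert (E : forall k, Rabs ((/ 2) ^ k) = (/ 2) ^ k).
  { intros; apply Rabs_pos_eq, pow_le; lra. }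
  apply nle_weak with (Series (fun k => Rabs ((/ 2) ^ k))).
  - apply ex_series_summable. exists 2. apply is_series_ext with (2 := H). intros; now rewrite E.
  - right. rewrite (Series_ext _ (fun k => (/ 2) ^ k)) by easy. now apply is_series_unique.
Qed.

Lemma tsum_S (f : nat -> R) : summable f -> tsum f = f 0%nat + tsum (fun k => f (S k)).
Proof.
  intros H. rewrite <- !tsum_Series; auto.
  - apply Series_incr_1. apply ex_series_Rabs. now apply summable_ex_series.
  - destruct H as [K H]. exists K. apply (nle_inj S f); [congruence|easy].
Qed.

(** Lets n tend to infinity; this is how estimates on the iterates reach the fixed point. *)
Lemma le_of_half_pow a b c : (forall n, a <= b + c * (/ 2) ^ n) -> a <= b.
Proof.
  intros H. apply Rnot_lt_le; intros N.
  assert (Hc : 0 < 1 + Rabs c) by (pose proof (Rabs_pos c); lra).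
  destruct (pow_lt_1_zero (/ 2)) with (y := (a - b) / (1 + Rabs c)) as [n Hn].
  - rewrite Rabs_pos_eq; lra.
  - apply Rdiv_lt_0_compat; lra.
  - specialize (Hn n (le_n n)). specialize (H n).
    assert (P : 0 < (/ 2) ^ n) by (apply pow_lt; lra).
    rewrite Rabs_pos_eq in Hn by lra.
    apply Rlt_div_r in Hn; [|easy].
    pose proof (Rle_abs c). nra.
Qed.

(** * Contractions of l^1 *)

Section Contraction.
Context {T : Type}.
Variable F : (T -> R) -> (T -> R).
Hypothesis F_ball : forall x, nle x 4 -> nle (F x) 4.
Hypothesis F_lip : forall x y d, nle x 4 -> nle y 4 -> nle (fun m => x m - y m) d ->
  nle (fun m => F x m - F y m) (d / 2).

Fixpoint itr (n : nat) : T -> R := match n with O => fun _ => 0 | S n => F (itr n) end.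

Lemma itr_ball n : nle (itr n) 4.
Proof.
  induction n; simpl; [|auto]. apply nle_weak with 0; [apply nle_zero|lra].
Qed.
Lemma itr_diff n : nle (fun m => itr (S n) m - itr n m) (4 * (/ 2) ^ n).
Proof.
  induction n as [|n IH].
  - apply nle_ext with (f := itr 1); [intros; simpl; ring|].
    apply nle_weak with 4; [apply itr_ball|simpl; lra].
  - replace (4 * (/ 2) ^ S n) with (4 * (/ 2) ^ n / 2) by (simpl; field).
    apply (F_lip (itr (S n)) (itr n)); auto using itr_ball.
Qed.

(** The limit of the iterates from 0, written as a telescoping sum so that it exists coefficient by
    coefficient through plain summability. *)
Definition fixpt (m : T) : R := tsum (fun k => itr (S k) m - itr k m).

Lemma nle_fix_bound n : nle (fun k => 4 * (/ 2) ^ (n + k)) (8 * (/ 2) ^ n).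
Proof.
  apply nle_ext with (f := fun k => (4 * (/ 2) ^ n) * (/ 2) ^ k).
  - intros; rewrite pow_add; ring.
  - replace (8 * (/ 2) ^ n) with (Rabs (4 * (/ 2) ^ n) * 2).
    + apply nle_scal, nle_geom_half.
    + assert (0 < (/ 2) ^ n) by (apply pow_lt; lra). rewrite Rabs_pos_eq; lra.
Qed.

Lemma fixpt_shift n m : fixpt m - itr n m = tsum (fun k => itr (S (n + k)) m - itr (n + k) m).
Proof.
  induction n as [|n IH].
  - change (fixpt m - 0 = fixpt m). ring.
  - rewrite tsum_S in IH.
    + rewrite Nat.add_0_r in IH.
      replace (fixpt m - itr (S n) m) with (fixpt m - itr n m - (itr (S n) m - itr n m)) by ring.
      rewrite IH. rewrite (tsum_ext (fun k => itr (S (n + S k)) m - itr (n + S k) m)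
         (fun k => itr (S (S n + k)) m - itr (S n + k) m)); [ring|].
      intros k. now rewrite Nat.add_succ_r.
    + apply (summable_superpose (fun k m => itr (S (n + k)) m - itr (n + k) m)
        (fun k => 4 * (/ 2) ^ (n + k)) (8 * (/ 2) ^ n)); [intros; apply itr_diff|apply nle_fix_bound].
Qed.
Lemma fixpt_itr n : nle (fun m => fixpt m - itr n m) (8 * (/ 2) ^ n).
Proof.
  apply nle_ext with (f := fun m => tsum (fun k => itr (S (n + k)) m - itr (n + k) m)).
  - intros; now rewrite fixpt_shift.
  - apply (nle_superpose (fun k m => itr (S (n + k)) m - itr (n + k) m)
        (fun k => 4 * (/ 2) ^ (n + k)) (8 * (/ 2) ^ n)); [intros; apply itr_diff|apply nle_fix_bound].
Qed.
Lemma fixpt_ball : nle fixpt 4.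
Proof.
  intros L HL. apply le_of_half_pow with 8. intros n.
  revert L HL. change (nle fixpt (4 + 8 * (/ 2) ^ n)).
  apply nle_ext with (f := fun m => itr n m + (fixpt m - itr n m)); [intros; ring|].
  apply nle_plus; [apply itr_ball|apply fixpt_itr].
Qed.
Lemma fixpt_eq m : F fixpt m = fixpt m.
Proof.
  apply Rminus_diag_uniq, Rabs_eq_0, Rle_antisym; [|apply Rabs_pos].
  apply le_of_half_pow with 8. intros n. rewrite Rplus_0_l.
  assert (H1 := F_lip _ _ _ fixpt_ball (itr_ball n) (fixpt_itr n)).
  apply (nle_point _ _ m) in H1.
  assert (H2 := nle_point _ _ m (fixpt_itr (S n))). simpl in H2.
  (* Each difference is at most 4 * (/ 2) ^ n: the first by the Lipschitz constant 1/2, the second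
     as the error after n + 1 steps. *)
  replace (F fixpt m - fixpt m) with ((F fixpt m - F (itr n) m) - (fixpt m - F (itr n) m)) by ring.
  apply Rle_trans with (1 := Rabs_triang _ _). rewrite Rabs_Ropp. lra.
Qed.
(** An equality of coefficients that holds along the iteration survives in the limit. The reflection
    symmetry is obtained this way, without a uniqueness argument for the fixed point. *)
Lemma fixpt_transfer m m' : (forall n, itr n m = itr n m') -> fixpt m = fixpt m'.
Proof. intros H. apply tsum_ext. intros k. now rewrite !H. Qed.
Lemma fixpt_null m : (forall n, itr n m = 0) -> fixpt m = 0.
Proof.
  intros H. unfold fixpt. rewrite (tsum_ext _ (fun _ => 0)), tsum_zero; [easy|].
  intros k; rewrite !H; ring.
Qed.
End Contraction.

(** * The binomial series *)

(** The generalised binomial coefficient g (g - 1) ... (g - k + 1) / k!. *)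
Fixpoint bn (g : R) (k : nat) : R :=
  match k with O => 1 | S k => bn g k * ((g - INR k) / (INR k + 1)) end.

(** Each factor |g - k| / (k + 1) is at most 1 + |g|. The crude radius of convergence 1 / (1 + |g|)
    that results is enough, since all arguments will be of the order of eps. *)
Lemma bn_bound g k : Rabs (bn g k) <= (1 + Rabs g) ^ k.
Proof.
  induction k as [|k IH]; simpl; [rewrite Rabs_R1; lra|].
  rewrite Rabs_mult, Rmult_comm. apply Rmult_le_compat; auto using Rabs_pos.
  pose proof (pos_INR k). pose proof (Rabs_pos g).
  rewrite Rabs_div, (Rabs_pos_eq (INR k + 1)) by lra.
  apply Rle_div_l; [lra|].
  apply Rle_trans with (1 := Rabs_triang _ _). rewrite Rabs_Ropp, (Rabs_pos_eq (INR k)) by lra. nra.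
Qed.
Lemma bn_rec g k : (INR k + 1) * bn g (S k) = (g - INR k) * bn g k.
Proof. simpl. pose proof (pos_INR k). field. lra. Qed.
(** The coefficient form of the derivative of (1 + x)^g; it identifies the derivative of the
    nonlinearity in the value of k^alpha at a = 0. *)
Lemma bn_shift g k : (INR k + 1) * bn g (S k) = g * bn (g - 1) k.
Proof.
  induction k as [|k IH]; [simpl; field|].
  rewrite bn_rec. pose proof (pos_INR k). simpl bn at 2. rewrite S_INR.
  replace (g * (bn (g - 1) k * ((g - 1 - INR k) / (INR k + 1))))
    with (g * bn (g - 1) k * ((g - 1 - INR k) / (INR k + 1))) by ring.
  rewrite <- IH. field. lra.
Qed.

Lemma bn_radius g : Rbar_le (/ (1 + Rabs g)) (CV_radius (bn g)).
Proof.
  apply (proj1 (CV_radius_bounded (bn g))). exists 1. intros n.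
  pose proof (Rabs_pos g). rewrite Rabs_mult.
  assert (0 < (/ (1 + Rabs g)) ^ n) by (apply pow_lt, Rinv_0_lt_compat; lra).
  rewrite (Rabs_pos_eq (_ ^ n)) by lra.
  apply Rle_trans with ((1 + Rabs g) ^ n * (/ (1 + Rabs g)) ^ n).
  - apply Rmult_le_compat_r; [lra|apply bn_bound].
  - rewrite <- Rpow_mult_distr, Rinv_r, pow1 by lra. lra.
Qed.

(** The recursion [bn_rec] is this differential equation read coefficient by coefficient. *)
Lemma bn_ode g y : Rabs y < / (1 + Rabs g) ->
  (1 + y) * PSeries (PS_derive (bn g)) y = g * PSeries (bn g) y.
Proof.
  intros Hy.
  assert (Hr : Rbar_lt (Rabs y) (CV_radius (bn g))).
  { apply Rbar_lt_le_trans with (2 := bn_radius g). exact Hy. }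
  assert (Hr' : Rbar_lt (Rabs y) (CV_radius (PS_derive (bn g)))) by now rewrite CV_radius_derive.
  replace ((1 + y) * PSeries (PS_derive (bn g)) y) with
    (PSeries (PS_derive (bn g)) y + y * PSeries (PS_derive (bn g)) y) by ring.
  rewrite <- PSeries_incr_1, <- PSeries_scal, <- PSeries_plus.
  - apply PSeries_ext. intros [|n]; unfold PS_plus, PS_incr_1, PS_derive, PS_scal, plus, scal, zero;
      simpl plus; unfold mult; simpl (_ * _)%R.
    + simpl. unfold mult; simpl. field.
    + change (INR (S (S n)) * bn g (S (S n)) + INR (S n) * bn g (S n) = g * bn g (S n)).
      rewrite (S_INR (S n)), bn_rec. ring.
  - now apply CV_disk_correct, CV_disk_inside || (apply ex_pseries_R, CV_disk_correct, CV_disk_inside).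
  - apply ex_pseries_incr_1. now apply CV_disk_correct, CV_disk_inside.
Qed.

(** The quotient of the series by (1 + y)^g has zero derivative by [bn_ode] and equals 1 at 0. *)
Lemma binomial_series g x : Rabs x < / (1 + Rabs g) ->
  is_series (fun k => bn g k * x ^ k) (Rpower (1 + x) g).
Proof.
  intros Hx.
  assert (Hr : forall y, Rabs y < / (1 + Rabs g) -> Rbar_lt (Rabs y) (CV_radius (bn g))).
  { intros y Hy. apply Rbar_lt_le_trans with (2 := bn_radius g). exact Hy. }
  assert (Hi : / (1 + Rabs g) <= 1).
  { rewrite <- Rinv_1. apply Rinv_le_contravar; [lra|pose proof (Rabs_pos g); lra]. }
  assert (E : PSeries (bn g) x = Rpower (1 + x) g).
  { set (h := fun y => PSeries (bn g) y * Rpower (1 + y) (- g)).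
    assert (Hb : forall y, Rmin 0 x <= y <= Rmax 0 x -> Rabs y < / (1 + Rabs g)).
    { intros y Hy. apply Rle_lt_trans with (2 := Hx). revert Hy. unfold Rmin, Rmax.
      destruct Rle_dec; intros; unfold Rabs; repeat destruct Rcase_abs; lra. }
    assert (Hd : forall y, Rabs y < / (1 + Rabs g) -> is_derive h y 0).
    { intros y Hy. assert (0 < 1 + y) by (apply Rabs_def2 in Hy; lra).
      evar_last.
      - apply @is_derive_mult.
        + apply is_derive_PSeries. now apply Hr.
        + unfold Rpower. auto_derive; [lra|reflexivity].
        + intros; apply Rmult_comm.
      - unfold plus, mult; simpl. fold (Rpower (1 + y) (- g)).
        transitivity (((1 + y) * PSeries (PS_derive (bn g)) y - g * PSeries (bn g) y)
           * Rpower (1 + y) (- g) / (1 + y)); [field; lra|].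
        rewrite bn_ode by easy. field; lra. }
    destruct (MVT_gen h 0 x (fun _ => 0)) as [c [_ Hc]].
    - intros y Hy. apply Hd, Hb; lra.
    - intros y Hy. apply continuity_pt_filterlim, (ex_derive_continuous h).
      exists 0. now apply Hd, Hb.
    - assert (H0 : h x = h 0) by lra.
      unfold h in H0. rewrite PSeries_0, Rplus_0_r in H0. simpl bn in H0.
      unfold Rpower at 2 in H0. rewrite ln_1, Rmult_0_r, exp_0 in H0.
      rewrite Rpower_Ropp in H0.
      assert (Rpower (1 + x) g <> 0) by (unfold Rpower; apply Rgt_not_eq, exp_pos).
      apply (f_equal (fun t => t * Rpower (1 + x) g)) in H0.
      rewrite Rmult_assoc, Rinv_l in H0 by easy. lra. }
  rewrite <- E. unfold PSeries. apply Series_correct.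
  apply ex_series_Rabs, (CV_disk_inside (bn g) x). now apply Hr.
Qed.

(** * The fixed point *)

(** The frequency |i - j|: at least one of the two truncated differences is 0. *)
Definition dd (m : M) : nat := (n1 m - n2 m + (n2 m - n1 m))%nat.
Definition e1 : M := (1, 0, 0)%nat.
Definition e2 : M := (0, 1, 0)%nat.
Definition e3 : M := (0, 0, 1)%nat.

Section Fixed.
Variables alpha p : R.
Hypothesis (Ha : 0 < alpha) (Hp : 1 <= p).

(* The symbol of Lambda^alpha; Rpower gives a junk value at frequency 0. *)
Definition lam (d : nat) : R := match d with O => 0 | _ => Rpower (INR d) alpha end.
(** Solving the coefficient equation for w divides by p (1 - lam d). The nonlinearity then carries
    the factor [am], and the product of w with the correction of k^alpha carries [bm]. Both are set
    to 0 at d = 1, where the divisor vanishes and w is prescribed. *)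
Definition am (d : nat) : R :=
  match d with O => - / p | 1%nat => 0 | _ => / (p * (lam d - 1)) end.
Definition bm (d : nat) : R :=
  match d with O => 0 | 1%nat => 0 | _ => - lam d / (p * (lam d - 1)) end.
(** A common bound for [am] and [bm]: lam / (lam - 1) = 1 + 1 / (lam - 1) decreases in lam, so d = 2
    is the worst frequency. *)
Definition Kcst : R := 1 + / (Rpower 2 alpha - 1).

Lemma two_alpha : 1 < Rpower 2 alpha.
Proof.
  rewrite <- (Rpower_O 2) by lra. apply Rpower_lt; lra.
Qed.
Lemma lam_ge d : (2 <= d)%nat -> Rpower 2 alpha <= lam d.
Proof.
  intros H. destruct d; [lia|]. unfold lam. apply Rle_Rpower_l; [lra|].
  split; [lra|]. apply (le_INR 2 (S d) H).
Qed.
Lemma lam_1 : lam 1 = 1.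
Proof. unfold lam. simpl INR. unfold Rpower. rewrite ln_1, Rmult_0_r. apply exp_0. Qed.
Lemma lam_nonneg d : 0 <= lam d.
Proof. destruct d; [simpl; lra|]. left; apply exp_pos. Qed.

Lemma Kab_pos : 1 <= Kcst.
Proof.
  unfold Kcst. pose proof two_alpha.
  assert (0 < / (Rpower 2 alpha - 1)) by (apply Rinv_0_lt_compat; lra). lra.
Qed.
Lemma am_bound d : Rabs (am d) <= Kcst.
Proof.
  pose proof Kab_pos. destruct d as [|[|d]].
  - simpl. rewrite Rabs_Ropp, Rabs_pos_eq.
    + apply Rle_trans with 1; [|easy]. rewrite <- Rinv_1. apply Rinv_le_contravar; lra.
    + left; apply Rinv_0_lt_compat; lra.
  - simpl. rewrite Rabs_R0; lra.
  - unfold am. assert (HL := lam_ge (S (S d)) ltac:(lia)). pose proof two_alpha.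
    set (l := lam (S (S d))) in *.
    assert (0 < p * (l - 1)) by nra.
    rewrite Rabs_pos_eq by (left; now apply Rinv_0_lt_compat).
    unfold Kcst. apply Rle_trans with (/ (Rpower 2 alpha - 1)); [|lra].
    apply Rinv_le_contravar; nra.
Qed.
Lemma bm_bound d : Rabs (bm d) <= Kcst.
Proof.
  pose proof Kab_pos. destruct d as [|[|d]]; try (simpl; rewrite Rabs_R0; lra).
  unfold bm. assert (HL := lam_ge (S (S d)) ltac:(lia)). pose proof two_alpha.
  set (l := lam (S (S d))) in *. unfold Kcst.
  replace (- l / (p * (l - 1))) with (- (/ p * (1 + / (l - 1)))) by (field; lra).
  assert (0 < / (l - 1)) by (apply Rinv_0_lt_compat; lra).
  assert (/ (l - 1) <= / (Rpower 2 alpha - 1)) by (apply Rinv_le_contravar; lra).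
  assert (0 < / p) by (apply Rinv_0_lt_compat; lra).
  assert (/ p <= 1) by (rewrite <- Rinv_1; apply Rinv_le_contravar; lra).
  rewrite Rabs_Ropp, Rabs_pos_eq by nra. nra.
Qed.

(** The linear part X + Y + B / p. After multiplication by eps it reads a cos z + b / p, where p is
    the derivative of -Q + Q^(p+1) at Q = 1. *)
Definition w0 (m : M) : R := iv (e1 = m) * 1 + iv (e2 = m) * 1 + iv (e3 = m) * / p.
Definition qcst : R := 1 + Rabs (p + 1).
(** The l^1 norm of [nlc] at radius 8: a factor 8^2 from the two lowest powers, which [nlc] omits, a
    factor 4 from shifting the geometric sequence back by two, and the sum 2 of that sequence. *)
Definition Lcst : R := 256 * qcst ^ 2 * 2.
(* Divides the part of g on i = j + 1 by A e^(iz); applied to the nonlinearity this gives the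
   coefficients of k^alpha. *)
Definition DD (g : M -> R) (m : M) : R := iv (n1 m = n2 m) * g (S (n1 m), n2 m, n3 m).

Lemma nle_w0 : nle w0 3.
Proof.
  apply nle_weak with (Rabs 1 + Rabs 1 + Rabs (/ p)).
  - repeat apply nle_plus.
    + apply (nle_single e1 (fun _ => 1)).
    + apply (nle_single e2 (fun _ => 1)).
    + apply (nle_single e3 (fun _ => / p)).
  - assert (0 < / p) by (apply Rinv_0_lt_compat; lra).
    assert (/ p <= 1) by (rewrite <- Rinv_1; apply Rinv_le_contravar; lra).
    rewrite Rabs_R1, Rabs_pos_eq; lra.
Qed.
Lemma nle_DD g B : nle g B -> nle (DD g) B.
Proof.
  intros H. apply nle_mul1; [intros; apply iv_abs|].
  apply (nle_inj (fun m : M => (S (n1 m), n2 m, n3 m)) g); [|easy].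
  intros [[i j] l] [[i' j'] l'] E. unfold n1, n2, n3 in E; simpl in E. congruence.
Qed.
Lemma DD_minus f g m : DD (fun m => f m - g m) m = DD f m - DD g m.
Proof. unfold DD; ring. Qed.
Lemma qp_ge : 3 <= qcst.
Proof. unfold qcst. rewrite Rabs_pos_eq; lra. Qed.
Lemma Lq_pos : 1 <= Lcst.
Proof. pose proof qp_ge. unfold Lcst. nra. Qed.

Variable eps : R.
(** [He16] makes 8 * qcst * eps at most 1/2, so that [nlc] is summable at radius 8. [HeK] makes the
    Lipschitz constant 6 * eps * Kcst * Lcst of the map below at most 1/2. *)
Hypothesis (He : 0 < eps) (He16 : eps * (16 * qcst) <= 1) (HeK : eps * (12 * (Kcst * Lcst)) <= 1).

(* The coefficients of the power series of F(eps x) / eps^2, where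
   F(x) = (1+x)^(p+1) - 1 - (p+1) x. *)
Definition nlc (k : nat) : R :=
  match k with S (S k') => bn (p + 1) k * eps ^ k' | _ => 0 end.

Lemma nle_cc8 : nle (fun k => nlc k * 8 ^ k) Lcst.
Proof.
  pose proof qp_ge as Hq.
  apply nle_dom with (g := fun k => (256 * qcst ^ 2) * (/ 2) ^ k).
  - intros k.
    assert (H2 : 0 < (/ 2) ^ k) by (apply pow_lt; lra).
    assert (0 <= 256 * qcst ^ 2 * (/ 2) ^ k) by nra.
    rewrite (Rabs_pos_eq (256 * qcst ^ 2 * (/ 2) ^ k)) by easy.
    destruct k as [|[|k]]; try (simpl nlc; rewrite Rmult_0_l, Rabs_R0; easy).
    unfold nlc. rewrite !Rabs_mult.
    assert (P8 : 0 < 8 ^ S (S k)) by (apply pow_lt; lra).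
    assert (Pe : 0 < eps ^ k) by now apply pow_lt.
    rewrite (Rabs_pos_eq (8 ^ S (S k))), (Rabs_pos_eq (eps ^ k)) by lra.
    apply Rle_trans with (qcst ^ S (S k) * eps ^ k * 8 ^ S (S k)).
    + apply Rmult_le_compat_r; [lra|]. apply Rmult_le_compat_r; [lra|]. apply bn_bound.
    + replace (qcst ^ S (S k) * eps ^ k * 8 ^ S (S k)) with (64 * qcst ^ 2 * (eps * (8 * qcst)) ^ k)
        by (rewrite !Rpow_mult_distr; simpl; ring).
      replace (256 * qcst ^ 2 * (/ 2) ^ S (S k)) with (64 * qcst ^ 2 * (/ 2) ^ k) by (simpl; field).
      apply Rmult_le_compat_l; [nra|]. apply pow_incr. nra.
  - apply nle_weak with (Rabs (256 * qcst ^ 2) * 2).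
    + apply nle_scal, nle_geom_half.
    + rewrite Rabs_pos_eq by nra. unfold Lcst; lra.
Qed.
Lemma nle_cc4 : nle (fun k => nlc k * 4 ^ k) Lcst.
Proof.
  apply nle_dom with (2 := nle_cc8). intros k. rewrite !Rabs_mult.
  apply Rmult_le_compat_l; [apply Rabs_pos|]. rewrite <- !RPow_abs, !Rabs_pos_eq by lra.
  apply pow_incr; lra.
Qed.

(** The unknown k^alpha no longer appears: its correction is [DD (psub nlc x)], a function of [x]
    itself. *)
Definition Top (x : M -> R) (m : M) : R :=
  w0 m + eps * (am (dd m) * psub nlc x m + bm (dd m) * conv (DD (psub nlc x)) x m).

(** The linear part has norm at most 3, which leaves 1 for the nonlinear part, of norm at most 5 *
    eps * Kcst * Lcst. *)
Lemma Top_ball x : nle x 4 -> nle (Top x) 4.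
Proof.
  intros Hx. pose proof Kab_pos as HK. pose proof Lq_pos as HL.
  assert (Hg := nle_psub nlc 4 Lcst nle_cc4 x Hx).
  apply nle_weak with (3 + Rabs eps * (Kcst * Lcst + Kcst * (Lcst * 4))).
  - apply nle_plus; [apply nle_w0|]. apply nle_scal. apply nle_plus.
    + apply nle_mul; [lra|intros; apply am_bound|easy].
    + apply nle_mul; [lra|intros; apply bm_bound|]. apply nle_conv; [now apply nle_DD|easy].
  - rewrite Rabs_pos_eq by lra. nra.
Qed.
(** The product varies in both factors, at a cost of 4 * Lcst * d and Lcst * d. Together with the
    [am] term the total is 6 * eps * Kcst * Lcst * d, at most d / 2. *)
Lemma Top_lip x y d : nle x 4 -> nle y 4 -> nle (fun m => x m - y m) d ->
  nle (fun m => Top x m - Top y m) (d / 2).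
Proof.
  intros Hx Hy Hd. pose proof Kab_pos as HK. pose proof Lq_pos as HL.
  assert (0 <= d) by now apply nle_nonneg in Hd.
  assert (Hgx := nle_psub nlc 4 Lcst nle_cc4 x Hx).
  assert (Hgy := nle_psub nlc 4 Lcst nle_cc4 y Hy).
  assert (Hgd := nle_psub_diff nlc Lcst x y d nle_cc8 Hx Hy Hd).
  assert (HDx := nle_DD _ _ Hgx). assert (HDy := nle_DD _ _ Hgy).
  assert (HDd := nle_DD _ _ Hgd).
  assert (Sx : summable x) by now exists 4. assert (Sy : summable y) by now exists 4.
  assert (SDx := nle_summable _ _ HDx). assert (SDy := nle_summable _ _ HDy).
  apply nle_weak with (Rabs eps * (Kcst * (Lcst * d) + Kcst * ((Lcst * d) * 4 + Lcst * d))).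
  - apply nle_ext with (f := fun m => eps * (am (dd m) * (psub nlc x m - psub nlc y m) +
      bm (dd m) * (conv (DD (fun m => psub nlc x m - psub nlc y m)) x m
                  + conv (DD (psub nlc y)) (fun m => x m - y m) m))).
    + intros m. unfold Top.
      rewrite (functional_extensionality _ _ (DD_minus (psub nlc x) (psub nlc y))).
      rewrite conv_minus_l, conv_minus_r by easy. ring.
    + apply nle_scal. apply nle_plus.
      * apply nle_mul; [lra|intros; apply am_bound|easy].
      * apply nle_mul; [lra|intros; apply bm_bound|].
        apply nle_plus; now apply nle_conv.
  - rewrite Rabs_pos_eq by lra. nra.
Qed.

Definition wsol : M -> R := fixpt Top.
Definition gsol : M -> R := psub nlc wsol.

Lemma nle_w : nle wsol 4.
Proof. apply fixpt_ball; [apply Top_ball|apply Top_lip]. Qed.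
Lemma summable_w : summable wsol.
Proof. exists 4; apply nle_w. Qed.
Lemma nle_gw : nle gsol Lcst.
Proof. apply nle_psub with 4; [apply nle_cc4|apply nle_w]. Qed.
Lemma summable_gw : summable gsol.
Proof. exists Lcst; apply nle_gw. Qed.
Lemma w_eq m : wsol m = w0 m + eps * (am (dd m) * gsol m + bm (dd m) * conv (DD gsol) wsol m).
Proof. symmetry. apply (fixpt_eq Top Top_ball Top_lip). Qed.

Lemma dd_sw m : dd (sw m) = dd m.
Proof. unfold dd, sw, n1, n2; simpl. lia. Qed.
Lemma w0_sw m : w0 (sw m) = w0 m.
Proof.
  assert (H : forall e, iv (sw e = sw m) = iv (e = m)).
  { intros e; apply iv_iff. split; [|congruence]. intros E.
    now rewrite <- (sw_sw e), E, sw_sw. }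
  unfold w0. rewrite <- (H e1), <- (H e2), <- (H e3).
  change (sw e1) with e2. change (sw e2) with e1. change (sw e3) with e3. ring.
Qed.
Lemma DD_sw g m : (forall m, g (sw m) = g m) -> DD g (sw m) = DD g m.
Proof.
  intros H. unfold DD. destruct m as [[i j] l]. unfold sw, n1, n2, n3; simpl.
  unfold iv. destruct (pdec (j = i)), (pdec (i = j)); subst; tauto || ring.
Qed.
Lemma Top_sw x : nle x 4 -> (forall m, x (sw m) = x m) -> forall m, Top x (sw m) = Top x m.
Proof.
  intros Hx H m. unfold Top. rewrite w0_sw, dd_sw.
  assert (Sx : summable x) by now exists 4.
  assert (Hg : forall m, psub nlc x (sw m) = psub nlc x m) by (intros; now apply psub_sw).
  rewrite conv_sw; [|exists Lcst; apply nle_DD, (nle_psub nlc 4); auto using nle_cc4|easy].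
  rewrite Hg, (functional_extensionality _ _ H).
  now rewrite (functional_extensionality _ _ (fun m => DD_sw (psub nlc x) m Hg)).
Qed.
Lemma w_sw m : wsol (sw m) = wsol m.
Proof.
  apply fixpt_transfer. intros n. revert m. induction n as [|n IH]; intros m; [easy|].
  simpl. apply Top_sw; [apply itr_ball, Top_ball|apply IH].
Qed.
Lemma gw_sw m : gsol (sw m) = gsol m.
Proof. apply psub_sw; [apply summable_w|apply w_sw]. Qed.
Lemma w_m0 : wsol m0 = 0.
Proof.
  apply fixpt_null. induction n as [|n IH]; [easy|].
  change (Top (itr Top n) m0 = 0). generalize dependent (itr Top n). intros x IH. unfold Top. rewrite (psub_m0 nlc x) by easy.
  rewrite conv_m0, IH. unfold w0. rewrite !iv_false by (unfold e1, e2, e3, m0; congruence).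
  simpl nlc. ring.
Qed.

(** [am] and [bm] vanish at frequency one, so only [w0] is left: the coefficient of cos z in the
    solution is exactly a. *)
Lemma w_dd1 m : dd m = 1%nat -> wsol m = iv (e1 = m) + iv (e2 = m).
Proof.
  intros H. rewrite w_eq, H. unfold w0. simpl.
  rewrite (iv_false (e3 = m)); [ring|]. intros <-. discriminate.
Qed.

(** [DD gsol] lives on frequency zero, so the other factor has exponents with n1 = n2 + 1, where
    [wsol] is the single unit coefficient at [e1]. The convolution therefore just undoes the
    division by A e^(iz) in [DD]. *)
Lemma conv_DD_up j l : conv (DD gsol) wsol (S j, j, l) = gsol (S j, j, l).
Proof.
  refine (eq_trans _ (eq_trans (tsum_single ((j, j, l), e1)
     (fun u : M * M => DD gsol (fst u) * wsol (snd u))) _)).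
  - apply tsum_ext. intros [[[a b] c] [[a' b'] c']]; simpl.
    unfold DD, madd, n1, n2, n3; simpl.
    destruct (pdec (a = b)) as [<-|N].
    2:{ rewrite (iv_false (a = b)) by easy. ring. }
    rewrite (iv_true (a = a)) by easy.
    destruct (pdec ((a + a', a + b', c + c')%nat = (S j, j, l))) as [E|N].
    + assert (E1 := f_equal n1 E). assert (E2 := f_equal n2 E). assert (E3 := f_equal n3 E).
      unfold n1, n2, n3 in E1, E2, E3; simpl in E1, E2, E3.
      assert (a' = S b') by lia. subst a'.
      rewrite w_dd1 by (unfold dd, n1, n2; cbn [fst snd]; lia).
      rewrite (iv_false (e2 = _)) by (unfold e2; congruence).
      rewrite iv_true by easy.
      destruct (pdec (e1 = (S b', b', c'))) as [E'|N'].
      * assert (b' = 0%nat) by (apply (f_equal n2) in E'; now symmetry).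
        assert (c' = 0%nat) by (apply (f_equal n3) in E'; now symmetry).
        subst. rewrite !Nat.add_0_r. rewrite !iv_true by easy. ring.
      * rewrite (iv_false (e1 = (S b', b', c'))) by easy. ring.
    + rewrite (iv_false (_ = (S j, j, l))) by easy.
      rewrite (iv_false ((j, j, l, e1) = _)); [ring|].
      intros E; apply N. unfold e1 in E; inversion E; subst. repeat f_equal; lia.
  - simpl. rewrite w_dd1 by easy. rewrite iv_true by easy. rewrite iv_false by (unfold e1, e2; congruence).
    unfold DD. rewrite iv_true by easy. unfold n1, n2, n3; simpl. ring.
Qed.
(** The reflection [sw] carries the side n2 = n1 + 1 to the one already treated; without the
    symmetry of [gsol], one scalar k^alpha could not solve both sides. *)
Lemma conv_DD_dd1 m : dd m = 1%nat -> conv (DD gsol) wsol m = gsol m.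
Proof.
  intros H. assert (SD : summable (DD gsol)) by (exists Lcst; apply nle_DD, nle_gw).
  assert (Hsw : forall m, conv (DD gsol) wsol (sw m) = conv (DD gsol) wsol m).
  { intros m'. rewrite conv_sw; auto using summable_w.
    rewrite (functional_extensionality _ _ w_sw).
    now rewrite (functional_extensionality _ _ (fun m => DD_sw gsol m gw_sw)). }
  destruct m as [[i j] l]. unfold dd, n1, n2 in H; simpl in H.
  destruct (Nat.lt_ge_cases i j).
  - assert (j = S i) by lia. subst j.
    rewrite <- Hsw, <- gw_sw. apply conv_DD_up.
  - assert (i = S j) by lia. subst i. apply conv_DD_up.
Qed.

(* The coefficientwise form of -(p + eps DD gsol) Lambda^alpha wsol + p wsol + eps gsol = e3,
   where p + eps DD gsol is the series of k^alpha. *)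
Lemma w_identity m :
  p * wsol m - p * (lam (dd m) * wsol m) - eps * (lam (dd m) * conv (DD gsol) wsol m) + eps * gsol m
  = iv (e3 = m) * 1.
Proof.
  destruct (dd m) as [|[|d]] eqn:E.
  - rewrite w_eq, E. unfold w0. simpl.
    rewrite (iv_false (e1 = m)), (iv_false (e2 = m)) by (intros <-; discriminate). field; lra.
  (* The linear symbol vanishes here, and the two nonlinear terms cancel by the choice of [DD]: this
     is the solvability condition that fixes k^alpha. *)
  - rewrite lam_1, conv_DD_dd1 by easy.
    rewrite (iv_false (e3 = m)) by (intros <-; discriminate). ring.
  - rewrite w_eq, E. assert (HL := lam_ge (S (S d)) ltac:(lia)). pose proof two_alpha.
    unfold w0, am, bm.
    rewrite !iv_false by (intros <-; discriminate).
    set (l := lam (S (S d))) in *. field. nra.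
Qed.
End Fixed.

(** * Evaluation of the fixed point *)

Lemma nle_bn g x : Rabs x * (1 + Rabs g) <= / 2 -> nle (fun k => bn g k * x ^ k) 2.
Proof.
  intros H. apply nle_dom with (2 := nle_geom_half). intros k.
  assert (0 <= (/ 2) ^ k) by (apply pow_le; lra).
  rewrite (Rabs_pos_eq ((/ 2) ^ k)), Rabs_mult, <- RPow_abs by easy.
  apply Rle_trans with ((1 + Rabs g) ^ k * Rabs x ^ k).
  - apply Rmult_le_compat_r; [apply pow_le, Rabs_pos|apply bn_bound].
  - rewrite <- Rpow_mult_distr. apply pow_incr.
    pose proof (Rabs_pos x); pose proof (Rabs_pos g). nra.
Qed.
Lemma bn_tsum g x : Rabs x * (1 + Rabs g) <= / 2 ->
  tsum (fun k => bn g k * x ^ k) = Rpower (1 + x) g.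
Proof.
  intros H. rewrite <- tsum_Series by (exists 2; now apply nle_bn).
  apply is_series_unique, binomial_series.
  pose proof (Rabs_pos g). apply Rmult_lt_reg_r with (1 + Rabs g); [lra|].
  rewrite Rinv_l; lra.
Qed.

Definition chr (A B : R) (m : M) : R := A ^ (n1 m + n2 m) * B ^ n3 m.
Definition frq (m : M) : R := INR (n1 m) - INR (n2 m).
(** [phi] and [psi] are the real and imaginary parts of the monomial X^i Y^j B^l at X = A e^(iz), Y
    = A e^(-iz). *)
Definition phi A B z (m : M) : R := chr A B m * cos (frq m * z).
Definition psi A B z (m : M) : R := chr A B m * sin (frq m * z).

Lemma pow_abs_le1 x n : Rabs x <= 1 -> Rabs (x ^ n) <= 1.
Proof. intros H. rewrite <- RPow_abs, <- (pow1 n). apply pow_incr. split; [apply Rabs_pos|easy]. Qed.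
Lemma Rabs_mult_le1 x y : Rabs x <= 1 -> Rabs y <= 1 -> Rabs (x * y) <= 1.
Proof.
  intros. rewrite Rabs_mult, <- (Rmult_1_r 1). apply Rmult_le_compat; auto using Rabs_pos.
Qed.
Lemma chr_1 A B m : Rabs A <= 1 -> Rabs B <= 1 -> Rabs (chr A B m) <= 1.
Proof. intros; apply Rabs_mult_le1; now apply pow_abs_le1. Qed.
Lemma phi_1 A B z m : Rabs A <= 1 -> Rabs B <= 1 -> Rabs (phi A B z m) <= 1.
Proof.
  intros; apply Rabs_mult_le1; [now apply chr_1|]. apply Rabs_le, COS_bound.
Qed.
Lemma psi_1 A B z m : Rabs A <= 1 -> Rabs B <= 1 -> Rabs (psi A B z m) <= 1.
Proof.
  intros; apply Rabs_mult_le1; [now apply chr_1|]. apply Rabs_le, SIN_bound.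
Qed.
Lemma chr_add A B u v : chr A B (madd u v) = chr A B u * chr A B v.
Proof.
  unfold chr, madd, n1, n2, n3; simpl.
  replace (fst (fst u) + fst (fst v) + (snd (fst u) + snd (fst v)))%nat with
    ((fst (fst u) + snd (fst u)) + (fst (fst v) + snd (fst v)))%nat by lia.
  rewrite !pow_add. ring.
Qed.
Lemma frq_add u v : frq (madd u v) = frq u + frq v.
Proof. unfold frq, madd, n1, n2; simpl. rewrite !plus_INR. ring. Qed.
Lemma phi_madd A B z u v : phi A B z (madd u v) =
  phi A B z u * phi A B z v + -1 * (psi A B z u * psi A B z v).
Proof. unfold phi, psi. rewrite chr_add, frq_add, Rmult_plus_distr_r, cos_plus. ring. Qed.
Lemma psi_madd A B z u v : psi A B z (madd u v) =
  phi A B z u * psi A B z v + psi A B z u * phi A B z v.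
Proof. unfold phi, psi. rewrite chr_add, frq_add, Rmult_plus_distr_r, sin_plus. ring. Qed.
Lemma chr_sw A B m : chr A B (sw m) = chr A B m.
Proof. unfold chr, sw, n1, n2, n3; simpl. now rewrite Nat.add_comm. Qed.
Lemma frq_sw m : frq (sw m) = - frq m.
Proof. unfold frq, sw, n1, n2; simpl. ring. Qed.
Lemma cos_frq m z : cos (frq m * z) = cos (INR (dd m) * z).
Proof.
  unfold frq, dd. destruct (Nat.le_ge_cases (n1 m) (n2 m)) as [H|H].
  - replace (n1 m - n2 m)%nat with 0%nat by lia. rewrite Nat.add_0_l, minus_INR by easy.
    rewrite <- cos_neg. f_equal; ring.
  - replace (n2 m - n1 m)%nat with 0%nat by lia. rewrite Nat.add_0_r, minus_INR by easy. easy.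
Qed.

(** The sine is odd under [sw]. Symmetric families thus have real values, and their powers can be
    evaluated through the cosine component alone. *)
Lemma psi_sym A B z x : (forall m, x (sw m) = x m) -> summable (fun m => psi A B z m * x m) ->
  tsum (fun m => psi A B z m * x m) = 0.
Proof.
  intros H S.
  assert (E : tsum (fun m => psi A B z (sw m) * x (sw m)) = tsum (fun m => psi A B z m * x m)).
  { apply (tsum_bij sw sw (fun m => psi A B z m * x m)); auto using sw_sw. }
  rewrite (tsum_ext _ (fun m => -1 * (psi A B z m * x m))), tsum_scal in E; auto; [lra|].
  intros m. unfold psi. rewrite chr_sw, frq_sw, H.
  replace (- frq m * z) with (- (frq m * z)) by ring. rewrite sin_neg. ring.
Qed.

(** Induction on [J] with s = sqrt q: n^(J+1) q^n = (n s^n) (n^J s^n), and n s^n (1 - s) <= 1 -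
    s^n. *)
Lemma npow_geom_bounded J q : 0 <= q < 1 -> exists C, forall n, INR n ^ J * q ^ n <= C.
Proof.
  revert q; induction J as [|J IH]; intros q Hq.
  - exists 1. intros n. rewrite Rmult_1_l, <- (pow1 n). apply pow_incr; lra.
  - set (s := sqrt q).
    assert (Hs : 0 <= s < 1).
    { split; [apply sqrt_pos|]. unfold s. rewrite <- sqrt_1. apply sqrt_lt_1; lra. }
    destruct (IH s Hs) as [C HC].
    assert (H1 : exists C', forall n, INR n * s ^ n <= C').
    { exists (/ (1 - s)). intros n.
      assert (Hb : forall n, INR n * s ^ n * (1 - s) <= 1 - s ^ n).
      { induction n0 as [|k IHk]; [simpl; lra|]. rewrite S_INR. simpl.
        assert (0 <= s ^ k) by (apply pow_le; lra). pose proof (pos_INR k).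
        assert (s ^ k <= 1) by (rewrite <- (pow1 k); apply pow_incr; lra).
        assert (s * (INR k * s ^ k * (1 - s)) <= s * (1 - s ^ k)) by (apply Rmult_le_compat_l; lra).
        assert (s * s ^ k * (1 - s) <= 1 - s); [|nra].
        assert (s * s ^ k <= 1) by nra. nra. }
      specialize (Hb n). assert (0 <= s ^ n) by (apply pow_le; lra).
      apply Rmult_le_reg_r with (1 - s); [lra|]. rewrite Rinv_l by lra. lra. }
    destruct H1 as [C' HC']. exists (C' * C). intros n.
    replace (INR n ^ S J * q ^ n) with ((INR n * s ^ n) * (INR n ^ J * s ^ n)).
    + apply Rmult_le_compat; auto.
      * apply Rmult_le_pos; [apply pos_INR|apply pow_le; lra].
      * apply Rmult_le_pos; apply pow_le; [apply pos_INR|lra].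
    + replace (q ^ n) with (s ^ n * s ^ n); [simpl; ring|].
      rewrite <- Rpow_mult_distr. unfold s. now rewrite sqrt_sqrt.
Qed.

Lemma lam_le_pow alpha : exists J, forall d, lam alpha d <= INR d ^ J.
Proof.
  destruct (INR_unbounded alpha) as [J HJ]. exists J. intros [|d].
  - apply pow_le, pos_INR.
  - unfold lam. assert (H : 1 <= INR (S d)) by (rewrite S_INR; pose proof (pos_INR d); lra).
    rewrite <- Rpower_pow by lra. apply Rle_Rpower; lra.
Qed.

Lemma dd_le m : (dd m <= n1 m + n2 m)%nat.
Proof. unfold dd; lia. Qed.

(** Since |i - j| <= i + j, the monomial is at most |A|^|i-j|, and for |A| < 1 this beats any
    polynomial weight in the frequency. All smoothness and Sobolev bounds rest on this gain. *)
Lemma chr_weight A B (W : nat -> R) J K0 : Rabs A < 1 -> Rabs B <= 1 ->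
  (forall d, 0 <= W d <= K0 * (1 + INR d ^ J)) ->
  exists K, forall m, Rabs (W (dd m) * chr A B m) <= K.
Proof.
  intros HA HB HW. destruct (npow_geom_bounded J (Rabs A)) as [K HK]; [split; [apply Rabs_pos|easy]|].
  assert (HK0 : 0 <= K0).
  { destruct (HW 0%nat) as [W0 W1]. assert (0 <= INR 0 ^ J) by (apply pow_le, pos_INR). nra. }
  exists (K0 * (1 + K)). intros m. rewrite Rabs_mult. destruct (HW (dd m)) as [W0 W1].
  rewrite (Rabs_pos_eq (W _)) by easy.
  assert (Hc : Rabs (chr A B m) <= Rabs A ^ dd m).
  { unfold chr. rewrite Rabs_mult. rewrite <- (Rmult_1_r (Rabs A ^ dd m)).
    apply Rmult_le_compat; try apply Rabs_pos; [|now apply pow_abs_le1].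
    rewrite <- RPow_abs. replace (n1 m + n2 m)%nat with (dd m + (n1 m + n2 m - dd m))%nat
      by (pose proof (dd_le m); lia).
    rewrite pow_add. apply Rle_trans with (Rabs A ^ dd m * 1); [|lra].
    apply Rmult_le_compat_l; [apply pow_le, Rabs_pos|].
    rewrite <- (pow1 (n1 m + n2 m - dd m)). apply pow_incr. split; [apply Rabs_pos|lra]. }
  assert (H0 : 0 <= Rabs A ^ dd m) by apply pow_le, Rabs_pos.
  assert (H1 : Rabs A ^ dd m <= 1) by (rewrite <- (pow1 (dd m)); apply pow_incr; split; [apply Rabs_pos|lra]).
  specialize (HK (dd m)).
  apply Rle_trans with (K0 * (1 + INR (dd m) ^ J) * Rabs A ^ dd m).
  - apply Rmult_le_compat; auto using Rabs_pos.
  - rewrite Rmult_assoc. apply Rmult_le_compat_l; [easy|]. lra.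
Qed.

(** * The evaluated equation and the value of k^alpha at a = 0 *)

Section Equation.
Variables alpha p : R.
Hypothesis (Ha : 0 < alpha) (Hp : 1 <= p).
Variable eps : R.
Hypothesis (He : 0 < eps) (He16 : eps * (16 * qcst p) <= 1)
  (HeK : eps * (12 * (Kcst alpha * Lcst p)) <= 1).
Notation w := (wsol alpha p eps).
Notation gw := (gsol alpha p eps).
Notation lam := (lam alpha).
Notation qp := (qcst p).
Notation Lq := (Lcst p).
Notation cc := (nlc p eps).

Lemma eps_s_small s : Rabs s <= 4 -> Rabs (eps * s) * qp <= / 2.
Proof.
  intros H. rewrite Rabs_mult, (Rabs_pos_eq eps) by lra.
  pose proof (qp_ge p Hp). pose proof (Rabs_pos s). nra.
Qed.
Lemma summable_cc s : Rabs s <= 4 -> summable (fun k => cc k * s ^ k).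
Proof.
  intros H. exists Lq. apply nle_dom with (2 := nle_cc8 p Hp eps He He16).
  intros k. rewrite !Rabs_mult. apply Rmult_le_compat_l; [apply Rabs_pos|].
  rewrite <- !RPow_abs. apply pow_incr. rewrite (Rabs_pos_eq 8) by lra.
  split; [apply Rabs_pos|lra].
Qed.

Lemma cc_tsum s : Rabs s <= 4 ->
  eps ^ 2 * tsum (fun k => cc k * s ^ k) = Rpower (1 + eps * s) (p + 1) - 1 - (p + 1) * (eps * s).
Proof.
  intros Hs. assert (Hx := eps_s_small s Hs). assert (S := summable_cc s Hs).
  rewrite <- (bn_tsum (p + 1)) by exact Hx.
  assert (S' : summable (fun k => bn (p + 1) k * (eps * s) ^ k)) by (exists 2; now apply nle_bn).
  assert (Sh : forall f : nat -> R, summable f -> summable (fun k => f (Datatypes.S k))).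
  { intros f [K H]. exists K. apply (nle_inj Datatypes.S f); [congruence|easy]. }
  assert (S1 := Sh _ S). assert (S1' := Sh _ S').
  rewrite (tsum_S _ S), (tsum_S _ S'), (tsum_S _ S1), (tsum_S _ S1').
  assert (S2 := Sh _ S1).
  rewrite !Rmult_plus_distr_l, <- (tsum_scal _ _ S2).
  rewrite (tsum_ext (fun k => eps ^ 2 * (cc (Datatypes.S (Datatypes.S k)) * s ^ Datatypes.S (Datatypes.S k)))
   (fun k => bn (p + 1) (Datatypes.S (Datatypes.S k)) * (eps * s) ^ Datatypes.S (Datatypes.S k))).
  - generalize (tsum (fun k => bn (p + 1) (Datatypes.S (Datatypes.S k)) * (eps * s) ^ Datatypes.S (Datatypes.S k))).
    intros t. simpl. field.
  - intros k. unfold nlc. rewrite Rpow_mult_distr. simpl. ring.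
Qed.

(** The termwise derivative of the nonlinearity, by k bn (p + 1) k = (p + 1) bn p (k - 1). *)
Lemma cc_tsum_derive s : Rabs s <= 4 ->
  eps * tsum (fun k => cc k * (INR k * s ^ pred k)) = (p + 1) * (Rpower (1 + eps * s) p - 1).
Proof.
  intros Hs. assert (Hx := eps_s_small s Hs).
  assert (Hx' : Rabs (eps * s) * (1 + Rabs p) <= / 2).
  { apply Rle_trans with (2 := Hx). apply Rmult_le_compat_l; [apply Rabs_pos|].
    unfold qcst. rewrite !Rabs_pos_eq; lra. }
  rewrite <- (bn_tsum p) by exact Hx'.
  assert (S' : summable (fun k => bn p k * (eps * s) ^ k)) by (exists 2; now apply nle_bn).
  assert (Sh : forall f : nat -> R, summable f -> summable (fun k => f (S k))).
  { intros f [K H]. exists K. apply (nle_inj S f); [congruence|easy]. }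
  assert (S1' := Sh _ S').
  assert (E : forall k, cc (S (S k)) * (INR (S (S k)) * s ^ pred (S (S k)))
      = / eps * ((p + 1) * (bn p (S k) * (eps * s) ^ S k))).
  { intros k. change (pred (S (S k))) with (S k). unfold nlc.
    assert (Hb := bn_shift (p + 1) (S k)). replace (p + 1 - 1) with p in Hb by ring.
    rewrite <- S_INR in Hb.
    replace ((p + 1) * (bn p (S k) * (eps * s) ^ S k))
      with ((p + 1) * bn p (S k) * (eps * s) ^ S k) by ring.
    rewrite <- Hb, Rpow_mult_distr. simpl pow. field. lra. }
  assert (S : summable (fun k => cc k * (INR k * s ^ pred k))).
  { assert (S2 : summable (fun k => cc (S (S k)) * (INR (S (S k)) * s ^ pred (S (S k))))).
    { apply summable_ext with (fun k => / eps * ((p + 1) * (bn p (S k) * (eps * s) ^ S k))).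
      - intros; now rewrite E.
      - now apply summable_scal, summable_scal. }
    destruct S2 as [K HK]. exists K. intros L HL.
    apply Rle_trans with (sumL (fun k => Rabs (cc k * (INR k * s ^ pred k))) (map (fun k => S (S k)) (seq 0 (list_max L)))).
    - assert (G : forall L', NoDup L' -> (forall x, In x L' -> (x <= S (list_max L))%nat) ->
         sumL (fun t => Rabs (cc t * (INR t * s ^ pred t))) L' <=
         sumL (fun t => Rabs (cc t * (INR t * s ^ pred t))) (0%nat :: 1%nat :: map (fun k => S (S k)) (seq 0 (list_max L)))).
      { intros L' HN Hi. apply sumL_incl; auto; [intros; apply Rabs_pos|].
        intros x Hx2. specialize (Hi x Hx2). destruct x as [|[|x]]; simpl; auto.
        do 2 right. apply (in_map (fun k => S (S k))), in_seq. lia. }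
      specialize (G L HL). simpl (sumL _ (0%nat :: _)) in G.
      rewrite !Rmult_0_l, Rabs_R0 in G. simpl map in G. lapply G; [intros; lra|].
      intros x Hx2. assert (HH := proj1 (list_max_le L (list_max L)) (Nat.le_refl _)).
      rewrite Forall_forall in HH. specialize (HH x Hx2). lia.
    - rewrite sumL_map. apply HK, seq_NoDup. }
  assert (S1 := Sh _ S).
  rewrite (tsum_S _ S), (tsum_S _ S'), (tsum_S _ S1).
  rewrite (tsum_ext _ _ E), !tsum_scal by auto using summable_scal.
  simpl. field. lra.
Qed.

Lemma ev_w_small f : (forall m, Rabs (f m) <= 1) -> Rabs (tsum (fun m => f m * w m)) <= 4.
Proof. intros H. apply tsum_Rabs, nle_mul1; [easy|]. now apply nle_w. Qed.

Section At.
Variables A B z : R.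
Hypothesis (HA : Rabs A < 1) (HB : Rabs B <= 1).
Let HA1 : Rabs A <= 1. Proof. lra. Qed.

(** The solution will be 1 + eps * [sval]; [Vval] is Lambda^alpha of [sval], and [kappa] is k^alpha.
    In [kappa], [chr] replaces [phi] because [DD gw] lives on i = j, where monomials do not depend
    on z. *)
Definition sval : R := tsum (fun m => phi A B z m * w m).
Definition Vval : R := tsum (fun m => phi A B z m * (lam (dd m) * w m)).
Definition kappa : R := p + eps * tsum (fun m => chr A B m * DD gw m).

Lemma sval_small : Rabs sval <= 4.
Proof. apply ev_w_small. intros; now apply phi_1. Qed.

(** The sine component of [w] vanishes by symmetry, so evaluation maps powers in the algebra to
    scalar powers and the composite to the scalar series. *)
Lemma ev_gw : eps ^ 2 * tsum (fun m => phi A B z m * gw m)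
  = Rpower (1 + eps * sval) (p + 1) - 1 - (p + 1) * (eps * sval).
Proof.
  rewrite <- cc_tsum by apply sval_small. f_equal.
  unfold gsol. rewrite (psub_eval cc 4 Lq (nle_cc4 p Hp eps He He16)).
  - apply tsum_ext. intros k. f_equal.
    refine (proj1 (ev_pw (phi A B z) (psi A B z) (-1) _ _ _ _ _ _ w k _ _)).
    + intros; now apply phi_1.
    + intros; now apply psi_1.
    + unfold phi, chr, frq, m0, n1, n2, n3; simpl. rewrite Rminus_0_r, Rmult_0_l, cos_0. ring.
    + unfold psi, chr, frq, m0, n1, n2, n3; simpl. rewrite Rminus_0_r, Rmult_0_l, sin_0. ring.
    + apply phi_madd.
    + apply psi_madd.
    + now apply summable_w.
    + rewrite psi_sym; [ring|intros; now apply w_sw|].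
      apply summable_mul1; [intros; now apply psi_1|now apply summable_w].
  - intros; now apply phi_1.
  - now apply nle_w.
Qed.

Lemma lam_phi_bound : exists K, forall m, Rabs (lam (dd m) * phi A B z m) <= K.
Proof.
  destruct (lam_le_pow alpha) as [J HJ].
  destruct (chr_weight A B lam J 1 HA HB) as [K HK].
  { intros d; split; [apply lam_nonneg|]. specialize (HJ d). lra. }
  exists K. intros m. apply Rle_trans with (2 := HK m).
  unfold phi. rewrite <- Rmult_assoc, Rabs_mult.
  apply Rle_trans with (Rabs (lam (dd m) * chr A B m) * 1); [|lra].
  apply Rmult_le_compat_l; [apply Rabs_pos|]. apply Rabs_le, COS_bound.
Qed.

Lemma summable_DDgw : summable (DD gw).
Proof. exists Lq. apply nle_DD. now apply nle_gw. Qed.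

Lemma summable_V : summable (fun m => phi A B z m * (lam (dd m) * w m)).
Proof.
  destruct lam_phi_bound as [K HK].
  apply summable_ext with (fun m => (lam (dd m) * phi A B z m) * w m); [intros; ring|].
  apply summable_mul with K; [easy|now apply summable_w].
Qed.

(** [DD gw] has frequency zero, so multiplication by it leaves the frequency of the other factor
    unchanged and commutes with Lambda^alpha. *)
Lemma ev_lam_conv :
  tsum (fun m => phi A B z m * (lam (dd m) * conv (DD gw) w m))
  = tsum (fun m => chr A B m * DD gw m) * Vval.
Proof.
  destruct lam_phi_bound as [K HK].
  rewrite (tsum_ext _ (fun m => (lam (dd m) * phi A B z m) * conv (DD gw) w m)) by (intros; ring).
  rewrite (conv_eval _ K); auto using summable_DDgw; [|now apply summable_w].
  unfold Vval. rewrite <- tsum_prod_mul.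
  - apply tsum_ext. intros [u v]; simpl. unfold DD.
    destruct (pdec (n1 u = n2 u)) as [E|N].
    + rewrite iv_true by easy. unfold phi. rewrite chr_add, frq_add.
      replace (frq u) with 0 by (unfold frq; rewrite E; ring).
      replace (dd (madd u v)) with (dd v).
      * rewrite Rplus_0_l. ring.
      * unfold dd, madd, n1, n2 in *; simpl. lia.
    + rewrite iv_false by easy. ring.
  - apply summable_mul1; [intros; apply chr_1; lra|apply summable_DDgw].
  - apply summable_V.
Qed.

(** [w_identity] is evaluated at the character and multiplied by eps; the source [e3] becomes eps *
    B, and [ev_gw] turns the last term into the nonlinearity. *)
Lemma solution_eq :
  - kappa * (eps * Vval) - (1 + eps * sval) + Rpower (1 + eps * sval) (p + 1) = eps * B.
Proof.
  assert (Hid : tsum (fun m => phi A B z m * (p * w m - p * (lam (dd m) * w m)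
     - eps * (lam (dd m) * conv (DD gw) w m) + eps * gw m)) = B).
  { rewrite (tsum_ext _ (fun m => iv (e3 = m) * phi A B z m)).
    - rewrite tsum_single. unfold phi, chr, frq, e3, n1, n2, n3; simpl.
      rewrite Rminus_0_r, Rmult_0_l, cos_0. ring.
    - intros m. rewrite w_identity by easy. ring. }
  assert (S1 : summable (fun m => phi A B z m * w m)).
  { apply summable_mul1; [intros; now apply phi_1|now apply summable_w]. }
  assert (S2 : summable (fun m => phi A B z m * gw m)).
  { apply summable_mul1; [intros; now apply phi_1|now apply summable_gw]. }
  assert (S3 := summable_V).
  assert (S4 : summable (fun m => phi A B z m * (lam (dd m) * conv (DD gw) w m))).
  { destruct lam_phi_bound as [K HK].
    apply summable_ext with (fun m => (lam (dd m) * phi A B z m) * conv (DD gw) w m); [intros; ring|].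
    apply summable_mul with K; [easy|]. apply summable_conv; [apply summable_DDgw|now apply summable_w]. }
  rewrite (tsum_ext _ (fun m => (p * (phi A B z m * w m) + -p * (phi A B z m * (lam (dd m) * w m)))
     + (- eps * (phi A B z m * (lam (dd m) * conv (DD gw) w m)) + eps * (phi A B z m * gw m)))) in Hid
    by (intros; ring).
  rewrite !tsum_plus, !tsum_scal in Hid by auto using summable_plus, summable_scal.
  rewrite ev_lam_conv in Hid. fold sval Vval in Hid.
  assert (Hg := ev_gw). unfold kappa.
  replace (Rpower (1 + eps * sval) (p + 1)) with
    (1 + (p + 1) * (eps * sval) + eps ^ 2 * tsum (fun m => phi A B z m * gw m)) by lra.
  apply (f_equal (Rmult eps)) in Hid. rewrite <- Hid. ring.
Qed.
End At.

(* Extracts the coefficient of A e^(iz). *)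
Definition dpsi (B : R) (m : M) : R :=
  match n1 m, n2 m with 1%nat, O => B ^ n3 m | _, _ => 0 end.

Lemma dpsi_1 B m : Rabs B <= 1 -> Rabs (dpsi B m) <= 1.
Proof.
  intros H. unfold dpsi. destruct (n1 m) as [|[|]], (n2 m);
    try (rewrite Rabs_R0; lra). now apply pow_abs_le1.
Qed.
Lemma dpsi_madd B u v : dpsi B (madd u v) = chr 0 B u * dpsi B v + dpsi B u * chr 0 B v.
Proof.
  destruct u as [[i j] l], v as [[i' j'] l']. unfold dpsi, chr, madd, n1, n2, n3; simpl.
  rewrite pow_add. destruct i as [|[|i]], j as [|j], i' as [|[|i']], j' as [|j']; simpl; ring.
Qed.

Lemma dpsi_w B : Rabs B <= 1 -> tsum (fun m => dpsi B m * w m) = 1.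
Proof.
  intros HB. rewrite (tsum_ext _ (fun m => iv (e1 = m) * dpsi B m)).
  - rewrite tsum_single. unfold dpsi, e1, n1, n2, n3; simpl. easy.
  - intros m. destruct (pdec (n1 m = 1%nat /\ n2 m = 0%nat)) as [[E1 E2]|N].
    + rewrite w_dd1 by (auto; unfold dd; rewrite E1, E2; easy).
      rewrite (iv_false (e2 = m)); [ring|]. intros <-. discriminate.
    + unfold dpsi. destruct m as [[[|[|i]] [|j]] l]; unfold n1, n2, n3 in *; simpl in *; try ring. tauto.
Qed.

(** At A = 0, k^alpha is p plus eps times the coefficient of A e^(iz) in the nonlinearity. [dpsi] is
    a derivation over [chr 0 B], so the chain rule gives that coefficient as the derivative of the
    nonlinearity times the coefficient of [w], which is 1 by [dpsi_w]. *)
Lemma kap_at_0 B : Rabs B <= 1 ->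
  kappa 0 B = (p + 1) * Rpower (1 + eps * sval 0 B 0) p - 1.
Proof.
  intros HB. assert (H0 : Rabs 0 <= 1) by (rewrite Rabs_R0; lra).
  set (s := tsum (fun m => chr 0 B m * w m)).
  assert (Es : sval 0 B 0 = s).
  { apply tsum_ext. intros m. unfold phi. rewrite Rmult_0_r, cos_0. ring. }
  assert (Hs : Rabs s <= 4) by (apply ev_w_small; intros; now apply chr_1).
  rewrite Es. unfold kappa.
  (* [chr 0 B] keeps only the entries (0,0,l) of [DD gw], because 0 ^ 0 = 1; these are the entries
     (1,0,l) of [gw]. *)
  assert (E : tsum (fun m => chr 0 B m * DD gw m) = tsum (fun m => dpsi B m * gw m)).
  { rewrite (tsum_inj (A := M) (B := M) (fun m => (S (n1 m), n2 m, n3 m)) (fun m => dpsi B m * gw m)).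
    - apply tsum_ext. intros [[i j] l]. unfold DD, chr, dpsi, n1, n2, n3; simpl.
      destruct i as [|i], j as [|j]; simpl; try ring.
      rewrite iv_true by easy. ring.
    - intros [[i j] l] [[i' j'] l'] E'. unfold n1, n2, n3 in E'; simpl in E'. congruence.
    - apply summable_mul1; [intros; now apply dpsi_1|now apply summable_gw].
    - intros [[[|i] j] l] Hb.
      + unfold dpsi, n1; simpl. ring.
      + exfalso. apply (Hb (i, j, l)). easy. }
  rewrite E. unfold gsol. rewrite (psub_eval cc 4 Lq (nle_cc4 p Hp eps He He16)).
  - rewrite (tsum_ext _ (fun k => cc k * (INR k * s ^ pred k))).
    + rewrite (cc_tsum_derive s Hs). ring.
    + intros k. f_equal.
      assert (G := proj2 (ev_pw (chr 0 B) (dpsi B) 0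
         (fun m => chr_1 0 B m H0 HB) (fun m => dpsi_1 B m HB)
         ltac:(unfold chr, m0, n1, n2, n3; simpl; ring) ltac:(easy)
         ltac:(intros; rewrite chr_add; ring) (dpsi_madd B) w k
         (summable_w alpha p Ha Hp eps He He16 HeK) ltac:(ring))).
      rewrite G, dpsi_w by easy. fold s. ring.
  - intros; now apply dpsi_1.
  - now apply nle_w.
Qed.
End Equation.

Lemma Rabs_cos_le1 x : Rabs (cos x) <= 1.
Proof. apply Rabs_le, COS_bound. Qed.
Lemma Rabs_sin_le1 x : Rabs (sin x) <= 1.
Proof. apply Rabs_le, SIN_bound. Qed.

(** * Cosine series *)

Definition rapid (u : nat -> R) := forall J, summable (fun n => INR n ^ J * u n).

Lemma rapid_summable u : rapid u -> summable u.
Proof. intros H. apply summable_ext with (2 := H 0%nat). intros; simpl; ring. Qed.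
Lemma rapid_scal_n c u : rapid u -> rapid (fun n => c * INR n * u n).
Proof.
  intros H J. apply summable_ext with (fun n => c * (INR n ^ S J * u n)); [intros; simpl; ring|].
  apply summable_scal, H.
Qed.
Lemma rapid_zero : rapid (fun _ => 0).
Proof. intros J. exists 0. apply nle_ext with (f := fun _ => 0); [intros; ring|apply nle_zero]. Qed.

Lemma Rabs_sin_le y : Rabs (sin y) <= Rabs y.
Proof.
  destruct (MVT_gen sin 0 y cos) as [c [_ Hc]].
  - intros; apply is_derive_Reals, derivable_pt_lim_sin.
  - intros; apply continuity_sin.
  - rewrite sin_0, !Rminus_0_r in Hc. rewrite Hc, Rabs_mult.
    rewrite <- (Rmult_1_l (Rabs y)) at 2. apply Rmult_le_compat_r; [apply Rabs_pos|].
    apply Rabs_cos_le1.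
Qed.
Lemma Rabs_mid y c : Rmin 0 y <= c <= Rmax 0 y -> Rabs c <= Rabs y.
Proof.
  unfold Rmin, Rmax. destruct Rle_dec; intros; unfold Rabs; repeat destruct Rcase_abs; lra.
Qed.
Lemma Rabs_cos_1 y : Rabs (cos y - 1) <= y ^ 2.
Proof.
  destruct (MVT_gen cos 0 y (fun x => - sin x)) as [c [Hc1 Hc]].
  - intros; apply is_derive_Reals, derivable_pt_lim_cos.
  - intros; apply continuity_cos.
  - rewrite cos_0, Rminus_0_r in Hc. rewrite Hc, Rabs_mult, Rabs_Ropp, <- pow2_abs.
    assert (H := Rabs_sin_le c). apply Rabs_mid in Hc1. pose proof (Rabs_pos y). simpl. nra.
Qed.
Lemma Rabs_sin_id y : Rabs (sin y - y) <= y ^ 2.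
Proof.
  destruct (MVT_gen (fun x => sin x - x) 0 y (fun x => cos x - 1)) as [c [Hc1 Hc]].
  - intros. auto_derive; [easy|ring].
  - intros x Hx. apply continuity_pt_minus; [apply continuity_sin|apply continuity_pt_id].
  - rewrite sin_0, !Rminus_0_r in Hc. rewrite Hc, Rabs_mult.
    destruct (MVT_gen cos 0 c (fun x => - sin x)) as [c' [_ Hc']].
    + intros; apply is_derive_Reals, derivable_pt_lim_cos.
    + intros; apply continuity_cos.
    + rewrite cos_0, Rminus_0_r in Hc'.
      assert (Rabs (cos c - 1) <= Rabs c).
      { rewrite Hc', Rabs_mult, Rabs_Ropp. rewrite <- (Rmult_1_l (Rabs c)) at 2.
        apply Rmult_le_compat_r; [apply Rabs_pos|]. apply Rabs_sin_le1. }
      apply Rabs_mid in Hc1. rewrite <- pow2_abs. pose proof (Rabs_pos y). simpl. nra.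
Qed.

Lemma trig_quadratic a b x y :
  Rabs (a * cos (x + y) + b * sin (x + y) - (a * cos x + b * sin x) - y * (b * cos x - a * sin x))
  <= 2 * (Rabs a + Rabs b) * y ^ 2.
Proof.
  rewrite cos_plus, sin_plus.
  replace (a * (cos x * cos y - sin x * sin y) + b * (sin x * cos y + cos x * sin y) -
    (a * cos x + b * sin x) - y * (b * cos x - a * sin x)) with
    ((a * cos x + b * sin x) * (cos y - 1) + (b * cos x - a * sin x) * (sin y - y)) by ring.
  assert (HS : forall t s, Rabs (t * cos x) <= Rabs t /\ Rabs (s * sin x) <= Rabs s).
  { intros t s. rewrite !Rabs_mult. pose proof (Rabs_pos t); pose proof (Rabs_pos s).
    pose proof (Rabs_cos_le1 x). pose proof (Rabs_sin_le1 x). split; nra. }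
  apply Rle_trans with (1 := Rabs_triang _ _). rewrite !Rabs_mult.
  pose proof (Rabs_cos_1 y). pose proof (Rabs_sin_id y).
  assert (H1 : Rabs (a * cos x + b * sin x) <= Rabs a + Rabs b).
  { apply Rle_trans with (1 := Rabs_triang _ _). destruct (HS a b). lra. }
  assert (H2 : Rabs (b * cos x - a * sin x) <= Rabs a + Rabs b).
  { apply Rle_trans with (1 := Rabs_triang _ _). rewrite Rabs_Ropp. destruct (HS b a). lra. }
  assert (Rabs (a * cos x + b * sin x) * Rabs (cos y - 1) <= (Rabs a + Rabs b) * y ^ 2)
    by (apply Rmult_le_compat; auto using Rabs_pos).
  assert (Rabs (b * cos x - a * sin x) * Rabs (sin y - y) <= (Rabs a + Rabs b) * y ^ 2)
    by (apply Rmult_le_compat; auto using Rabs_pos).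
  lra.
Qed.

Lemma is_derive_quadratic (f : R -> R) x l K :
  (forall h, Rabs (f (x + h) - f x - h * l) <= K * h ^ 2) -> is_derive f x l.
Proof.
  intros H. apply is_derive_Reals. intros e He.
  assert (HK : 0 < 1 + Rabs K) by (pose proof (Rabs_pos K); lra).
  assert (Hd : 0 < e / (1 + Rabs K)) by now apply Rdiv_lt_0_compat.
  exists (mkposreal _ Hd). intros h Hh Hlt. simpl in Hlt.
  replace ((f (x + h) - f x) / h - l) with ((f (x + h) - f x - h * l) / h) by (field; easy).
  rewrite Rabs_div by easy. assert (P : 0 < Rabs h) by now apply Rabs_pos_lt.
  apply Rlt_div_l; [easy|]. apply Rle_lt_trans with (1 := H h).
  rewrite <- (pow2_abs h). apply Rlt_div_r in Hlt; [|easy].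
  pose proof (Rle_abs K). simpl. nra.
Qed.

(** Sines are included so that the class is closed under differentiation. *)
Definition trig (a b : nat -> R) (z : R) : R :=
  tsum (fun n => a n * cos (INR n * z) + b n * sin (INR n * z)).

Lemma summable_cos (a : nat -> R) z : summable a -> summable (fun n => a n * cos (INR n * z)).
Proof.
  intros H. apply summable_ext with (fun n => cos (INR n * z) * a n); [intros; ring|].
  apply summable_mul1; [|easy]. intros; apply Rabs_cos_le1.
Qed.
Lemma summable_sin (a : nat -> R) z : summable a -> summable (fun n => a n * sin (INR n * z)).
Proof.
  intros H. apply summable_ext with (fun n => sin (INR n * z) * a n); [intros; ring|].
  apply summable_mul1; [|easy]. intros; apply Rabs_sin_le1.
Qed.
Lemma summable_trig a b z : rapid a -> rapid b ->
  summable (fun n => a n * cos (INR n * z) + b n * sin (INR n * z)).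
Proof.
  intros; apply summable_plus; [apply summable_cos|apply summable_sin]; now apply rapid_summable.
Qed.

(** The n-th first-order Taylor remainder is at most 2 (|a_n| + |b_n|) n^2 h^2 for every h. Rapid
    decay makes these bounds summable, so the whole remainder is O(h^2). *)
Lemma is_derive_trig a b z : rapid a -> rapid b ->
  is_derive (trig a b) z (trig (fun n => 1 * INR n * b n) (fun n => -1 * INR n * a n) z).
Proof.
  intros Ha Hb.
  assert (Sab : summable (fun n => 2 * (Rabs (INR n ^ 2 * a n) + Rabs (INR n ^ 2 * b n)))).
  { apply summable_scal, summable_plus; apply (proj1 (summable_abs _)); [apply Ha|apply Hb]. }
  destruct Sab as [K HK].
  apply is_derive_quadratic with K. intros h.
  assert (S1 := summable_trig _ _ z (rapid_scal_n 1 _ Hb) (rapid_scal_n (-1) _ Ha)).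
  unfold trig.
  rewrite <- tsum_minus, <- (tsum_scal h), <- tsum_minus; auto using summable_trig, summable_scal.
  2:{ apply summable_ext with (fun n => (a n * cos (INR n * (z + h)) + b n * sin (INR n * (z + h)))
        + -1 * (a n * cos (INR n * z) + b n * sin (INR n * z))); [intros; ring|].
      auto using summable_plus, summable_scal, summable_trig. }
  apply tsum_Rabs.
  apply nle_dom with (g := fun n => h ^ 2 * (2 * (Rabs (INR n ^ 2 * a n) + Rabs (INR n ^ 2 * b n)))).
  - intros n. rewrite Rmult_plus_distr_l.
    assert (Q := trig_quadratic (a n) (b n) (INR n * z) (INR n * h)).
    match type of Q with Rabs ?u <= _ => match goal with |- Rabs ?v <= _ => replace v with u by ring end end.
    apply Rle_trans with (1 := Q). rewrite !Rabs_mult, (Rabs_pos_eq (INR n ^ 2)) by apply pow2_ge_0.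
    rewrite (Rabs_pos_eq (h ^ 2)) by apply pow2_ge_0. rewrite (Rabs_pos_eq 2) by lra.
    rewrite (Rabs_pos_eq (_ + _)).
    + right; rewrite Rpow_mult_distr. ring.
    + pose proof (Rabs_pos (a n)); pose proof (Rabs_pos (b n)); pose proof (pow2_ge_0 (INR n)). nra.
  - apply nle_weak with (Rabs (h ^ 2) * K); [now apply nle_scal|].
    rewrite Rabs_pos_eq by apply pow2_ge_0. lra.
Qed.

Lemma trig_smooth a b : rapid a -> rapid b -> forall j, exists a' b', rapid a' /\ rapid b' /\
  forall z, Derive_n (trig a b) j z = trig a' b' z.
Proof.
  intros Ha Hb; induction j as [|j (a' & b' & Ha' & Hb' & H)].
  - now exists a, b.
  - exists (fun n => 1 * INR n * b' n), (fun n => -1 * INR n * a' n).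
    split; [now apply rapid_scal_n|]. split; [now apply rapid_scal_n|].
    intros z. simpl. rewrite (Derive_ext _ _ z H). apply is_derive_unique. now apply is_derive_trig.
Qed.

Section CosSeries.
Variable c : nat -> R.
Hypothesis Hc : rapid c.
Variable f : R -> R.
Hypothesis Hf : forall z, f z = tsum (fun n => c n * cos (INR n * z)).

Lemma cos_series_trig z : f z = trig c (fun _ => 0) z.
Proof. rewrite Hf. apply tsum_ext; intros; ring. Qed.
Lemma cos_series_smooth j z : ex_derive_n f j z.
Proof.
  destruct j as [|j]; [easy|]. simpl.
  destruct (trig_smooth c (fun _ => 0) Hc rapid_zero j) as (a' & b' & Ha' & Hb' & H).
  apply ex_derive_ext with (trig a' b').
  - intros t. rewrite <- H. symmetry. apply Derive_n_ext, cos_series_trig.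
  - eexists. now apply is_derive_trig.
Qed.
Lemma cos_series_even z : f (- z) = f z.
Proof.
  rewrite !Hf. apply tsum_ext; intros n.
  replace (INR n * - z) with (- (INR n * z)) by ring. now rewrite cos_neg.
Qed.
Lemma cos_series_periodic z : f (z + 2 * PI) = f z.
Proof.
  rewrite !Hf. apply tsum_ext; intros n.
  replace (INR n * (z + 2 * PI)) with (INR n * z + 2 * INR n * PI) by ring. now rewrite cos_period.
Qed.

(** * Fourier coefficients and fractional Laplacian of a cosine series *)

Lemma is_RInt_tsum (u : nat -> R -> R) (I b : nat -> R) (x y : R) :
  summable b -> (forall n z, Rabs (u n z) <= b n) -> (forall n, is_RInt (u n) x y (I n)) ->
  summable I -> is_RInt (fun z => tsum (fun n => u n z)) x y (tsum I).
Proof.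
  intros Hb Hu HI HS.
  assert (Su : forall z, summable (fun n => u n z)).
  { intros z. apply summable_dom with b; [|easy]. intros n. apply Rle_trans with (1 := Hu n z), Rle_abs. }
  destruct (filterlim_RInt (fun N z => sum_n (fun n => u n z) N) x y eventually _
     (fun z => tsum (fun n => u n z)) (fun N => sum_n I N)) as [If [H1 H2]].
  - intros N. induction N as [|N IH].
    + apply is_RInt_ext with (u 0%nat); [intros; now rewrite sum_O|]. rewrite sum_O. apply HI.
    + rewrite sum_Sn. apply is_RInt_ext with (fun z => plus (sum_n (fun n => u n z) N) (u (S N) z)).
      * intros; now rewrite sum_Sn.
      * now apply (is_RInt_plus (V := R_NormedModule)).
  (* Uniform convergence: the tail of the majorant [b] bounds the error at every z. *)
  - apply filterlim_locally. intros e.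
    assert (T := tsum_tail b (fun N n => (n <= N)%nat) Hb (fun N n H => Nat.le_trans _ _ _ H (Nat.le_succ_diag_r N))
       (fun n => ex_intro _ n (Nat.le_refl n))).
    apply is_lim_seq_spec in T. destruct (T e) as [N0 HN0].
    exists N0. intros N HN z. specialize (HN0 N HN).
    change (Rabs (sum_n (fun n => u n z) N - tsum (fun n => u n z)) < e).
    apply Rle_lt_trans with (2 := HN0). rewrite Rminus_0_r.
    apply Rle_trans with (2 := Rle_abs _).
    assert (E : sum_n (fun n => u n z) N = tsum (fun n => iv (n <= N)%nat * u n z)).
    { symmetry. apply tsum_eq. rewrite <- sumL_seq.
      rewrite (sumL_ext _ (fun n => iv (n <= N)%nat * u n z)).
      - apply has_sum_finite; [apply seq_NoDup|]. intros n Hn. rewrite iv_false; [ring|].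
        intros Hle; apply Hn, in_seq. lia.
      - intros n Hn. apply in_seq in Hn. rewrite iv_true; [ring|lia]. }
    rewrite E, <- tsum_minus; [|apply summable_mul1; [intros; apply iv_abs|easy]|easy].
    assert (Sb : summable (fun n => iv (~ (n <= N)%nat) * Rabs (b n))).
    { apply summable_mul1; [intros; apply iv_abs|]. now apply (proj1 (summable_abs _)). }
    apply Rle_trans with (tsum (fun n => Rabs (iv (~ (n <= N)%nat) * Rabs (b n)))).
    + apply tsum_Rabs. apply nle_dom with (2 := nle_tsum _ Sb).
      intros n. destruct (pdec (n <= N)%nat) as [L|L].
      * rewrite (iv_true (n <= N)%nat) by easy. rewrite (iv_false (~ _)) by tauto.
        replace (1 * u n z - u n z) with 0 by ring. rewrite Rabs_R0. apply Rabs_pos.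
      * rewrite (iv_false (n <= N)%nat) by easy. rewrite (iv_true (~ _)) by tauto.
        replace (0 * u n z - u n z) with (- u n z) by ring.
        rewrite Rabs_Ropp, Rmult_1_l, Rabs_Rabsolu.
        apply Rle_trans with (1 := Hu n z), Rle_abs.
    + right. apply tsum_ext. intros n. apply Rabs_pos_eq, Rmult_le_pos; [apply iv_01|apply Rabs_pos].
  - assert (E : If = tsum I).
    { apply (filterlim_locally_unique (F := eventually) (sum_n I)); [exact H1|].
      apply tsum_is_series, HS. }
    now rewrite <- E.
Qed.

(** The integral of e^(irz) over one period. *)
Definition ci (r : Z) : R := if Z.eqb r 0 then 2 * PI else 0.

Lemma sin_2Zpi r : sin (IZR r * (2 * PI)) = 0.
Proof.
  apply sin_eq_0_1. exists (r * 2)%Z. rewrite mult_IZR. ring.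
Qed.
Lemma cos_2Zpi r : cos (IZR r * (2 * PI)) = 1.
Proof.
  replace (IZR r * (2 * PI)) with (2 * (IZR r * PI)) by ring.
  rewrite cos_2a_sin, (sin_eq_0_1 (IZR r * PI)); [ring|]. now exists r.
Qed.
Lemma is_RInt_cosZ r : is_RInt (fun z => cos (IZR r * z)) 0 (2 * PI) (ci r).
Proof.
  unfold ci. destruct (Z.eqb_spec r 0) as [->|N].
  - apply is_RInt_ext with (fun _ => 1); [intros; now rewrite Rmult_0_l, cos_0|].
    replace (2 * PI) with (scal (2 * PI - 0) 1) at 2 by (unfold scal; simpl; unfold mult; simpl; ring).
    apply (is_RInt_const (V := R_NormedModule)).
  - assert (IZR r <> 0) by (intros E; apply N, eq_IZR, E).
    evar_last.
    + apply (is_RInt_derive (fun z => sin (IZR r * z) / IZR r)).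
      * intros x _. auto_derive; [easy|]. field; easy.
      * intros x _. apply (ex_derive_continuous (fun z => cos (IZR r * z))). auto_derive. easy.
    + unfold minus, plus, opp; simpl. rewrite sin_2Zpi, Rmult_0_r, sin_0. field; easy.
Qed.
Lemma is_RInt_sinZ r : is_RInt (fun z => sin (IZR r * z)) 0 (2 * PI) 0.
Proof.
  destruct (Z.eq_dec r 0) as [->|N].
  - apply is_RInt_ext with (fun _ => 0); [intros; now rewrite Rmult_0_l, sin_0|].
    evar_last; [apply (is_RInt_const (V := R_NormedModule))|].
    unfold scal; simpl; unfold mult; simpl; ring.
  - assert (IZR r <> 0) by (intros E; apply N, eq_IZR, E).
    evar_last.
    + apply (is_RInt_derive (fun z => - cos (IZR r * z) / IZR r)).
      * intros x _. auto_derive; [easy|]. field; easy.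
      * intros x _. apply (ex_derive_continuous (fun z => sin (IZR r * z))). auto_derive. easy.
    + unfold minus, plus, opp; simpl. rewrite cos_2Zpi, Rmult_0_r, cos_0. field; easy.
Qed.

Lemma is_RInt_cc n k a : is_RInt (fun z => a * cos (INR n * z) * cos (IZR k * z)) 0 (2 * PI)
  (a / 2 * (ci (Z.of_nat n - k) + ci (Z.of_nat n + k))).
Proof.
  apply is_RInt_ext with (fun z => scal (a / 2) (plus (cos (IZR (Z.of_nat n - k) * z))
     (cos (IZR (Z.of_nat n + k) * z)))).
  - intros z _. rewrite minus_IZR, plus_IZR, <- INR_IZR_INZ.
    rewrite Rmult_minus_distr_r, Rmult_plus_distr_r, cos_plus, cos_minus.
    unfold scal, plus; simpl; unfold mult; simpl. field.
  - apply (is_RInt_scal (V := R_NormedModule)), (is_RInt_plus (V := R_NormedModule));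
      apply is_RInt_cosZ.
Qed.
Lemma is_RInt_cs n k a : is_RInt (fun z => a * cos (INR n * z) * sin (IZR k * z)) 0 (2 * PI) 0.
Proof.
  evar_last.
  - apply is_RInt_ext with (fun z => scal (a / 2) (minus (sin (IZR (Z.of_nat n + k) * z))
     (sin (IZR (Z.of_nat n - k) * z)))).
    + intros z _. rewrite minus_IZR, plus_IZR, <- INR_IZR_INZ.
      rewrite Rmult_minus_distr_r, Rmult_plus_distr_r, sin_plus, sin_minus.
      unfold scal, minus, plus, opp; simpl; unfold mult; simpl. field.
    + apply (is_RInt_scal (V := R_NormedModule)), (is_RInt_minus (V := R_NormedModule));
        apply is_RInt_sinZ.
  - unfold scal, minus, plus, opp; simpl; unfold mult; simpl. ring.
Qed.

Definition fcoef (k : Z) : R := if Z.eqb k 0 then c 0%nat else c (Z.abs_nat k) / 2.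

Lemma four_coef_cos k : four_coef f k = RtoC (fcoef k).
Proof.
  assert (Sc := rapid_summable c Hc). pose proof PI_RGT_0.
  assert (Sa := proj1 (summable_abs _) Sc).
  unfold four_coef.
  assert (E1 : is_RInt (fun z => f z * sin (IZR k * z)) 0 (2 * PI) 0).
  { evar_last.
    - apply is_RInt_ext with (fun z => tsum (fun n => c n * cos (INR n * z) * sin (IZR k * z))).
      + intros z _. rewrite Hf, (Rmult_comm (tsum _)), <- tsum_scal by now apply summable_cos.
        apply tsum_ext; intros; ring.
      + apply is_RInt_tsum with (b := fun n => Rabs (c n)) (I := fun _ => 0); auto.
        * intros n z. rewrite !Rabs_mult.
          pose proof (Rabs_cos_le1 (INR n * z)). pose proof (Rabs_sin_le1 (IZR k * z)).
          pose proof (Rabs_pos (c n)). pose proof (Rabs_pos (cos (INR n * z))).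
          pose proof (Rabs_pos (sin (IZR k * z))).
          assert (Rabs (cos (INR n * z)) * Rabs (sin (IZR k * z)) <= 1) by nra. nra.
        * intros n. apply is_RInt_cs.
        * exists 0; apply nle_zero.
    - apply tsum_zero. }
  set (I := fun n => c n / 2 * (ci (Z.of_nat n - k) + ci (Z.of_nat n + k))).
  assert (Hci : forall r, 0 <= ci r <= 2 * PI) by (intros r; unfold ci; destruct Z.eqb; lra).
  assert (SI : summable I).
  { apply summable_ext with (fun n => (/ 2 * (ci (Z.of_nat n - k) + ci (Z.of_nat n + k))) * c n).
    - intros; unfold I; field.
    - apply summable_mul with (2 * PI); [|easy]. intros n.
      destruct (Hci (Z.of_nat n - k)%Z), (Hci (Z.of_nat n + k)%Z). rewrite Rabs_pos_eq; lra. }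
  assert (E2 : is_RInt (fun z => f z * cos (IZR k * z)) 0 (2 * PI) (tsum I)).
  { apply is_RInt_ext with (fun z => tsum (fun n => c n * cos (INR n * z) * cos (IZR k * z))).
    - intros z _. rewrite Hf, (Rmult_comm (tsum _)), <- tsum_scal by now apply summable_cos.
      apply tsum_ext; intros; ring.
    - apply is_RInt_tsum with (b := fun n => Rabs (c n)); auto.
      + intros n z. rewrite !Rabs_mult.
        pose proof (Rabs_cos_le1 (INR n * z)). pose proof (Rabs_cos_le1 (IZR k * z)).
        pose proof (Rabs_pos (c n)). pose proof (Rabs_pos (cos (INR n * z))).
        pose proof (Rabs_pos (cos (IZR k * z))).
        assert (Rabs (cos (INR n * z)) * Rabs (cos (IZR k * z)) <= 1) by nra. nra.
      + intros n. apply is_RInt_cc. }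
  rewrite (is_RInt_unique _ _ _ _ E1), (is_RInt_unique _ _ _ _ E2).
  unfold RtoC. f_equal; [|ring].
  assert (EI : tsum I = 2 * PI * fcoef k).
  { rewrite (tsum_ext _ (fun n => iv (Z.abs_nat k = n) * (2 * PI * fcoef k))).
    - now rewrite (tsum_single _ (fun _ => 2 * PI * fcoef k)).
    - intros n. unfold I, fcoef, ci.
      destruct (pdec (Z.abs_nat k = n)) as [E|N].
      + rewrite iv_true by easy. subst n.
        destruct (Z.eqb_spec k 0) as [->|Nk]; [simpl; field|].
        destruct (Z.eqb_spec (Z.of_nat (Z.abs_nat k) - k) 0), (Z.eqb_spec (Z.of_nat (Z.abs_nat k) + k) 0);
          try lia; field.
      + rewrite iv_false by easy.
        destruct (Z.eqb_spec (Z.of_nat n - k) 0), (Z.eqb_spec (Z.of_nat n + k) 0); try lia; field. }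
  rewrite EI. field. lra.
Qed.

Lemma C_filterlim (u : nat -> C) (l1 l2 : R) :
  is_lim_seq (fun n => fst (u n)) l1 -> is_lim_seq (fun n => snd (u n)) l2 ->
  filterlim u eventually (locally ((l1, l2) : C)).
Proof.
  intros H1 H2. apply (filterlim_locally (U := C_UniformSpace)). intros e.
  apply is_lim_seq_spec in H1, H2. destruct (H1 e) as [N1 A1], (H2 e) as [N2 A2].
  exists (N1 + N2)%nat. intros N HN. split; [apply A1|apply A2]; lia.
Qed.
Lemma C_sum_fst (u : nat -> C) N : fst (sum_n u N) = sum_n (fun n => fst (u n)) N.
Proof. induction N; [now rewrite !sum_O|]. rewrite !sum_Sn, <- IHN. easy. Qed.
Lemma C_sum_snd (u : nat -> C) N : snd (sum_n u N) = sum_n (fun n => snd (u n)) N.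
Proof. induction N; [now rewrite !sum_O|]. rewrite !sum_Sn, <- IHN. easy. Qed.

(** The terms at k and -k recombine into a cosine. The series in [is_frac_lap] starts at frequency
    one, and the sum here loses nothing at n = 0 because [lam] is 0 there. *)
Lemma frac_lap_cos alpha x : is_frac_lap alpha f x
  (RtoC (tsum (fun n => lam alpha n * c n * cos (INR n * x)))).
Proof.
  assert (Sl : summable (fun n => lam alpha n * c n)).
  { destruct (lam_le_pow alpha) as [J HJ]. apply summable_dom with (2 := Hc J).
    intros n. rewrite !Rabs_mult. apply Rmult_le_compat_r; [apply Rabs_pos|].
    pose proof (lam_nonneg alpha n). rewrite Rabs_pos_eq by easy.
    apply Rle_trans with (1 := HJ n), Rle_abs. }
  set (t := fun n => lam alpha n * c n * cos (INR n * x)).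
  assert (St : summable t) by now apply summable_cos.
  assert (Ss : is_series (fun j => t (S j)) (tsum t)).
  { replace (tsum t) with (tsum (fun j => t (S j))).
    - apply tsum_is_series. destruct St as [K HK]. exists K. apply (nle_inj S t); [congruence|easy].
    - rewrite (tsum_S t) by easy. unfold t at 2. simpl. ring. }
  unfold is_frac_lap. apply is_series_ext with (fun j => RtoC (t (S j))).
  - intros j. rewrite !four_coef_cos. unfold fcoef.
    replace (Z.abs_nat (Z.of_nat (S j))) with (S j) by lia.
    replace (Z.abs_nat (- Z.of_nat (S j))) with (S j) by lia.
    replace (Z.eqb (Z.of_nat (S j)) 0) with false by (symmetry; apply Z.eqb_neq; lia).
    replace (Z.eqb (- Z.of_nat (S j)) 0) with false by (symmetry; apply Z.eqb_neq; lia).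
    unfold t. change (lam alpha (S j)) with (Rpower (INR (S j)) alpha).
    unfold eix. rewrite cos_neg, sin_neg.
    apply injective_projections; simpl; field.
  - apply (C_filterlim (sum_n (fun j => RtoC (t (S j))))).
    + apply is_lim_seq_ext with (sum_n (fun j => t (S j))); [intros; now rewrite C_sum_fst|exact Ss].
    + apply is_lim_seq_ext with (fun _ => 0); [|apply is_lim_seq_const].
      intros N. rewrite C_sum_snd. simpl. rewrite sum_n_const. ring.
Qed.
End CosSeries.

(** * Analyticity of sums of monomials *)

(* The I-th Taylor coefficient of x^N. *)
Definition be (N I : nat) (x : R) : R := if (I <=? N)%nat then Binomial.C N I * x ^ (N - I) else 0.

Lemma be_has_sum N x h : has_sum (fun I => be N I x * h ^ I) ((h + x) ^ N).
Proof.
  replace ((h + x) ^ N) with (sumL (fun I => be N I x * h ^ I) (seq 0 (S N))).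
  - apply has_sum_finite; [apply seq_NoDup|]. intros I HI. rewrite in_seq in HI.
    unfold be. destruct (Nat.leb_spec I N); [lia|ring].
  - rewrite sumL_seq, sum_n_Reals, binomial. apply sum_eq. intros I HI.
    unfold be. destruct (Nat.leb_spec I N); [ring|lia].
Qed.
Lemma be_abs N I x : Rabs (be N I x) = be N I (Rabs x).
Proof.
  unfold be. destruct (I <=? N)%nat; [|apply Rabs_R0].
  rewrite Rabs_mult, <- RPow_abs. f_equal. apply Rabs_pos_eq.
  unfold Binomial.C. apply Rmult_le_pos; [apply pos_INR|]. left. apply Rinv_0_lt_compat.
  apply Rmult_lt_0_compat; apply INR_fact_lt_0.
Qed.
Lemma nle_be N x r : 0 <= r -> nle (fun I => be N I x * r ^ I) ((Rabs x + r) ^ N).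
Proof.
  intros Hr. apply has_sum_nle. rewrite Rplus_comm.
  apply has_sum_ext with (2 := be_has_sum N (Rabs x) r).
  intros I. rewrite Rabs_mult, be_abs, (Rabs_pos_eq (r ^ I)) by now apply pow_le. easy.
Qed.

Lemma double_series (z : nat -> nat -> R) K : (forall i j, 0 <= z i j) ->
  nle (fun u : nat * nat => z (fst u) (snd u)) K ->
  (forall i, ex_series (z i)) /\ ex_series (fun i => Series (z i)).
Proof.
  intros H0 H.
  assert (Hs : forall i, summable (z i)).
  { intros i. exists K. exact (nle_slice _ K i H). }
  split.
  - intros i. apply ex_series_ext with (fun j => Rabs (z i j)).
    + intros; now apply Rabs_pos_eq.
    + apply summable_ex_series, Hs.
  - apply ex_series_ext with (fun i => Rabs (tsum (z i))).
    + intros i. rewrite tsum_Series by apply Hs. apply Rabs_pos_eq.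
      rewrite <- (tsum_zero (T := nat)). apply tsum_le; auto. exists 0; apply nle_zero.
    + apply summable_ex_series. exists K. exact (nle_outer_tsum _ K H).
Qed.

Lemma square_tsum (f : nat * nat -> R) N :
  sum_n (fun i => sum_n (fun j => f (i, j)) N) N
  = tsum (fun u => iv (fst u <= N /\ snd u <= N)%nat * f u).
Proof.
  symmetry. apply tsum_eq.
  assert (Hin : forall u, In u (list_prod (seq 0 (S N)) (seq 0 (S N))) <-> (fst u <= N /\ snd u <= N)%nat).
  { intros [i j]. rewrite in_prod_iff, !in_seq. simpl. lia. }
  replace (sum_n (fun i => sum_n (fun j => f (i, j)) N) N) with
    (sumL (fun u => iv (fst u <= N /\ snd u <= N)%nat * f u) (list_prod (seq 0 (S N)) (seq 0 (S N)))).
  - apply has_sum_finite; [apply NoDup_list_prod; apply seq_NoDup|].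
    intros u Hu. rewrite iv_false; [ring|]. now rewrite <- Hin.
  - rewrite (sumL_ext _ f).
    + rewrite sumL_list_prod, <- sumL_seq. apply sumL_ext. intros; apply sumL_seq.
    + intros u Hu. apply Hin in Hu. rewrite iv_true by easy. ring.
Qed.

Section Reexpand.
Context {T : Type}.
Variables (X : T -> R) (N L : T -> nat) (x y r : R).
Hypothesis (Hr : 0 < r).

(** The coefficient of h^I h'^J in X t * (x + h)^(N t) * (y + h')^(L t). Taking absolute values
    everywhere replaces the centre by (|x|, |y|), hence the majorant with |x| + r and |y| + r. *)
Definition Yt (u : T * (nat * nat)) : R :=
  X (fst u) * (be (N (fst u)) (fst (snd u)) x * be (L (fst u)) (snd (snd u)) y).

Lemma nle_Yt K : nle (fun t => X t * ((Rabs x + r) ^ N t * (Rabs y + r) ^ L t)) K ->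
  nle (fun u => Yt u * (r ^ fst (snd u) * r ^ snd (snd u))) K.
Proof.
  intros H.
  assert (HP : forall t, nle (fun v : nat * nat => X t * ((be (N t) (fst v) x * r ^ fst v)
      * (be (L t) (snd v) y * r ^ snd v)))
     (Rabs (X t) * ((Rabs x + r) ^ N t * (Rabs y + r) ^ L t))).
  { intros t. apply nle_scal. apply (nle_prod_mul (fun I => be (N t) I x * r ^ I)
     (fun J => be (L t) J y * r ^ J)); apply nle_be; lra. }
  apply nle_ext with (f := fun u : T * (nat * nat) => X (fst u) *
    ((be (N (fst u)) (fst (snd u)) x * r ^ fst (snd u))
     * (be (L (fst u)) (snd (snd u)) y * r ^ snd (snd u)))).
  { intros; unfold Yt; ring. }
  apply tonelli; simpl.
  - intros t. eexists. apply HP.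
  - apply nle_dom with (2 := H). intros t.
    apply Rle_trans with (Rabs (X t) * ((Rabs x + r) ^ N t * (Rabs y + r) ^ L t)).
    + apply tsum_Rabs, (proj1 (nle_abs _ _)), HP.
    + rewrite Rabs_mult. apply Rmult_le_compat_l; [apply Rabs_pos|]. apply Rle_abs.
Qed.

Hypothesis HS : summable (fun t => X t * ((Rabs x + r) ^ N t * (Rabs y + r) ^ L t)).
Variables h h' : R.
Hypothesis (Hh : Rabs h <= r) (Hh' : Rabs h' <= r).

Lemma pow_le_r t n : Rabs t <= r -> Rabs (t ^ n) <= r ^ n.
Proof. intros; rewrite <- RPow_abs. apply pow_incr. split; [apply Rabs_pos|easy]. Qed.

Lemma summable_Yh : summable (fun u => Yt u * (h ^ fst (snd u) * h' ^ snd (snd u))).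
Proof.
  destruct HS as [K HK]. exists K. apply nle_dom with (2 := nle_Yt K HK).
  intros u. rewrite !Rabs_mult. apply Rmult_le_compat_l; [apply Rabs_pos|].
  rewrite !(Rabs_pos_eq (r ^ _)) by (apply pow_le; lra).
  apply Rmult_le_compat; try apply Rabs_pos; now apply pow_le_r.
Qed.
Lemma tsum_Yh t : tsum (fun v : nat * nat => Yt (t, v) * (h ^ fst v * h' ^ snd v))
  = X t * ((h + x) ^ N t * (h' + y) ^ L t).
Proof.
  assert (S1 : forall n z k, Rabs k <= r -> summable (fun I => be n I z * k ^ I)).
  { intros n z k Hk. exists ((Rabs z + r) ^ n). apply nle_dom with (2 := nle_be n z r ltac:(lra)).
    intros I. rewrite !Rabs_mult. apply Rmult_le_compat_l; [apply Rabs_pos|].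
    rewrite (Rabs_pos_eq (r ^ _)) by (apply pow_le; lra). now apply pow_le_r. }
  rewrite (tsum_ext _ (fun v : nat * nat => X t * ((be (N t) (fst v) x * h ^ fst v)
      * (be (L t) (snd v) y * h' ^ snd v)))) by (intros; unfold Yt; simpl; ring).
  rewrite tsum_scal.
  - rewrite (tsum_prod_mul (fun I => be (N t) I x * h ^ I) (fun J => be (L t) J y * h' ^ J)) by auto.
    now rewrite (tsum_eq _ _ (be_has_sum _ _ _)), (tsum_eq _ _ (be_has_sum _ _ _)).
  - destruct (S1 (N t) x h Hh) as [K1 H1], (S1 (L t) y h' Hh') as [K2 H2].
    eexists. exact (nle_prod_mul _ _ _ _ H1 H2).
Qed.
End Reexpand.

(** Each monomial is re-expanded at (x, y) by the binomial formula and Fubini collects equal powers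
    of the increments. Absolute convergence at the enlarged point (|x| + r, |y| + r) is all that
    this uses. *)
Theorem analytic2_family {T} (X : T -> R) (N L : T -> nat) (D : R -> R -> Prop) f :
  (forall x y, D x y -> exists r, 0 < r /\
     summable (fun t => X t * ((Rabs x + r) ^ N t * (Rabs y + r) ^ L t))) ->
  (forall a b, D a b -> f a b = tsum (fun t => X t * (a ^ N t * b ^ L t))) ->
  analytic2 D f.
Proof.
  intros HS Hf x y Hxy. destruct (HS x y Hxy) as (r & Hr & HSr). exists r. split; [easy|].
  set (c := fun i j => tsum (fun t => Yt X N L x y (t, (i, j)))).
  exists c.
  assert (Hs : forall h h', Rabs h <= r -> Rabs h' <= r ->
    summable (fun v : (nat * nat) * T => Yt X N L x y (snd v, fst v) * (h ^ fst (fst v) * h' ^ snd (fst v)))).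
  { intros h h' Hh Hh'. destruct (summable_Yh X N L x y r Hr HSr h h' Hh Hh') as [K HK]. exists K.
    apply (nle_bij (fun v : (nat * nat) * T => (snd v, fst v)) (fun u => (snd u, fst u))
      (fun u => Yt X N L x y u * (h ^ fst (snd u) * h' ^ snd (snd u)))); [now intros []|easy]. }
  assert (Hslice : forall v, summable (fun t => Yt X N L x y (t, v))).
  { intros v. destruct (Hs r r) as [K HK]; try (rewrite Rabs_pos_eq; lra).
    assert (H1 := nle_slice _ K v HK). simpl in H1.
    assert (Hp : r ^ fst v * r ^ snd v <> 0) by (apply Rmult_integral_contrapositive; split; apply pow_nonzero; lra).
    apply summable_ext with (fun t => / (r ^ fst v * r ^ snd v) *
       (Yt X N L x y (t, v) * (r ^ fst v * r ^ snd v))).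
    - intros t. field. split; apply pow_nonzero; lra.
    - apply summable_scal. now exists K. }
  assert (Hz : exists K, nle (fun u : nat * nat => Rabs (c (fst u) (snd u)) * r ^ (fst u + snd u)) K).
  { destruct (Hs r r) as [K HK]; try (rewrite Rabs_pos_eq; lra). exists K.
    apply nle_dom with (2 := nle_outer_tsum _ K HK). intros [i j]. simpl.
    assert (E : tsum (fun b => Yt X N L x y (b, (i, j)) * (r ^ i * r ^ j)) = c i j * r ^ (i + j)).
    { unfold c. rewrite (tsum_ext _ (fun t => r ^ (i + j) * Yt X N L x y (t, (i, j)))).
      - rewrite tsum_scal by auto. ring.
      - intros; rewrite pow_add; ring. }
    rewrite E, !Rabs_mult, Rabs_Rabsolu. lra. }
  destruct Hz as [K HK].
  destruct (double_series (fun i j => Rabs (c i j) * r ^ (i + j)) K) as [D1 D2]; [|easy|].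
  { intros; apply Rmult_le_pos; [apply Rabs_pos|apply pow_le; lra]. }
  split; [exact D1|]. split; [exact D2|].
  intros a b Hab Ha Hb.
  assert (Hh : Rabs (a - x) <= r) by lra. assert (Hh' : Rabs (b - y) <= r) by lra.
  specialize (Hs (a - x) (b - y) Hh Hh').
  apply is_lim_seq_ext with (fun M => sum_n (fun i => sum_n (fun j =>
     (fun u : nat * nat => c (fst u) (snd u) * ((a - x) ^ fst u * (b - y) ^ snd u)) (i, j)) M) M).
  { intros M'. apply sum_n_ext; intros i; apply sum_n_ext; intros j. simpl. ring. }
  apply (has_sum_square (fun u : nat * nat => c (fst u) (snd u) * ((a - x) ^ fst u * (b - y) ^ snd u))).
  assert (E : forall u : nat * nat, c (fst u) (snd u) * ((a - x) ^ fst u * (b - y) ^ snd u) =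
     tsum (fun t => Yt X N L x y (t, u) * ((a - x) ^ fst u * (b - y) ^ snd u))).
  { intros [i j]. unfold c. rewrite Rmult_comm, <- tsum_scal by auto. apply tsum_ext; intros; simpl; ring. }
  apply has_sum_ext with (fun u => tsum (fun t => Yt X N L x y (t, u) * ((a - x) ^ fst u * (b - y) ^ snd u)));
    [intros; now rewrite E|].
  replace (f a b) with (tsum (fun u : nat * nat =>
     tsum (fun t => Yt X N L x y (t, u) * ((a - x) ^ fst u * (b - y) ^ snd u)))).
  - apply tsum_correct. destruct Hs as [K' HK']. exists K'. exact (nle_outer_tsum _ K' HK').
  - refine (eq_trans (fubini _ Hs) _). rewrite <- (tsum_swap _ Hs), Hf by easy. simpl.
    apply tsum_ext. intros t. rewrite (tsum_Yh X N L x y r) by easy.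
    f_equal. f_equal; f_equal; ring.
Qed.

(** * Analyticity with values in H^alpha *)

Section Sobolev.
Variable alpha : R.
Hypothesis Ha : 0 < alpha.

Definition Wt (k : Z) : R := Rpower (1 + IZR k ^ 2) (alpha / 2).
Lemma Wt_pos k : 0 < Wt k.
Proof. apply exp_pos. Qed.
Lemma Wt_sq j : Wt (Z.of_nat (S j)) ^ 2 = Rpower (1 + INR (S j) ^ 2) alpha.
Proof.
  unfold Wt. rewrite <- INR_IZR_INZ, <- Rpower_pow by apply exp_pos.
  rewrite Rpower_mult. f_equal. simpl; field.
Qed.
Lemma Wt_opp k : Wt (- k) = Wt k.
Proof. unfold Wt. rewrite opp_IZR. f_equal. ring. Qed.
Lemma Wt_0 : Wt 0 = 1.
Proof.
  unfold Wt. replace (1 + 0 ^ 2) with 1 by ring.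
  unfold Rpower. now rewrite ln_1, Rmult_0_r, exp_0.
Qed.

(** The sequence [v], which pairs the frequencies j + 1 and -(j + 1), has l^1 norm at most 2 B, so
    its squares sum to at most 4 B^2. With the zero mode the norm is at most sqrt 5 * B. *)
Lemma H_l1 (u : Z -> R) B : nle (fun k => Wt k * u k) B ->
  in_H alpha (fun k => RtoC (u k)) /\ Hnorm alpha (fun k => RtoC (u k)) <= 3 * B.
Proof.
  intros H. assert (HB : 0 <= B) by now apply nle_nonneg in H.
  set (v := fun j : nat => Wt (Z.of_nat (S j)) * (Rabs (u (Z.of_nat (S j))) + Rabs (u (- Z.of_nat (S j))%Z))).
  assert (Hv : nle v (B + B)).
  { apply nle_ext with (f := fun j : nat => Rabs (Wt (Z.of_nat (S j)) * u (Z.of_nat (S j)))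
       + Rabs (Wt (- Z.of_nat (S j)) * u (- Z.of_nat (S j))%Z)).
    - intros j. unfold v. rewrite Wt_opp, !Rabs_mult, (Rabs_pos_eq (Wt _)) by (left; apply Wt_pos). ring.
    - apply nle_plus; apply (proj1 (nle_abs _ _)).
      + apply (nle_inj (fun j => Z.of_nat (S j)) (fun k => Wt k * u k)); [intros; lia|easy].
      + apply (nle_inj (fun j => (- Z.of_nat (S j))%Z) (fun k => Wt k * u k)); [intros; lia|easy]. }
  assert (Hv0 : forall j, 0 <= v j).
  { intros j. apply Rmult_le_pos; [left; apply Wt_pos|].
    pose proof (Rabs_pos (u (Z.of_nat (S j)))). pose proof (Rabs_pos (u (- Z.of_nat (S j))%Z)). lra. }
  assert (Ht : forall j, 0 <= Hsq_terms alpha (fun k => RtoC (u k)) j <= (B + B) * v j).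
  { intros j. unfold Hsq_terms. rewrite !Cmod_R, <- Wt_sq.
    set (p1 := Rabs (u (Z.of_nat (S j)))). set (p2 := Rabs (u (- Z.of_nat (S j))%Z)).
    assert (0 <= p1) by apply Rabs_pos. assert (0 <= p2) by apply Rabs_pos.
    pose proof (Wt_pos (Z.of_nat (S j))) as HW. split.
    - apply Rmult_le_pos; [apply pow2_ge_0|]. nra.
    - apply Rle_trans with (v j * v j).
      + unfold v. fold p1 p2. set (W := Wt (Z.of_nat (S j))) in *.
        replace (W * (p1 + p2) * (W * (p1 + p2))) with (W ^ 2 * (p1 ^ 2 + p2 ^ 2) + W ^ 2 * (2 * p1 * p2)) by ring.
        assert (0 <= W ^ 2 * (2 * p1 * p2)) by (apply Rmult_le_pos; [apply pow2_ge_0|nra]). lra.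
      + apply Rmult_le_compat_r; [apply Hv0|]. assert (Q := nle_point _ _ j Hv).
        rewrite Rabs_pos_eq in Q by apply Hv0. exact Q. }
  assert (Hn : nle (Hsq_terms alpha (fun k => RtoC (u k))) ((B + B) * (B + B))).
  { apply nle_dom with (g := fun j => (B + B) * v j).
    - intros j. destruct (Ht j). rewrite !Rabs_pos_eq; try lra.
    - apply nle_weak with (Rabs (B + B) * (B + B)); [now apply nle_scal|].
      rewrite Rabs_pos_eq; lra. }
  assert (Sn := nle_summable _ _ Hn).
  assert (Ex : ex_series (Hsq_terms alpha (fun k => RtoC (u k)))).
  { apply ex_series_Rabs. now apply summable_ex_series. }
  split; [exact Ex|].
  unfold Hnorm. rewrite tsum_Series by easy.
  assert (T' : tsum (Hsq_terms alpha (fun k => RtoC (u k))) <= (B + B) * (B + B)).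
  { apply Rle_trans with (1 := Rle_abs _). exact (tsum_Rabs _ _ Hn). }
  assert (Q := nle_point _ _ 0%Z H). simpl in Q. rewrite Wt_0, Rmult_1_l in Q.
  rewrite Cmod_R. pose proof (Rabs_pos (u 0%Z)).
  apply Rsqr_incr_0_var; [|lra]. rewrite Rsqr_sqrt.
  - unfold Rsqr. nra.
  - assert (0 <= tsum (Hsq_terms alpha (fun k => RtoC (u k)))); [|nra].
    rewrite <- (tsum_zero (T := nat)). apply tsum_le; auto; [|exists 0; apply nle_zero].
    intros j; apply Ht.
Qed.

(** Infinitely many monomials share one frequency; the Sobolev weight is constant on these fibres
    and passes through the grouping. *)
Lemma nle_Wt_fibre {T} (kk : T -> Z) (X : T -> R) B : nle (fun t => Wt (kk t) * X t) B ->
  nle (fun k => Wt k * tsum (fun t => iv (kk t = k) * X t)) B.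
Proof.
  intros H. apply nle_ext with (2 := nle_fibre kk _ _ H). intros k.
  rewrite <- tsum_scal.
  - apply tsum_ext; intros t. unfold iv. destruct pdec as [<-|]; ring.
  - assert (Wt k <> 0) by (apply Rgt_not_eq, Wt_pos).
    apply summable_ext with (fun t => / Wt k * (iv (kk t = k) * (Wt (kk t) * X t))).
    + intros t. unfold iv. destruct pdec as [<-|]; field; easy.
    + apply summable_scal, summable_mul1; [intros; apply iv_abs|]. now exists B.
Qed.

(** The scalar re-expansion, carried out with the Sobolev weight inside the l^1 norm. The error of
    the n-th square partial sum is the part of one summable family outside that square, and [H_l1]
    bounds its norm by 3 times the tail [tau n]. *)
Theorem analytic2_H_family {T} (X : T -> R) (N L : T -> nat) (kk : T -> Z) (D : R -> R -> Prop)
  (F : R -> R -> Z -> C) :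
  (forall x y, D x y -> exists r, 0 < r /\
     summable (fun t => (Wt (kk t) * X t) * ((Rabs x + r) ^ N t * (Rabs y + r) ^ L t))) ->
  (forall a b k, D a b -> F a b k = RtoC (tsum (fun t => iv (kk t = k) * (X t * (a ^ N t * b ^ L t))))) ->
  analytic2_H alpha D F.
Proof.
  intros HS HF.
  assert (EF : forall a b, D a b ->
     F a b = fun k => RtoC (tsum (fun t => iv (kk t = k) * (X t * (a ^ N t * b ^ L t))))).
  { intros a b Hab. apply functional_extensionality; intros k; now apply HF. }
  split.
  { intros a b Hab. rewrite EF by easy. destruct (HS a b Hab) as (r & Hr & [K HK]).
    apply (H_l1 (fun k => tsum (fun t => iv (kk t = k) * (X t * (a ^ N t * b ^ L t)))) K).
    apply nle_Wt_fibre. apply nle_dom with (2 := HK). intros t. rewrite <- Rmult_assoc.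
    rewrite !(Rabs_mult (Wt (kk t) * X t)). apply Rmult_le_compat_l; [apply Rabs_pos|].
    rewrite !Rabs_mult.
    assert (G : forall z n, Rabs (z ^ n) <= Rabs ((Rabs z + r) ^ n)).
    { intros z n. rewrite <- !RPow_abs. apply pow_incr. split; [apply Rabs_pos|].
      pose proof (Rabs_pos z). rewrite (Rabs_pos_eq (_ + _)); lra. }
    apply Rmult_le_compat; auto using Rabs_pos. }
  intros x y Hxy. destruct (HS x y Hxy) as (r & Hr & HSr). exists r. split; [easy|].
  set (Y := Yt X N L x y).
  assert (EY : forall u, Yt (fun t => Wt (kk t) * X t) N L x y u = Wt (kk (fst u)) * Y u).
  { intros u; unfold Y, Yt; ring. }
  assert (Hs : forall h h', Rabs h <= r -> Rabs h' <= r ->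
    summable (fun u : T * (nat * nat) => Wt (kk (fst u)) * (Y u * (h ^ fst (snd u) * h' ^ snd (snd u))))).
  { intros h h' Hh Hh'.
    apply summable_ext with (2 := summable_Yh _ N L x y r Hr HSr h h' Hh Hh').
    intros u. rewrite EY; ring. }
  assert (HrK : exists K, nle (fun v : (nat * nat) * T => Wt (kk (snd v)) *
     (Y (snd v, fst v) * (r ^ fst (fst v) * r ^ snd (fst v)))) K).
  { destruct (Hs r r) as [K HK]; try (rewrite Rabs_pos_eq; lra). exists K.
    apply (nle_bij (fun v : (nat * nat) * T => (snd v, fst v)) (fun u => (snd u, fst u))
      (fun u => Wt (kk (fst u)) * (Y u * (r ^ fst (snd u) * r ^ snd (snd u)))));
    [now intros []|easy]. }
  destruct HrK as [K HK].
  assert (Hslice : forall v, summable (fun t => Wt (kk t) * Y (t, v))).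
  { intros v. assert (H1 := nle_slice _ K v HK). simpl in H1.
    apply summable_ext with (fun t => / (r ^ fst v * r ^ snd v) *
       (Wt (kk t) * (Y (t, v) * (r ^ fst v * r ^ snd v)))).
    - intros t. field. split; apply pow_nonzero; lra.
    - apply summable_scal. now exists K. }
  assert (HsY : forall v k, summable (fun t => iv (kk t = k) * Y (t, v))).
  { intros v k. apply summable_ext with (fun t => (/ Wt k * iv (kk t = k)) * (Wt (kk t) * Y (t, v))).
    - intros t. unfold iv. assert (Wt k <> 0) by (apply Rgt_not_eq, Wt_pos).
      destruct pdec as [<-|]; field; easy.
    - apply summable_mul with (Rabs (/ Wt k)); [|auto]. intros t. rewrite Rabs_mult.
      pose proof (iv_abs (kk t = k)). pose proof (Rabs_pos (/ Wt k)). pose proof (Rabs_pos (iv (kk t = k))). nra. }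
  set (nrm := fun v : nat * nat => tsum (fun t => Rabs (Wt (kk t) * Y (t, v)))).
  set (cR := fun i j k => tsum (fun t => iv (kk t = k) * Y (t, (i, j)))).
  assert (Hc : forall i j, in_H alpha (fun k => RtoC (cR i j k)) /\
     Hnorm alpha (fun k => RtoC (cR i j k)) <= 3 * nrm (i, j)).
  { intros i j. apply H_l1. apply (nle_Wt_fibre kk (fun t => Y (t, (i, j)))).
    apply nle_tsum, Hslice. }
  exists (fun i j k => RtoC (cR i j k)).
  split; [intros; apply Hc|].
  destruct (double_series (fun i j => Hnorm alpha (fun k => RtoC (cR i j k)) * r ^ (i + j)) (3 * K)) as [D1 D2].
  { intros; apply Rmult_le_pos; [apply sqrt_pos|apply pow_le; lra]. }
  { assert (O := nle_outer _ K HK).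
    apply nle_weak with (Rabs 3 * K); [|rewrite Rabs_pos_eq; lra].
    apply nle_dom with (2 := nle_scal 3 _ _ O).
    intros [i j]. simpl.
    assert (P : 0 < r ^ i * r ^ j) by (apply Rmult_lt_0_compat; now apply pow_lt).
    rewrite (tsum_ext _ (fun t => (r ^ i * r ^ j) * Rabs (Wt (kk t) * Y (t, (i, j))))).
    - rewrite tsum_scal by (apply (proj1 (summable_abs _)), Hslice). fold (nrm (i, j)).
      rewrite pow_add. destruct (Hc i j) as [_ Hn]. rewrite Rabs_mult, (Rabs_pos_eq (r ^ i * r ^ j)) by lra.
      rewrite (Rabs_pos_eq (Hnorm _ _)) by apply sqrt_pos.
      apply Rle_trans with (2 := Rle_abs _). nra.
    - intros t. rewrite <- Rmult_assoc, Rabs_mult, (Rabs_pos_eq (r ^ i * r ^ j)); lra. }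
  split; [exact D1|]. split; [exact D2|].
  intros a b Hab Hax Hby.
  assert (Hh : Rabs (a - x) <= r) by lra. assert (Hh' : Rabs (b - y) <= r) by lra.
  set (h := a - x) in *. set (h' := b - y) in *.
  set (Z := fun u : T * (nat * nat) => Y u * (h ^ fst (snd u) * h' ^ snd (snd u))).
  assert (SZ : summable (fun u => Wt (kk (fst u)) * Z u)) by (apply Hs; easy).
  set (E := fun (n : nat) (u : T * (nat * nat)) => (fst (snd u) <= n /\ snd (snd u) <= n)%nat).
  assert (SZk : forall k, summable (fun u => iv (kk (fst u) = k) * Z u)).
  { intros k. apply summable_ext with (fun u => (/ Wt k * iv (kk (fst u) = k)) * (Wt (kk (fst u)) * Z u)).
    - intros u. unfold iv. assert (Wt k <> 0) by (apply Rgt_not_eq, Wt_pos).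
      destruct pdec as [<-|]; field; easy.
    - apply summable_mul with (Rabs (/ Wt k)); [|exact SZ]. intros u. rewrite Rabs_mult.
      pose proof (iv_abs (kk (fst u) = k)). pose proof (Rabs_pos (/ Wt k)).
      pose proof (Rabs_pos (iv (kk (fst u) = k))). nra. }
  assert (Tail := tsum_tail _ E SZ).
  set (tau := fun n => tsum (fun u => iv (~ E n u) * Rabs (Wt (kk (fst u)) * Z u))) in Tail.
  assert (Tl : is_lim_seq tau 0).
  { apply Tail; unfold E; [intros; lia|]. intros u. exists (fst (snd u) + snd (snd u))%nat. lia. }
  (* Frequency by frequency, the error is the sum over the Taylor indices outside the n-th
     square. *)
  assert (ED : forall n k, Cminus (F a b k) (sum_n (fun i => sum_n (fun j =>
       Cmult (RtoC (cR i j k)) (RtoC (h ^ i * h' ^ j))) n) n)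
     = RtoC (tsum (fun u => iv (kk (fst u) = k) * (iv (~ E n u) * Z u)))).
  { intros n k. rewrite HF by easy.
    assert (E1 : tsum (fun t => iv (kk t = k) * (X t * (a ^ N t * b ^ L t))) =
       tsum (fun u => iv (kk (fst u) = k) * Z u)).
    { rewrite <- fubini by apply SZk. simpl. apply tsum_ext; intros t.
      assert (Hin : summable (fun v => Yt X N L x y (t, v) * (h ^ fst v * h' ^ snd v))).
      { destruct (Hs h h' Hh Hh') as [K' HK']. assert (Q := nle_slice _ K' t HK'). simpl in Q.
        apply summable_ext with (fun v => / Wt (kk t) * (Wt (kk t) * (Y (t, v) * (h ^ fst v * h' ^ snd v)))).
        - intros v. unfold Y. field. apply Rgt_not_eq, Wt_pos.
        - apply summable_scal. now exists K'. }
      unfold Z, Y. simpl. rewrite tsum_scal by exact Hin.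
      rewrite (tsum_Yh X N L x y r Hr h h' Hh Hh'). unfold h, h'.
      f_equal. f_equal. f_equal; f_equal; ring. }
    assert (E2 : sum_n (fun i => sum_n (fun j => cR i j k * (h ^ i * h' ^ j)) n) n =
       tsum (fun u => iv (kk (fst u) = k) * (iv (E n u) * Z u))).
    { refine (eq_trans (square_tsum (fun v => cR (fst v) (snd v) k * (h ^ fst v * h' ^ snd v)) n) _).
      assert (S2 : summable (fun u => iv (kk (fst u) = k) * (iv (E n u) * Z u))).
      { apply summable_ext with (fun u => iv (E n u) * (iv (kk (fst u) = k) * Z u)); [intros; ring|].
        apply summable_mul1; [intros; apply iv_abs|apply SZk]. }
      rewrite <- (tsum_swap _ S2). apply tsum_ext. intros [i j]. unfold cR.
      rewrite <- Rmult_assoc, (Rmult_comm _ (tsum _)), Rmult_assoc, Rmult_comm, <- tsum_scal by apply HsY.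
      apply tsum_ext; intros t. unfold E, Z. simpl. ring. }
    assert (E3 : sum_n (fun i => sum_n (fun j => Cmult (RtoC (cR i j k)) (RtoC (h ^ i * h' ^ j))) n) n
       = RtoC (sum_n (fun i => sum_n (fun j => cR i j k * (h ^ i * h' ^ j)) n) n)).
    { apply injective_projections.
      - rewrite C_sum_fst. apply sum_n_ext; intros i. rewrite C_sum_fst. apply sum_n_ext; intros j. simpl. ring.
      - rewrite C_sum_snd. transitivity (sum_n (fun _ : nat => 0) n).
        + apply sum_n_ext; intros i. rewrite C_sum_snd. transitivity (sum_n (fun _ : nat => 0) n).
          * apply sum_n_ext; intros j. simpl. ring.
          * rewrite sum_n_const. apply Rmult_0_r.
        + rewrite sum_n_const. apply Rmult_0_r. }
    rewrite E3, E1, E2.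
    apply injective_projections; simpl; [|ring].
    rewrite (tsum_ext (fun u => iv (kk (fst u) = k) * (iv (~ E n u) * Z u))
      (fun u => iv (kk (fst u) = k) * Z u - iv (kk (fst u) = k) * (iv (E n u) * Z u))).
    - rewrite tsum_minus; [ring|apply SZk|].
      apply summable_ext with (fun u => iv (E n u) * (iv (kk (fst u) = k) * Z u)); [intros; ring|].
      apply summable_mul1; [intros; apply iv_abs|apply SZk].
    - intros u. unfold iv at 2 5. destruct (pdec (~ E n u)), (pdec (E n u)); try tauto; ring. }
  apply is_lim_seq_le_le with (fun _ => 0) (fun n => 3 * tau n).
  - intros n. split; [apply sqrt_pos|].
    rewrite (functional_extensionality _ _ (ED n)). apply H_l1.
    apply (nle_Wt_fibre (fun u : T * (nat * nat) => kk (fst u)) (fun u => iv (~ E n u) * Z u)).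
    assert (Q : summable (fun u => iv (~ E n u) * (Wt (kk (fst u)) * Z u))).
    { apply summable_mul1; [intros; apply iv_abs|exact SZ]. }
    apply nle_weak with (tsum (fun u => Rabs (iv (~ E n u) * (Wt (kk (fst u)) * Z u)))).
    + apply nle_ext with (2 := nle_tsum _ Q). intros; ring.
    + right. apply tsum_ext. intros u. rewrite Rabs_mult. f_equal. apply Rabs_pos_eq, iv_01.
  - apply is_lim_seq_const.
  - replace (Finite 0) with (Rbar_mult 3 0) by (simpl; f_equal; ring).
    now apply is_lim_seq_scal_l.
Qed.
End Sobolev.

(** * The solution *)

Section Solution.
Variables alpha p : R.
Hypothesis (Ha : 0 < alpha) (Hp : 1 <= p).
Variable eps : R.
Hypothesis (He : 0 < eps) (He16 : eps * (16 * qcst p) <= 1)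
  (HeK : eps * (12 * (Kcst alpha * Lcst p)) <= 1) (Hek : eps * (2 * (Lcst p * (1 + / alpha))) <= 1).
Notation w := (wsol alpha p eps).
Notation gw := (gsol alpha p eps).
Notation lam := (lam alpha).
Notation Lq := (Lcst p).
Notation kap := (kappa alpha p eps).

(* Coefficients of the whole solution 1 + eps w; here a = 2 eps A and b = eps B. *)
Definition wfull (m : M) : R := iv (m0 = m) * 1 + eps * w m.
Definition Ascl (a : R) : R := a / (2 * eps).
Definition Bscl (b : R) : R := b / eps.

Lemma nle_wf : nle wfull (1 + 4 * eps).
Proof.
  apply nle_weak with (Rabs 1 + Rabs eps * 4).
  - apply nle_plus; [apply (nle_single m0 (fun _ => 1))|]. now apply nle_scal, nle_w.
  - rewrite Rabs_R1, Rabs_pos_eq; lra.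
Qed.
Lemma summable_wf : summable wfull.
Proof. eexists; apply nle_wf. Qed.
Lemma wf_sw m : wfull (sw m) = wfull m.
Proof.
  unfold wfull. rewrite w_sw by easy. f_equal. f_equal. apply iv_iff. split; intros E.
  - now rewrite <- (sw_sw m), <- E.
  - now rewrite <- E.
Qed.
Lemma eps_small : eps <= / 48.
Proof. pose proof (qp_ge p Hp). apply Rmult_le_reg_r with 48; [lra|]. nra. Qed.

Lemma box_A a b : box eps (eps / 2) a b -> Rabs (Ascl a) < / 2.
Proof.
  intros [H _]. unfold Ascl. rewrite Rabs_div, (Rabs_pos_eq (2 * eps)) by lra.
  apply Rlt_div_l; [lra|]. apply Rabs_def1; lra.
Qed.
Lemma Bs_small b : - (eps / 2) < b < eps / 2 -> Rabs (Bscl b) < / 2.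
Proof.
  intros H. unfold Bscl. rewrite Rabs_div, (Rabs_pos_eq eps) by lra.
  apply Rlt_div_l; [lra|]. apply Rabs_def1; lra.
Qed.
Lemma box_B a b : box eps (eps / 2) a b -> Rabs (Bscl b) < / 2.
Proof. intros [_ H]; now apply Bs_small. Qed.

Lemma chr_scale a b m : chr (Ascl a) (Bscl b) m = a ^ (n1 m + n2 m) * b ^ n3 m / ((2 * eps) ^ (n1 m + n2 m) * eps ^ n3 m).
Proof.
  unfold chr, Ascl, Bscl, Rdiv. rewrite !Rpow_mult_distr, !pow_inv, ?Rpow_mult_distr. field.
  repeat split; try apply pow_nonzero; lra.
Qed.

Definition Psol (a b z : R) : R := 1 + eps * sval alpha p eps (Ascl a) (Bscl b) z.
(** At a = 0 every monomial that depends on z vanishes, so the solution is the constant Q_b and any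
    z may be used. *)
Definition Qsol (b : R) : R := Psol 0 b 0.
Definition ksol (a b : R) : R := Rpower (kap (Ascl a) (Bscl b)) (/ alpha).
Definition cosc (a b : R) (n : nat) : R := tsum (fun m => iv (dd m = n) * (chr (Ascl a) (Bscl b) m * wfull m)).

Section Box.
Variables a b : R.
Hypothesis Hab : box eps (eps / 2) a b.
Let HA : Rabs (Ascl a) < / 2 := box_A a b Hab.
Let HB : Rabs (Bscl b) < / 2 := box_B a b Hab.
Let HA1 : Rabs (Ascl a) <= 1. Proof. lra. Qed.
Let HA2 : Rabs (Ascl a) < 1. Proof. lra. Qed.
Let HB1 : Rabs (Bscl b) <= 1. Proof. lra. Qed.

Lemma summable_psi_wf z : summable (fun m => psi (Ascl a) (Bscl b) z m * wfull m).
Proof. apply summable_mul1; [intros; now apply psi_1|apply summable_wf]. Qed.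
Lemma summable_chr_wf : summable (fun m => chr (Ascl a) (Bscl b) m * wfull m).
Proof. apply summable_mul1; [intros; now apply chr_1|apply summable_wf]. Qed.

Lemma Pf_tsum z : Psol a b z = tsum (fun m => phi (Ascl a) (Bscl b) z m * wfull m).
Proof.
  rewrite (tsum_ext _ (fun m => iv (m0 = m) * phi (Ascl a) (Bscl b) z m
    + eps * (phi (Ascl a) (Bscl b) z m * w m))) by (intros; unfold wfull; ring).
  assert (S : summable (fun m => phi (Ascl a) (Bscl b) z m * w m)).
  { apply summable_mul1; [intros; now apply phi_1|now apply summable_w]. }
  rewrite tsum_plus, tsum_scal, tsum_single; auto using summable_scal.
  - unfold Psol, sval, phi at 2, chr, frq, m0, n1, n2, n3; simpl.
    rewrite Rminus_0_r, Rmult_0_l, cos_0. ring.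
  - eexists; apply nle_single.
Qed.

(** |eps * [sval]| is at most 4/48. Positivity is what makes [Rpower] the genuine power, equal to
    [powq]. *)
Lemma Pf_pos z : / 2 < Psol a b z.
Proof.
  assert (H := sval_small alpha p Ha Hp eps He He16 HeK (Ascl a) (Bscl b) z HA2 HB1).
  pose proof eps_small. apply Rabs_le_between in H. unfold Psol. nra.
Qed.

Lemma weight_sum (W : nat -> R) J K0 : (forall d, 0 <= W d <= K0 * (1 + INR d ^ J)) ->
  summable (fun m => W (dd m) * (chr (Ascl a) (Bscl b) m * wfull m)).
Proof.
  intros HW. destruct (chr_weight (Ascl a) (Bscl b) W J K0 HA2 HB1 HW) as [K HK].
  apply summable_ext with (fun m => (W (dd m) * chr (Ascl a) (Bscl b) m) * wfull m); [intros; ring|].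
  apply summable_mul with K; [easy|apply summable_wf].
Qed.

(** A weight that depends only on the frequency can be moved between the sum over monomials and the
    cosine series. With different [g] this gives the decay, the value, and Lambda^alpha of the
    series. *)
Lemma fibre_weight (g : nat -> R) : summable (fun m => g (dd m) * (chr (Ascl a) (Bscl b) m * wfull m)) ->
  summable (fun n => g n * cosc a b n) /\
  tsum (fun n => g n * cosc a b n) = tsum (fun m => g (dd m) * (chr (Ascl a) (Bscl b) m * wfull m)).
Proof.
  intros S.
  assert (E : forall n, g n * cosc a b n =
     tsum (fun m => iv (dd m = n) * (g (dd m) * (chr (Ascl a) (Bscl b) m * wfull m)))).
  { intros n. unfold cosc. rewrite <- tsum_scal.
    - apply tsum_ext; intros m. unfold iv. destruct pdec as [<-|]; ring.
    - apply summable_mul1; [intros; apply iv_abs|apply summable_chr_wf]. }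
  split.
  - destruct S as [K HK]. exists K. apply nle_ext with (2 := nle_fibre dd _ K HK).
    intros; now rewrite E.
  - rewrite (tsum_ext _ _ E). now apply tsum_fibre.
Qed.

Lemma rapid_cf : rapid (cosc a b).
Proof.
  intros J. apply (fibre_weight (fun n => INR n ^ J)).
  apply (weight_sum (fun n => INR n ^ J) J 1). intros d.
  assert (0 <= INR d ^ J) by apply pow_le, pos_INR. lra.
Qed.

Lemma Pf_cos z : Psol a b z = tsum (fun n => cosc a b n * cos (INR n * z)).
Proof.
  rewrite (tsum_ext _ (fun n => cos (INR n * z) * cosc a b n)) by (intros; ring).
  assert (S : summable (fun m => cos (INR (dd m) * z) * (chr (Ascl a) (Bscl b) m * wfull m))).
  { apply summable_mul1; [intros; apply Rabs_cos_le1|apply summable_chr_wf]. }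
  rewrite (proj2 (fibre_weight (fun n => cos (INR n * z)) S)), Pf_tsum.
  apply tsum_ext. intros m. unfold phi. rewrite cos_frq. ring.
Qed.

Lemma lam_cos z : tsum (fun n => lam n * cosc a b n * cos (INR n * z))
  = eps * Vval alpha p eps (Ascl a) (Bscl b) z.
Proof.
  destruct (lam_le_pow alpha) as [J HJ].
  rewrite (tsum_ext _ (fun n => (lam n * cos (INR n * z)) * cosc a b n)) by (intros; ring).
  assert (S : summable (fun m => (lam (dd m) * cos (INR (dd m) * z)) * (chr (Ascl a) (Bscl b) m * wfull m))).
  { apply summable_ext with (fun m => cos (INR (dd m) * z) * (lam (dd m) * (chr (Ascl a) (Bscl b) m * wfull m)));
      [intros; ring|].
    apply summable_mul1; [intros; apply Rabs_cos_le1|].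
    apply (weight_sum lam J 1). intros d; split; [apply lam_nonneg|]. specialize (HJ d); lra. }
  rewrite (proj2 (fibre_weight (fun n => lam n * cos (INR n * z)) S)).
  unfold Vval. rewrite <- tsum_scal.
  - apply tsum_ext. intros m. unfold phi. rewrite cos_frq. unfold wfull.
    (* The constant 1 in [wfull] has frequency zero and is annihilated by [lam]. *)
    destruct (pdec (m0 = m)) as [<-|N].
    + simpl. ring.
    + rewrite iv_false by easy. ring.
  - now apply summable_V.
Qed.

Lemma kap_small : Rabs (eps * tsum (fun m => chr (Ascl a) (Bscl b) m * DD gw m)) <= eps * Lq.
Proof.
  rewrite Rabs_mult, (Rabs_pos_eq eps) by lra. apply Rmult_le_compat_l; [lra|].
  apply tsum_Rabs, nle_mul1; [intros; now apply chr_1|]. now apply nle_DD, nle_gw.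
Qed.
Lemma epsL : eps * Lq * (1 + / alpha) <= / 2.
Proof. lra. Qed.
Lemma epsL2 : eps * Lq <= / 2.
Proof.
  pose proof epsL. assert (0 < / alpha) by now apply Rinv_0_lt_compat.
  pose proof (Lq_pos p Hp). nra.
Qed.
Lemma kap_pos : 0 < kap (Ascl a) (Bscl b).
Proof.
  assert (H := kap_small). pose proof epsL2. apply Rabs_le_between in H. unfold kappa. lra.
Qed.
Lemma kf_pow : Rpower (ksol a b) alpha = kap (Ascl a) (Bscl b).
Proof.
  unfold ksol. rewrite Rpower_mult, Rinv_l, Rpower_1; [easy|apply kap_pos|lra].
Qed.

Lemma Pf_equation z : - kap (Ascl a) (Bscl b) * (eps * Vval alpha p eps (Ascl a) (Bscl b) z) - Psol a b z
  + Rpower (Psol a b z) (p + 1) = b.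
Proof.
  unfold Psol. rewrite (solution_eq alpha p Ha Hp eps He He16 HeK) by (lra || easy).
  unfold Bscl. field. lra.
Qed.

Definition fourc (k : Z) : R := fcoef (cosc a b) k.
Lemma four_Pf k : four_coef (Psol a b) k = RtoC (fourc k).
Proof. apply four_coef_cos; [apply rapid_cf|apply Pf_cos]. Qed.

Definition kk (m : M) : Z := (Z.of_nat (n1 m) - Z.of_nat (n2 m))%Z.
(** For k <> 0 the cosine coefficient collects the monomials of frequency k and -k. [sw] exchanges
    the two groups, so each is one half, as in [fcoef]. *)
Lemma cz_tsum k : fourc k = tsum (fun m => iv (kk m = k) * (chr (Ascl a) (Bscl b) m * wfull m)).
Proof.
  assert (S : forall g, summable (fun m => iv (g m) * (chr (Ascl a) (Bscl b) m * wfull m))).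
  { intros g. apply summable_mul1; [intros; apply iv_abs|apply summable_chr_wf]. }
  unfold fourc, fcoef. destruct (Z.eqb_spec k 0) as [->|N].
  - unfold cosc. apply tsum_ext. intros m. f_equal. apply iv_iff. unfold dd, kk. lia.
  - assert (E : tsum (fun m => iv (kk m = - k)%Z * (chr (Ascl a) (Bscl b) m * wfull m)) =
      tsum (fun m => iv (kk m = k) * (chr (Ascl a) (Bscl b) m * wfull m))).
    { rewrite <- (tsum_bij sw sw) by auto using sw_sw.
      apply tsum_ext. intros m. rewrite chr_sw, wf_sw. f_equal. apply iv_iff.
      unfold kk, sw, n1, n2; simpl. lia. }
    assert (E2 : cosc a b (Z.abs_nat k) = tsum (fun m => iv (kk m = k) * (chr (Ascl a) (Bscl b) m * wfull m))
       + tsum (fun m => iv (kk m = - k)%Z * (chr (Ascl a) (Bscl b) m * wfull m))).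
    { rewrite <- tsum_plus by auto. apply tsum_ext; intros m.
      rewrite <- Rmult_plus_distr_r. f_equal.
      destruct (Z.eq_dec (kk m) k) as [E1|N1].
      - rewrite (iv_true (kk m = k)), (iv_false (kk m = - k)%Z), iv_true; [ring| |lia|easy].
        unfold dd, kk in *. lia.
      - rewrite (iv_false (kk m = k)) by easy. rewrite Rplus_0_l. apply iv_iff.
        unfold dd, kk in *. lia. }
    rewrite E2, E. field.
Qed.
End Box.

Lemma box0 b : - (eps / 2) < b < eps / 2 -> box eps (eps / 2) 0 b.
Proof. intros; split; lra. Qed.
Lemma box_opp a b : box eps (eps / 2) a b -> box eps (eps / 2) (- a) b.
Proof. intros [H1 H2]; split; lra. Qed.
Lemma As_opp a : Ascl (- a) = - Ascl a.
Proof. unfold Ascl; field; lra. Qed.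
Lemma As_0 : Ascl 0 = 0.
Proof. unfold Ascl; field; lra. Qed.
Lemma Bs_0 : Bscl 0 = 0.
Proof. unfold Bscl; field; lra. Qed.

(** At A = 0 only monomials of frequency zero survive, so the term with Lambda^alpha drops out and
    the equation becomes algebraic; what remains is to check the branch. *)
Lemma Qf_spec b : - (eps / 2) < b < eps / 2 -> Qb_spec p b (Qsol b).
Proof.
  intros Hb. assert (B0 := box0 b Hb).
  assert (HQ := Pf_pos 0 b B0 0). fold (Qsol b) in HQ.
  assert (Eq := Pf_equation 0 b B0 0). fold (Qsol b) in Eq.
  assert (V : Vval alpha p eps (Ascl 0) (Bscl b) 0 = 0).
  { unfold Vval. transitivity (tsum (fun _ : M => 0)); [|apply tsum_zero]. apply tsum_ext. intros m.
    rewrite As_0. unfold phi, chr.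
    destruct (n1 m + n2 m)%nat as [|s] eqn:E.
    - pose proof (dd_le m). assert (dd m = 0%nat) by lia. rewrite H0. simpl. ring.
    - simpl. ring. }
  rewrite V in Eq.
  assert (E2 : - Qsol b + Rpower (Qsol b) (p + 1) = b) by lra.
  split; [lra|]. split; [|exact E2].
  rewrite Rpower_plus, Rpower_1 in E2 by lra.
  pose proof eps_small.
  (* If Q^p <= 1/2 then Q^(p+1) - Q <= -Q/2 < -1/4, below every admissible b. Conversely Q^p > 1/2
     gives (p+1) Q^p > 1, because p >= 1. *)
  assert (/ 2 < Rpower (Qsol b) p); [|nra].
  apply Rnot_le_lt. intros N. assert (Rpower (Qsol b) p * Qsol b <= / 2 * Qsol b) by nra. lra.
Qed.

(** [DD] lives on i = j, so A enters k^alpha only through A^(2i). *)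
Lemma kf_even a b : ksol (- a) b = ksol a b.
Proof.
  unfold ksol, kappa. rewrite As_opp. do 3 f_equal. apply tsum_ext. intros m.
  unfold DD. destruct (pdec (n1 m = n2 m)) as [E|N].
  - unfold chr. rewrite E. replace (n2 m + n2 m)%nat with (2 * n2 m)%nat by lia.
    rewrite !(pow_mult _ 2). now replace ((- Ascl a) ^ 2) with (Ascl a ^ 2) by ring.
  - rewrite iv_false by easy. ring.
Qed.

(** In the box |A| and |B| are below 1/2. The radius eps / 4 enlarges these bounds to 5/8 and 3/4,
    still inside the unit polydisc where the l^1 bounds live. *)
Lemma chr_shift x y r m : 0 < r -> Rabs x < eps -> Rabs y < eps / 2 -> r = eps / 4 ->
  (Rabs x + r) ^ (n1 m + n2 m) * (Rabs y + r) ^ n3 m =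
  chr (Ascl (Rabs x + r)) (Bscl (Rabs y + r)) m * ((2 * eps) ^ (n1 m + n2 m) * eps ^ n3 m)
  /\ Rabs (Ascl (Rabs x + r)) < 1 /\ Rabs (Bscl (Rabs y + r)) <= 1.
Proof.
  intros Hr Hx Hy E. pose proof (Rabs_pos x); pose proof (Rabs_pos y). split; [|split].
  - rewrite chr_scale. field. split; apply pow_nonzero; lra.
  - unfold Ascl. rewrite Rabs_pos_eq.
    + apply Rlt_div_l; lra.
    + apply Rdiv_le_0_compat; lra.
  - unfold Bscl. rewrite Rabs_pos_eq.
    + apply Rle_div_l; lra.
    + apply Rdiv_le_0_compat; lra.
Qed.

(** k^alpha = p (1 + t) with t the value of [xk]. Hence k is p^(1/alpha) times a binomial series of
    exponent 1/alpha taken inside the algebra, which displays it as an absolutely convergent sum of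
    monomials. *)
Definition xk (m : M) : R := eps / p * DD gw m.
Lemma nle_xk : nle xk (eps * Lq).
Proof.
  apply nle_weak with (Rabs (eps / p) * Lq).
  - now apply nle_scal, nle_DD, nle_gw.
  - assert (0 < / p) by (apply Rinv_0_lt_compat; lra).
    assert (/ p <= 1) by (rewrite <- Rinv_1; apply Rinv_le_contravar; lra).
    pose proof (Lq_pos p Hp). unfold Rdiv. rewrite Rabs_pos_eq by nra.
    apply Rmult_le_compat_r; [lra|]. nra.
Qed.
(** This is the purpose of [Hek]: the argument of the series for (1 + t)^(1/alpha) stays within half
    of the radius 1 / (1 + 1/alpha). *)
Lemma bn_small t : Rabs t <= eps * Lq -> Rabs t * (1 + Rabs (/ alpha)) <= / 2.
Proof.
  intros H. assert (0 < / alpha) by now apply Rinv_0_lt_compat.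
  rewrite (Rabs_pos_eq (/ alpha)) by lra. pose proof epsL.
  apply Rle_trans with (2 := H1). apply Rmult_le_compat_r; lra.
Qed.
Lemma nle_bnk : nle (fun k => bn (/ alpha) k * (eps * Lq) ^ k) 2.
Proof.
  apply nle_bn, bn_small. pose proof (Lq_pos p Hp). rewrite Rabs_pos_eq; nra.
Qed.

Lemma kf_tsum a b : box eps (eps / 2) a b ->
  ksol a b = tsum (fun m => chr (Ascl a) (Bscl b) m * (Rpower p (/ alpha) * psub (bn (/ alpha)) xk m)).
Proof.
  intros Hab. assert (HA := box_A a b Hab). assert (HB := box_B a b Hab).
  assert (H1 : forall m, Rabs (chr (Ascl a) (Bscl b) m) <= 1) by (intros; apply chr_1; lra).
  set (t := tsum (fun m => chr (Ascl a) (Bscl b) m * xk m)).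
  assert (Sx : summable xk) by (eexists; apply nle_xk).
  assert (Ht : Rabs t <= eps * Lq) by (apply tsum_Rabs, nle_mul1; [easy|apply nle_xk]).
  assert (Et : kap (Ascl a) (Bscl b) = p * (1 + t)).
  { unfold kappa, t, xk.
    rewrite (tsum_ext (fun m => chr (Ascl a) (Bscl b) m * (eps / p * DD gw m))
      (fun m => eps / p * (chr (Ascl a) (Bscl b) m * DD gw m))) by (intros; ring).
    rewrite tsum_scal; [field; lra|]. apply summable_mul1; [easy|]. now apply summable_DDgw. }
  assert (0 < 1 + t).
  { pose proof epsL2. apply Rabs_le_between in Ht. lra. }
  unfold ksol. rewrite Et, <- Rpower_mult_distr by lra.
  rewrite <- (bn_tsum (/ alpha) t) by now apply bn_small.
  rewrite (tsum_ext (fun m => chr (Ascl a) (Bscl b) m * (Rpower p (/ alpha) * psub (bn (/ alpha)) xk m))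
    (fun m => Rpower p (/ alpha) *
     (chr (Ascl a) (Bscl b) m * psub (bn (/ alpha)) xk m))) by (intros; ring).
  rewrite tsum_scal.
  - f_equal. rewrite (psub_eval _ _ _ nle_bnk _ _ H1 nle_xk). apply tsum_ext. intros k. f_equal.
    symmetry.
    (* [chr] is multiplicative by itself, so the second component can be taken to be 0. *)
    refine (proj1 (ev_pw (chr (Ascl a) (Bscl b)) (fun _ => 0) 0 H1 _ _ eq_refl _ _ xk k Sx _)).
    + intros; rewrite Rabs_R0; lra.
    + unfold chr, m0, n1, n2, n3; simpl; ring.
    + intros; rewrite chr_add; ring.
    + intros; ring.
    + ring.
  - apply summable_mul1; [easy|]. exists 2. apply (nle_psub _ _ _ nle_bnk), nle_xk.
Qed.

Lemma kf_analytic : analytic2 (box eps (eps / 2)) ksol.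
Proof.
  apply (analytic2_family (fun m => Rpower p (/ alpha) * psub (bn (/ alpha)) xk m
     / ((2 * eps) ^ (n1 m + n2 m) * eps ^ n3 m)) (fun m => n1 m + n2 m)%nat n3).
  - intros x y [Hx Hy]. exists (eps / 4). split; [lra|].
    assert (Hx' : Rabs x < eps) by (apply Rabs_def1; lra).
    assert (Hy' : Rabs y < eps / 2) by (apply Rabs_def1; lra).
    assert (HH := fun m => chr_shift x y (eps / 4) m ltac:(lra) Hx' Hy' eq_refl).
    destruct (HH m0) as (_ & HA & HB).
    apply summable_ext with (fun m => chr (Ascl (Rabs x + eps / 4)) (Bscl (Rabs y + eps / 4)) m *
       (Rpower p (/ alpha) * psub (bn (/ alpha)) xk m)).
    + intros m. rewrite (proj1 (HH m)). field. split; apply pow_nonzero; lra.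
    + apply summable_mul1; [intros; apply chr_1; lra|]. apply summable_scal.
      exists 2. apply (nle_psub _ _ _ nle_bnk), nle_xk.
  - intros a b Hab. rewrite kf_tsum by easy. apply tsum_ext; intros m. rewrite chr_scale.
    field. split; apply pow_nonzero; lra.
Qed.

Lemma Wt_bound : exists J K0, forall d, 0 <= Wt alpha (Z.of_nat d) <= K0 * (1 + INR d ^ J).
Proof.
  destruct (INR_unbounded (alpha / 2)) as [J HJ]. exists (2 * J)%nat, (2 ^ J). intros d.
  split; [left; apply Wt_pos|]. unfold Wt. rewrite <- INR_IZR_INZ.
  assert (Q : 0 <= INR d ^ 2) by apply pow2_ge_0.
  apply Rle_trans with ((1 + INR d ^ 2) ^ J).
  - rewrite <- (Rpower_pow J) by lra. apply Rle_Rpower; lra.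
  - assert (0 < 2 ^ J) by (apply pow_lt; lra).
    destruct d as [|d].
    + simpl INR. replace (1 + 0 ^ 2) with 1 by ring. rewrite pow1.
      assert (1 <= 2 ^ J) by (apply pow_R1_Rle; lra).
      assert (0 <= 0 ^ (2 * J)) by (apply pow_le; lra). nra.
    + assert (1 <= INR (S d)) by (rewrite S_INR; pose proof (pos_INR d); lra).
      apply Rle_trans with ((2 * INR (S d) ^ 2) ^ J).
      * apply pow_incr. split; [lra|]. nra.
      * rewrite Rpow_mult_distr, <- pow_mult. nra.
Qed.
Lemma Wt_kk m : Wt alpha (kk m) = Wt alpha (Z.of_nat (dd m)).
Proof.
  unfold kk, dd. destruct (Nat.le_ge_cases (n1 m) (n2 m)).
  - rewrite <- Wt_opp. f_equal. lia.
  - f_equal. lia.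
Qed.

Lemma Pf_analytic : analytic2_H alpha (box eps (eps / 2)) (fun a b => four_coef (Psol a b)).
Proof.
  apply (analytic2_H_family alpha (fun m => wfull m / ((2 * eps) ^ (n1 m + n2 m) * eps ^ n3 m))
    (fun m => n1 m + n2 m)%nat n3 kk).
  - intros x y [Hx Hy]. exists (eps / 4). split; [lra|].
    assert (Hx' : Rabs x < eps) by (apply Rabs_def1; lra).
    assert (Hy' : Rabs y < eps / 2) by (apply Rabs_def1; lra).
    assert (HH := fun m => chr_shift x y (eps / 4) m ltac:(lra) Hx' Hy' eq_refl).
    destruct (HH m0) as (_ & HA & HB).
    destruct Wt_bound as (J & K0 & HW).
    destruct (chr_weight _ _ _ J K0 HA HB HW) as [K HK].
    apply summable_ext with (fun m => (Wt alpha (Z.of_nat (dd m)) *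
      chr (Ascl (Rabs x + eps / 4)) (Bscl (Rabs y + eps / 4)) m) * wfull m).
    + intros m. rewrite (proj1 (HH m)), Wt_kk. field. split; apply pow_nonzero; lra.
    + apply summable_mul with K; [easy|apply summable_wf].
  - intros a b k Hab. rewrite four_Pf, cz_tsum by easy. f_equal. apply tsum_ext; intros m.
    rewrite chr_scale. field. split; apply pow_nonzero; lra.
Qed.
End Solution.

(** * Expansions in powers of a and behaviour of the Fourier coefficients *)

Section Expansions.
Variables alpha p : R.
Hypothesis (Ha : 0 < alpha) (Hp : 1 <= p).
Variable eps : R.
Hypothesis (He : 0 < eps) (He16 : eps * (16 * qcst p) <= 1)
  (HeK : eps * (12 * (Kcst alpha * Lcst p)) <= 1) (Hek : eps * (2 * (Lcst p * (1 + / alpha))) <= 1).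
Notation w := (wsol alpha p eps).
Notation gw := (gsol alpha p eps).
Notation Lq := (Lcst p).
Notation kap := (kappa alpha p eps).
Notation wf := (wfull alpha p eps).
Notation As := (Ascl eps).
Notation Bs := (Bscl eps).
Notation Pf := (Psol alpha p eps).
Notation Qf := (Qsol alpha p eps).
Notation cz := (fourc alpha p eps).
Notation cf := (cosc alpha p eps).
Notation Box := (box eps (eps / 2)).

(** On i = j the power of A is 2j, and (2 eps)^(2j) converts it to a power of a. The index j = 0 is
    included; it carries the difference of k^* and p. *)
Definition ktil (j : nat) (b : R) : R :=
  eps * tsum (fun m => iv (n1 m = j) * (Bs b ^ n3 m * DD gw m)) / (2 * eps) ^ (2 * j).

Lemma Bpow_1 b l : - (eps / 2) < b < eps / 2 -> Rabs (Bs b ^ l) <= 1.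
Proof. intros H. apply pow_abs_le1. assert (Q := Bs_small eps He b H). lra. Qed.

Lemma ktil_bound j b : - (eps / 2) < b < eps / 2 -> Rabs (ktil j b) <= eps * Lq / (2 * eps) ^ (2 * j).
Proof.
  intros Hb. assert (P : 0 < (2 * eps) ^ (2 * j)) by (apply pow_lt; lra).
  unfold ktil. rewrite Rabs_div, (Rabs_pos_eq (_ ^ _)) by lra.
  apply Rmult_le_compat_r; [left; now apply Rinv_0_lt_compat|].
  rewrite Rabs_mult, (Rabs_pos_eq eps) by lra. apply Rmult_le_compat_l; [lra|].
  apply tsum_Rabs, nle_mul1; [intros; apply iv_abs|].
  apply nle_mul1; [intros; now apply Bpow_1|]. now apply nle_DD, nle_gw.
Qed.

Lemma ktil_sum a b : Box a b ->
  summable (fun j => ktil j b * a ^ (2 * j)) /\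
  tsum (fun j => ktil j b * a ^ (2 * j)) = kap (As a) (Bs b) - p.
Proof.
  intros Hab. assert (HA := box_A eps He a b Hab). assert (HB := box_B eps He a b Hab).
  assert (S0 : summable (fun m => chr (As a) (Bs b) m * DD gw m)).
  { apply summable_mul1; [intros; apply chr_1; lra|]. now apply summable_DDgw. }
  assert (E : forall j, ktil j b * a ^ (2 * j)
     = tsum (fun m => iv (n1 m = j) * (eps * (chr (As a) (Bs b) m * DD gw m)))).
  { intros j. transitivity (As a ^ (2 * j) * eps * tsum (fun m => iv (n1 m = j) * (Bs b ^ n3 m * DD gw m))).
    - unfold ktil, Ascl, Rdiv. rewrite (Rpow_mult_distr a), pow_inv. field. apply pow_nonzero; lra.
    - rewrite <- tsum_scal.
      + apply tsum_ext; intros m. destruct (pdec (n1 m = j)) as [E1|N].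
        * rewrite iv_true by easy. unfold DD. destruct (pdec (n1 m = n2 m)) as [E2|N2].
          -- unfold chr. rewrite <- E2, E1. replace (j + j)%nat with (2 * j)%nat by lia. ring.
          -- rewrite (iv_false (n1 m = n2 m)) by easy. ring.
        * rewrite iv_false by easy. ring.
      + apply summable_mul1; [intros; apply iv_abs|].
        apply summable_mul1; [intros; apply Bpow_1, Hab|]. now apply summable_DDgw. }
  assert (S1 := summable_scal eps _ S0).
  split.
  - apply summable_ext with (1 := fun j => eq_sym (E j)).
    destruct S1 as [K HK]. exists K. exact (nle_fibre n1 _ K HK).
  - rewrite (tsum_ext _ _ E), (tsum_fibre n1 _ S1), tsum_scal by easy. unfold kappa. ring.
Qed.

(** At a = 0 only the j = 0 term survives, and [kap_at_0] gives the value. This identifies the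
    constant term of k^alpha with k^*. *)
Lemma ktil_0 b : - (eps / 2) < b < eps / 2 -> p + ktil 0 b = (p + 1) * Rpower (Qf b) p - 1.
Proof.
  intros Hb. assert (B0 := box0 eps He b Hb). assert (HB := Bs_small eps He b Hb).
  assert (Q := kap_at_0 alpha p Ha Hp eps He He16 HeK (Bs b) ltac:(lra)).
  unfold Qsol, Psol. rewrite (As_0 eps He). rewrite <- Q.
  destruct (ktil_sum 0 b B0) as [S E]. rewrite (As_0 eps He) in E.
  rewrite (tsum_S _ S) in E.
  rewrite (tsum_ext _ (fun _ => 0)), tsum_zero in E by (intros; simpl; ring).
  simpl pow in E. lra.
Qed.

Lemma ktil_series a b : Box a b ->
  is_series (fun j => ktil (S j) b * a ^ (2 * S j))
    (Rpower (ksol alpha p eps a b) alpha - ((p + 1) * Rpower (Qf b) p - 1)).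
Proof.
  intros Hab. rewrite (kf_pow alpha p Ha Hp eps He He16 HeK Hek a b Hab).
  rewrite <- ktil_0 by apply Hab.
  destruct (ktil_sum a b Hab) as [S E]. rewrite (tsum_S _ S) in E. simpl pow in E at 1.
  evar_last.
  - apply tsum_is_series. destruct S as [K HK]. exists K.
    apply (nle_inj Datatypes.S (fun j => ktil j b * a ^ (2 * j))); [congruence|easy].
  - lra.
Qed.

Definition pairs (m : M) : nat * nat := (n1 m, n2 m).
(** Sums out the powers of B and rescales A to a; the result is the coefficient of e^(i(i-j)z)
    a^(i+j). *)
Definition ptil (i j : nat) (b : R) : R :=
  tsum (fun m => iv (pairs m = (i, j)) * (Bs b ^ n3 m * wf m)) / (2 * eps) ^ (i + j).

Lemma summable_Bwf b : - (eps / 2) < b < eps / 2 -> summable (fun m => Bs b ^ n3 m * wf m).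
Proof. intros Hb. apply summable_mul1; [intros; now apply Bpow_1|now apply summable_wf]. Qed.

Lemma ptil_bound i j b : - (eps / 2) < b < eps / 2 ->
  Rabs (ptil i j b) <= (1 + 4 * eps) / (2 * eps) ^ (i + j).
Proof.
  intros Hb. assert (P : 0 < (2 * eps) ^ (i + j)) by (apply pow_lt; lra).
  unfold ptil. rewrite Rabs_div, (Rabs_pos_eq (_ ^ _)) by lra.
  apply Rmult_le_compat_r; [left; now apply Rinv_0_lt_compat|].
  apply tsum_Rabs, nle_mul1; [intros; apply iv_abs|].
  apply nle_mul1; [intros; now apply Bpow_1|]. now apply nle_wf.
Qed.
Lemma ptil_sym i j b : - (eps / 2) < b < eps / 2 -> ptil i j b = ptil j i b.
Proof.
  intros Hb. unfold ptil. rewrite (Nat.add_comm j i). f_equal.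
  rewrite <- (tsum_bij sw sw).
  - apply tsum_ext; intros m. rewrite wf_sw by easy. f_equal. apply iv_iff.
    unfold pairs, sw, n1, n2; simpl. split; congruence.
  - apply sw_sw.
  - apply sw_sw.
  - apply summable_mul1; [intros; apply iv_abs|]. now apply summable_Bwf.
Qed.

(** The coefficient eps at [e1], divided by 2 * eps; with its mirror image at [e2] it produces
    exactly a cos z. *)
Lemma ptil_10 b : ptil 1 0 b = / 2.
Proof.
  unfold ptil. rewrite (tsum_ext _ (fun m => iv (e1 = m) * (Bs b ^ n3 m * eps))).
  - rewrite (tsum_single e1 (fun m => Bs b ^ n3 m * eps)). simpl. field. lra.
  - intros [[i j] l]. unfold pairs, n1, n2, n3; simpl.
    destruct (pdec ((i, j) = (1%nat, 0%nat))) as [E|N].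
    + assert (i = 1%nat) by congruence. assert (j = 0%nat) by congruence. subst.
      rewrite iv_true by easy. unfold wfull. rewrite w_dd1 by easy.
      rewrite (iv_false (m0 = _)), (iv_false (e2 = _)) by (unfold m0, e2; congruence). ring.
    + rewrite iv_false by easy. rewrite iv_false; [ring|]. unfold e1; congruence.
Qed.
(** By the normalisation [w_dd1], frequency one contains nothing beyond [e1] and [e2]. This is why
    pairs with difference one can be left out of the expansion. *)
Lemma ptil_dd1 i j b : (i = S j \/ j = S i) -> (2 <= i + j)%nat -> ptil i j b = 0.
Proof.
  intros H1 H2. unfold ptil.
  rewrite (tsum_ext _ (fun _ => 0)), tsum_zero; [unfold Rdiv; ring|].
  intros [[i' j'] l]. unfold pairs, n1, n2, n3; simpl.
  destruct (pdec ((i', j') = (i, j))) as [E|N].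
  - assert (i' = i) by congruence. assert (j' = j) by congruence. subst i' j'.
    unfold wfull. rewrite w_dd1 by (easy || (unfold dd, n1, n2; cbn [fst snd]; lia)).
    rewrite (iv_true ((i, j) = (i, j))) by easy. rewrite !iv_false; [ring| | |].
    + intros E1. apply (f_equal pairs) in E1. unfold pairs, e2, n1, n2 in E1; simpl in E1.
      assert (i = 0%nat) by congruence. assert (j = 1%nat) by congruence. lia.
    + intros E1. apply (f_equal pairs) in E1. unfold pairs, e1, n1, n2 in E1; simpl in E1.
      assert (i = 1%nat) by congruence. assert (j = 0%nat) by congruence. lia.
    + intros E1. apply (f_equal pairs) in E1. unfold pairs, m0, n1, n2 in E1; simpl in E1.
      assert (i = 0%nat) by congruence. assert (j = 0%nat) by congruence. lia.
  - rewrite iv_false by easy. ring.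
Qed.

(** The weight [g] on pairs is arbitrary, so that the real and imaginary parts of the expansion
    share one proof. *)
Lemma ptil_sum a b (g : nat * nat -> R) : Box a b -> (forall u, Rabs (g u) <= 1) ->
  summable (fun u => ptil (fst u) (snd u) b * a ^ (fst u + snd u) * g u) /\
  tsum (fun u => ptil (fst u) (snd u) b * a ^ (fst u + snd u) * g u)
  = tsum (fun m => chr (As a) (Bs b) m * g (pairs m) * wf m).
Proof.
  intros Hab Hg. assert (HA := box_A eps He a b Hab). assert (HB := box_B eps He a b Hab).
  assert (S0 : summable (fun m => chr (As a) (Bs b) m * g (pairs m) * wf m)).
  { apply summable_mul1; [|now apply summable_wf].
    intros m. apply Rabs_mult_le1; [apply chr_1; lra|auto]. }
  assert (E : forall u, ptil (fst u) (snd u) b * a ^ (fst u + snd u) * g u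
     = tsum (fun m => iv (pairs m = u) * (chr (As a) (Bs b) m * g (pairs m) * wf m))).
  { intros [i j]. simpl.
    transitivity (As a ^ (i + j) * g (i, j) * tsum (fun m => iv (pairs m = (i, j)) * (Bs b ^ n3 m * wf m))).
    - unfold ptil, Ascl, Rdiv. rewrite (Rpow_mult_distr a), pow_inv. field. apply pow_nonzero; lra.
    - rewrite <- tsum_scal.
      + apply tsum_ext; intros m. destruct (pdec (pairs m = (i, j))) as [E1|N].
        * rewrite iv_true by easy. rewrite E1. unfold chr.
          replace (n1 m) with i by (unfold pairs in E1; congruence).
          replace (n2 m) with j by (unfold pairs in E1; congruence). ring.
        * rewrite iv_false by easy. ring.
      + apply summable_mul1; [intros; apply iv_abs|]. apply summable_Bwf, Hab. }
  split.
  - apply summable_ext with (1 := fun u => eq_sym (E u)).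
    destruct S0 as [K HK]. exists K. exact (nle_fibre pairs _ K HK).
  - rewrite (tsum_ext _ _ E). apply (tsum_fibre pairs _ S0).
Qed.

Lemma ptil_00 b : - (eps / 2) < b < eps / 2 -> ptil 0 0 b = Qf b.
Proof.
  intros Hb. assert (B0 := box0 eps He b Hb). unfold Qsol.
  rewrite (Pf_tsum alpha p Ha Hp eps He He16 HeK 0 b B0).
  destruct (ptil_sum 0 b (fun u => cos ((INR (fst u) - INR (snd u)) * 0)) B0) as [_ E].
  { intros; apply Rabs_cos_le1. }
  transitivity (tsum (fun u : nat * nat => iv ((0%nat, 0%nat) = u) * ptil (fst u) (snd u) b)).
  - now rewrite (tsum_single (0%nat, 0%nat) (fun u => ptil (fst u) (snd u) b)).
  - rewrite <- (tsum_ext (fun m => chr (As 0) (Bs b) m * cos ((INR (fst (pairs m)) - INR (snd (pairs m))) * 0) * wf m))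
      by easy.
    rewrite <- E. apply tsum_ext. intros [i j]. simpl. rewrite Rmult_0_r, cos_0.
    destruct (pdec ((0%nat, 0%nat) = (i, j))) as [E1|N].
    + rewrite iv_true by easy. replace i with 0%nat by congruence. replace j with 0%nat by congruence.
      simpl. ring.
    + rewrite iv_false by easy. destruct (i + j)%nat eqn:E2; [|simpl; ring].
      exfalso; apply N. f_equal; lia.
Qed.

(** [adm] omits (0,0), (1,0), (0,1) and the further pairs with difference one. On the latter [ptil]
    vanishes, so only three entries have to be subtracted. *)
Lemma adm_split b (g : nat * nat -> R) u :
  (if adm (fst u) (snd u) then ptil (fst u) (snd u) b * g u else 0) =
  ptil (fst u) (snd u) b * g u - iv ((0%nat, 0%nat) = u) * (ptil (fst u) (snd u) b * g u)
   - iv ((1%nat, 0%nat) = u) * (ptil (fst u) (snd u) b * g u)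
   - iv ((0%nat, 1%nat) = u) * (ptil (fst u) (snd u) b * g u).
Proof.
  destruct u as [i j]; simpl fst; simpl snd. unfold adm.
  destruct (Nat.leb_spec 2 (i + j)) as [H|H].
  - rewrite (iv_false ((0%nat, 0%nat) = _)), (iv_false ((1%nat, 0%nat) = _)), (iv_false ((0%nat, 1%nat) = _));
      try (intros E; assert (i + j < 2)%nat; [|lia]; inversion E; simpl; lia).
    destruct (Nat.eqb_spec i (S j)) as [E1|E1]; simpl.
    + rewrite ptil_dd1; auto; ring.
    + destruct (Nat.eqb_spec j (S i)) as [E2|E2]; simpl; [rewrite ptil_dd1; auto; ring|ring].
  - simpl. destruct i as [|[|i]], j as [|[|j]]; try lia.
    + rewrite iv_true, !iv_false by congruence. ring.
    + rewrite (iv_false ((0%nat, 0%nat) = _)), (iv_false ((1%nat, 0%nat) = _)), iv_true by congruence. ring.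
    + rewrite (iv_false ((0%nat, 0%nat) = _)), iv_true, iv_false by congruence. ring.
Qed.

Lemma adm_has_sum a b (g : nat * nat -> R) : Box a b -> (forall u, Rabs (g u) <= 1) ->
  has_sum (fun u => if adm (fst u) (snd u) then ptil (fst u) (snd u) b * (a ^ (fst u + snd u) * g u) else 0)
    (tsum (fun m => chr (As a) (Bs b) m * g (pairs m) * wf m)
      - Qf b * g (0, 0)%nat - / 2 * a * g (1, 0)%nat - / 2 * a * g (0, 1)%nat).
Proof.
  intros Hab Hg. destruct (ptil_sum a b g Hab Hg) as [S E].
  set (f := fun u => ptil (fst u) (snd u) b * (a ^ (fst u + snd u) * g u)).
  assert (Sf : summable f) by (apply summable_ext with (2 := S); intros; unfold f; ring).
  assert (Ef : tsum f = tsum (fun m => chr (As a) (Bs b) m * g (pairs m) * wf m)).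
  { rewrite <- E. apply tsum_ext; intros; unfold f; ring. }
  assert (Si : forall v : nat * nat, summable (fun u => iv (v = u) * f u)).
  { intros v. apply summable_mul1; [intros; apply iv_abs|easy]. }
  apply has_sum_ext with (fun u => f u - iv ((0, 0)%nat = u) * f u - iv ((1, 0)%nat = u) * f u
     - iv ((0, 1)%nat = u) * f u).
  { intros u. symmetry. apply (adm_split b (fun u => a ^ (fst u + snd u) * g u)). }
  evar_last.
  - apply tsum_correct.
    apply summable_ext with (fun u => f u + -1 * (iv ((0, 0)%nat = u) * f u) + -1 * (iv ((1, 0)%nat = u) * f u)
     + -1 * (iv ((0, 1)%nat = u) * f u)); [intros; ring|].
    auto using summable_plus, summable_scal.
  - rewrite (tsum_ext _ (fun u => f u + -1 * (iv ((0, 0)%nat = u) * f u) + -1 * (iv ((1, 0)%nat = u) * f u)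
     + -1 * (iv ((0, 1)%nat = u) * f u))) by (intros; ring).
    rewrite !tsum_plus, !tsum_scal, !tsum_single, Ef by auto using summable_plus, summable_scal.
    unfold f. simpl fst; simpl snd. rewrite ptil_00 by apply Hab.
    rewrite (ptil_sym 0 1 b) by apply Hab. rewrite ptil_10. simpl. ring.
Qed.

Lemma Pf_expansion a b z : Box a b ->
  filterlim (fun N : nat => Cplus (RtoC (Qf b + a * cos z))
     (sum_n (fun i => sum_n (fun j => if adm i j then
         Cmult (RtoC (ptil i j b * a ^ (i + j))) (eix ((INR i - INR j) * z)) else RtoC 0) N) N))
    eventually (locally (RtoC (Pf a b z))).
Proof.
  intros Hab.
  set (gc := fun u : nat * nat => cos ((INR (fst u) - INR (snd u)) * z)).
  set (gs := fun u : nat * nat => sin ((INR (fst u) - INR (snd u)) * z)).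
  assert (Hc := adm_has_sum a b gc Hab (fun u => Rabs_cos_le1 _)).
  assert (Hs := adm_has_sum a b gs Hab (fun u => Rabs_sin_le1 _)).
  apply has_sum_square in Hc. apply has_sum_square in Hs.
  apply C_filterlim.
  - set (T := fun N => sum_n (fun i => sum_n (fun j => if adm i j then ptil i j b * (a ^ (i + j) * gc (i, j)) else 0) N) N).
    apply is_lim_seq_ext with (fun N => (Qf b + a * cos z) + T N).
    + intros N. unfold Cplus, T. cbv beta. cbn [fst RtoC]. f_equal. rewrite C_sum_fst. apply sum_n_ext; intros i.
      rewrite C_sum_fst. apply sum_n_ext; intros j. destruct (adm i j); simpl; [|easy].
      unfold gc; simpl. ring.
    + evar_last.
      * apply is_lim_seq_plus'; [apply is_lim_seq_const|exact Hc].
      * f_equal. rewrite (Pf_tsum alpha p Ha Hp eps He He16 HeK a b Hab).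
        rewrite (tsum_ext (fun m => chr (As a) (Bs b) m * gc (pairs m) * wf m)
          (fun m => phi (As a) (Bs b) z m * wf m)) by easy.
        unfold gc; simpl.
        replace ((0 - 0) * z) with 0 by ring. replace ((1 - 0) * z) with z by ring.
        replace ((0 - 1) * z) with (- z) by ring. rewrite cos_0, cos_neg. field.
  (* The imaginary part: the sine sum vanishes by the reflection symmetry, and the contributions of
     (1,0) and (0,1) cancel. *)
  - set (T := fun N => sum_n (fun i => sum_n (fun j => if adm i j then ptil i j b * (a ^ (i + j) * gs (i, j)) else 0) N) N).
    apply is_lim_seq_ext with (fun N => 0 + T N).
    + intros N. unfold Cplus, T. cbv beta. cbn [snd RtoC]. f_equal. rewrite C_sum_snd. apply sum_n_ext; intros i.
      rewrite C_sum_snd. apply sum_n_ext; intros j. destruct (adm i j); simpl; [|easy].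
      unfold gs; simpl. ring.
    + evar_last.
      * apply is_lim_seq_plus'; [apply is_lim_seq_const|exact Hs].
      * f_equal.
        rewrite (tsum_ext (fun m => chr (As a) (Bs b) m * gs (pairs m) * wf m)
          (fun m => psi (As a) (Bs b) z m * wf m)) by easy.
        rewrite psi_sym; [|intros; now apply wf_sw|now apply summable_psi_wf].
        unfold gs; simpl.
        replace ((0 - 0) * z) with 0 by ring. replace ((1 - 0) * z) with z by ring.
        replace ((0 - 1) * z) with (- z) by ring. rewrite sin_0, sin_neg. field.
Qed.

Lemma Box_a0 a : Rabs a < eps -> Box a 0.
Proof. intros H. apply Rabs_def2 in H. split; lra. Qed.

(** At b = 0 only monomials (i,i,0) contribute. The one with i = 0 has coefficient 0 in [w] by
    [w_m0], and every other carries A^2. *)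
Lemma cz_0 a : Rabs a < eps -> Rabs (cz a 0 0 - 1) <= eps * 4 / (2 * eps) ^ 2 * a ^ 2.
Proof.
  intros H. assert (Hab := Box_a0 a H). assert (HA := box_A eps He a 0 Hab).
  replace (cz a 0 0) with (cf a 0 0%nat) by easy. unfold cosc. rewrite (Bs_0 eps He).
  assert (Sw : summable (fun m => iv (dd m = 0%nat) * chr (As a) 0 m * w m)).
  { apply summable_mul1; [|now apply summable_w]. intros m. apply Rabs_mult_le1; [apply iv_abs|].
    apply chr_1; [lra|rewrite Rabs_R0; lra]. }
  assert (E : tsum (fun m => iv (dd m = 0%nat) * (chr (As a) 0 m * wf m)) =
     1 + eps * tsum (fun m => iv (dd m = 0%nat) * chr (As a) 0 m * w m)).
  { rewrite (tsum_ext _ (fun m => iv (m0 = m) * (iv (dd m = 0%nat) * chr (As a) 0 m)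
      + eps * (iv (dd m = 0%nat) * chr (As a) 0 m * w m))) by (intros; unfold wfull; ring).
    rewrite tsum_plus, tsum_scal, tsum_single; auto using summable_scal.
    - rewrite iv_true by easy. unfold chr, m0, n1, n2, n3; simpl. ring.
    - eexists; apply nle_single. }
  rewrite E.
  replace (1 + eps * tsum (fun m => iv (dd m = 0%nat) * chr (As a) 0 m * w m) - 1)
    with (eps * tsum (fun m => iv (dd m = 0%nat) * chr (As a) 0 m * w m)) by ring.
  rewrite Rabs_mult, (Rabs_pos_eq eps) by lra.
  apply Rle_trans with (eps * (As a ^ 2 * 4)).
  - apply Rmult_le_compat_l; [lra|]. apply tsum_Rabs.
    apply nle_dom with (g := fun m => As a ^ 2 * w m).
    + intros m. rewrite !Rabs_mult. rewrite (Rabs_pos_eq (As a ^ 2)) by apply pow2_ge_0.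
      destruct (pdec (dd m = 0%nat)) as [D|D].
      2:{ rewrite iv_false, Rabs_R0 by easy. rewrite !Rmult_0_l.
          apply Rmult_le_pos; [apply pow2_ge_0|apply Rabs_pos]. }
      rewrite iv_true, Rabs_R1, Rmult_1_l by easy.
      destruct m as [[i j] l]. unfold dd, n1, n2 in D; cbn [fst snd] in D.
      assert (j = i) by lia. subst j. unfold chr, n1, n2, n3; cbn [fst snd].
      destruct l as [|l].
      2:{ simpl (0 ^ S l). rewrite Rmult_0_l, Rmult_0_r, Rabs_R0, Rmult_0_l.
          apply Rmult_le_pos; [apply pow2_ge_0|apply Rabs_pos]. }
      destruct i as [|i].
      { assert (W := w_m0 alpha p eps). unfold m0 in W. rewrite W, Rabs_R0, !Rmult_0_r. lra. }
      apply Rmult_le_compat_r; [apply Rabs_pos|].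
      replace (S i + S i)%nat with (2 + (i + i))%nat by lia.
      rewrite pow_add. simpl (0 ^ 0). rewrite Rmult_1_r, Rabs_mult, (Rabs_pos_eq (As a ^ 2)) by apply pow2_ge_0.
      rewrite <- (Rmult_1_r (As a ^ 2)) at 2. apply Rmult_le_compat_l; [apply pow2_ge_0|].
      apply pow_abs_le1; lra.
    + apply nle_weak with (Rabs (As a ^ 2) * 4); [now apply nle_scal, nle_w|].
      rewrite Rabs_pos_eq by apply pow2_ge_0. lra.
  - right. unfold Ascl. field. lra.
Qed.

(** A monomial of frequency j has degree at least |j| in A. *)
Lemma cz_j a j : Rabs a < eps -> (j <> 0)%Z ->
  Rabs (cz a 0 j) <= (1 + 4 * eps) / (2 * eps) ^ Z.abs_nat j * Rabs a ^ Z.abs_nat j.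
Proof.
  intros H Hj. assert (Hab := Box_a0 a H). assert (HA := box_A eps He a 0 Hab).
  rewrite (cz_tsum alpha p Ha Hp eps He He16 HeK a 0 Hab), (Bs_0 eps He).
  apply Rle_trans with (Rabs (As a) ^ Z.abs_nat j * (1 + 4 * eps)).
  - apply tsum_Rabs. apply nle_ext with (f := fun m => iv (kk m = j) * chr (As a) 0 m * wf m); [intros; ring|].
    apply nle_mul; [apply pow_le, Rabs_pos| |now apply nle_wf].
    intros m. destruct (pdec (kk m = j)) as [E|N].
    + rewrite iv_true, Rmult_1_l by easy. unfold chr. rewrite Rabs_mult, <- RPow_abs.
      apply Rle_trans with (Rabs (As a) ^ (n1 m + n2 m) * 1).
      * apply Rmult_le_compat_l; [apply pow_le, Rabs_pos|]. apply pow_abs_le1. rewrite Rabs_R0; lra.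
      * rewrite Rmult_1_r.
        replace (n1 m + n2 m)%nat with (Z.abs_nat j + (n1 m + n2 m - Z.abs_nat j))%nat by (unfold kk in E; lia).
        rewrite pow_add. apply Rle_trans with (Rabs (As a) ^ Z.abs_nat j * 1); [|lra].
        apply Rmult_le_compat_l; [apply pow_le, Rabs_pos|].
        rewrite <- (pow1 (n1 m + n2 m - Z.abs_nat j)). apply pow_incr. split; [apply Rabs_pos|lra].
    + rewrite iv_false, Rmult_0_l, Rabs_R0 by easy. apply pow_le, Rabs_pos.
  - right. unfold Ascl. rewrite Rabs_div, (Rabs_pos_eq (2 * eps)) by lra.
    unfold Rdiv. rewrite (Rpow_mult_distr (Rabs a)), pow_inv. ring.
Qed.

(** The degree n1 + n2 in A has the parity of the frequency n1 - n2. *)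
Lemma cz_opp a b j : Box a b -> cz (- a) b j = (-1) ^ Z.abs_nat j * cz a b j.
Proof.
  intros Hab. rewrite (cz_tsum alpha p Ha Hp eps He He16 HeK a b Hab).
  rewrite (cz_tsum alpha p Ha Hp eps He He16 HeK (- a) b (box_opp eps a b Hab)).
  rewrite <- tsum_scal.
  - apply tsum_ext; intros m. rewrite (As_opp eps He).
    destruct (pdec (kk m = j)) as [E|N].
    + rewrite iv_true by easy. unfold chr. replace (- As a) with (-1 * As a) by ring.
      rewrite Rpow_mult_distr. replace ((-1) ^ (n1 m + n2 m)) with ((-1) ^ Z.abs_nat j); [ring|].
      replace (n1 m + n2 m)%nat with (Z.abs_nat j + 2 * Nat.min (n1 m) (n2 m))%nat by (unfold kk in E; lia).
      rewrite pow_add, pow_1_even. ring.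
    + rewrite iv_false by easy. ring.
  - apply summable_mul1; [intros; apply iv_abs|]. now apply summable_chr_wf.
Qed.
End Expansions.

Theorem theoremA1 (alpha : R) (m n : nat) :
  / 2 < alpha ->
  (0 < n)%nat ->
  (n = 1%nat \/ (Nat.Even m /\ Nat.Odd n)) ->
  1 <= INR m / INR n ->
  let p := INR m / INR n in
  exists a0 b0 : R, 0 < a0 /\ 0 < b0 /\
  exists (Q : R -> R) (k : R -> R -> R) (P : R -> R -> R -> R),
    (* Q_b *)
    (forall b, - b0 < b < b0 -> Qb_spec p b (Q b)) /\
    (* the family of solutions u_{a,b}(x) = P_{a,b}(k_{a,b} x) *)
    (forall a b, box a0 b0 a b ->
       0 < k a b /\
       (forall z, P a b (z + 2 * PI) = P a b z) /\
       (forall z, P a b (- z) = P a b z) /\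
       (forall (j : nat) z, ex_derive_n (P a b) j z) /\
       (forall z, exists v : C, is_frac_lap alpha (P a b) z v /\
          Cplus (Cmult (RtoC (- Rpower (k a b) alpha)) v)
                (RtoC (- P a b z + P a b z * powq m n (P a b z))) = RtoC b)) /\
    (* (i) *)
    analytic2 (box a0 b0) k /\
    (forall a b, box a0 b0 a b -> k (- a) b = k a b) /\
    exists K0 rho0 C0 : R, 0 < K0 /\ a0 < rho0 /\ 0 < C0 /\
    (exists ktil : nat -> R -> R,
       (forall (j : nat) b, - b0 < b < b0 -> (1 <= j)%nat ->
          Rabs (ktil j b) <= K0 / rho0 ^ (2 * j)) /\
       (forall a b, box a0 b0 a b ->
          is_series (fun j : nat => ktil (S j) b * a ^ (2 * S j))
            (Rpower (k a b) alpha - ((p + 1) * Rpower (Q b) p - 1)))) /\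
    (* (ii) *)
    analytic2_H alpha (box a0 b0) (fun a b => four_coef (P a b)) /\
    (exists ptil : nat -> nat -> R -> R,
       (forall (i j : nat) b, - b0 < b < b0 ->
          ptil i j b = ptil j i b /\ Rabs (ptil i j b) <= C0 / rho0 ^ (i + j)) /\
       (forall a b z, box a0 b0 a b ->
          filterlim (fun N : nat =>
              Cplus (RtoC (Q b + a * cos z))
                (sum_n (fun i => sum_n (fun j =>
                   if adm i j then
                     Cmult (RtoC (ptil i j b * a ^ (i + j)))
                           (eix ((INR i - INR j) * z))
                   else RtoC 0) N) N))
            eventually (locally (RtoC (P a b z))))) /\
    (* (iii) *)
    (forall a b (j : Z), box a0 b0 a b -> Im (four_coef (P a b) j) = 0) /\
    (exists C1 d1 : R, 0 < d1 /\ forall a, Rabs a < d1 -> Rabs a < a0 ->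
        Cmod (Cminus (four_coef (P a 0) 0%Z) (RtoC 1)) <= C1 * a ^ 2) /\
    (forall j : Z, j <> 0%Z -> exists C1 d1 : R, 0 < d1 /\ forall a,
        Rabs a < d1 -> Rabs a < a0 ->
        Cmod (four_coef (P a 0) j) <= C1 * Rabs a ^ Z.abs_nat j) /\
    (forall a b (j : Z), box a0 b0 a b ->
        (Z.Even j -> four_coef (P (- a) b) j = four_coef (P a b) j) /\
        (Z.Odd j -> four_coef (P (- a) b) j = Copp (four_coef (P a b) j))).
Proof.
  intros Halpha Hn _ Hp p. change (1 <= p) in Hp.
  assert (Ha : 0 < alpha) by lra.
  pose proof (Kab_pos alpha Ha) as HK. pose proof (Lq_pos p Hp) as HL. pose proof (qp_ge p Hp) as Hq.
  assert (Hia : 0 < / alpha) by now apply Rinv_0_lt_compat.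
  (* The sum of the three thresholds, so that eps = 1 / D satisfies all smallness conditions at
     once. *)
  set (D := 16 * qcst p + 12 * (Kcst alpha * Lcst p) + 2 * (Lcst p * (1 + / alpha))).
  assert (T1 : 0 < 16 * qcst p) by lra.
  assert (T2 : 0 < 12 * (Kcst alpha * Lcst p)) by (repeat apply Rmult_lt_0_compat; lra).
  assert (T3 : 0 < 2 * (Lcst p * (1 + / alpha))) by (repeat apply Rmult_lt_0_compat; lra).
  assert (HD : 0 < D) by (unfold D; lra).
  set (eps := / D).
  assert (He : 0 < eps) by now apply Rinv_0_lt_compat.
  assert (Hle : forall t, t <= D -> eps * t <= 1).
  { intros t Ht. apply Rle_trans with (eps * D); [apply Rmult_le_compat_l; lra|].
    right. unfold eps. apply Rinv_l. lra. }
  assert (He16 : eps * (16 * qcst p) <= 1) by (apply Hle; unfold D; lra).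
  assert (HeK : eps * (12 * (Kcst alpha * Lcst p)) <= 1) by (apply Hle; unfold D; lra).
  assert (Hek : eps * (2 * (Lcst p * (1 + / alpha))) <= 1) by (apply Hle; unfold D; lra).
  clearbody eps. clear Hle.
  (* With these radii |A| = |a| / (2 eps) and |B| = |b| / eps both stay below 1/2. *)
  exists eps, (eps / 2). split; [easy|]. split; [lra|].
  exists (Qsol alpha p eps), (ksol alpha p eps), (Psol alpha p eps).
  split; [intros; now apply Qf_spec|].
  split.
  { intros a b Hab.
    assert (Hr := rapid_cf alpha p Ha Hp eps He He16 HeK a b Hab).
    assert (Hc := Pf_cos alpha p Ha Hp eps He He16 HeK a b Hab).
    split; [apply exp_pos|].
    split; [now apply (cos_series_periodic (cosc alpha p eps a b))|].
    split; [now apply (cos_series_even (cosc alpha p eps a b))|].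
    split; [now apply (cos_series_smooth (cosc alpha p eps a b))|].
    intros z. eexists. split; [apply (frac_lap_cos (cosc alpha p eps a b) Hr _ Hc)|].
    rewrite lam_cos by easy.
    rewrite (kf_pow alpha p Ha Hp eps He He16 HeK Hek a b Hab).
    assert (HP := Pf_pos alpha p Ha Hp eps He He16 HeK a b Hab z).
    assert (Eq := Pf_equation alpha p Ha Hp eps He He16 HeK a b Hab z).
    (* The solution is positive, so [root_odd] takes its first branch and both sides are the same
       real power. *)
    assert (Epow : Psol alpha p eps a b z * powq m n (Psol alpha p eps a b z)
       = Rpower (Psol alpha p eps a b z) (p + 1)).
    { unfold powq, root_odd. destruct Rlt_dec; [|lra].
      rewrite <- Rpower_pow by apply exp_pos. rewrite Rpower_mult.
      replace (/ INR n * INR m) with p by (unfold p, Rdiv; ring).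
      rewrite Rpower_plus, Rpower_1 by lra. ring. }
    rewrite Epow, <- RtoC_mult, <- RtoC_plus. f_equal. lra. }
  split; [now apply kf_analytic|].
  split; [intros; now apply kf_even|].
  (* The l^1 bounds are bounds at A = 1, that is at a = 2 * eps: this is rho0, twice a0. The outer
     two constants bound the norms of the corrections of k^alpha and of the solution. *)
  exists (eps * Lcst p), (2 * eps), (1 + 4 * eps).
  split; [nra|]. split; [lra|]. split; [lra|].
  split.
  { exists (ktil alpha p eps). split.
    - intros j b Hb _. now apply ktil_bound.
    - intros a b Hab. now apply ktil_series. }
  split; [now apply Pf_analytic|].
  split.
  { exists (ptil alpha p eps). split.
    - intros i j b Hb. split; [now apply ptil_sym|now apply ptil_bound].
    - intros a b z Hab. now apply Pf_expansion. }
  split.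
  { intros a b j Hab. now rewrite four_Pf. }
  split.
  { exists (eps * 4 / (2 * eps) ^ 2), 1. split; [lra|]. intros a _ Hae.
    rewrite four_Pf by (try easy; now apply Box_a0). rewrite <- RtoC_minus, Cmod_R. now apply cz_0. }
  split.
  { intros j Hj. exists ((1 + 4 * eps) / (2 * eps) ^ Z.abs_nat j), 1. split; [lra|]. intros a _ Hae.
    rewrite four_Pf by (try easy; now apply Box_a0). rewrite Cmod_R. now apply cz_j. }
  intros a b j Hab. rewrite !four_Pf by (try easy; now apply box_opp). rewrite cz_opp by easy.
  split; intros [q Hq'].
  - replace (Z.abs_nat j) with (2 * Z.abs_nat q)%nat by lia. rewrite pow_1_even. f_equal; ring.
  - rewrite <- RtoC_opp. f_equal.
    (* For q < 0 the absolute value of 2q + 1 is 2 (|q| - 1) + 1, not 2 |q| + 1. *)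
    destruct (Z_le_gt_dec 0 q).
    + replace (Z.abs_nat j) with (S (2 * Z.abs_nat q))%nat by lia. rewrite pow_1_odd. ring.
    + replace (Z.abs_nat j) with (S (2 * (Z.abs_nat q - 1)))%nat by lia. rewrite pow_1_odd. ring.
Qed.
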